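(* Let $V_1,V_2\in\mathcal{UM}$ and let $m_1=\deg(V_1,0)$, $m_2=\deg(V_2,0)$. Suppose that (a) $m_1>2$ or $m_2>2$; or (b) $m_1=m_2=2$ and $V_1(x)=\omega V_2(\tau x)$ for all $x\in\mathbb R$, for some $\omega>0$ and $\tau\neq0$ such that $\sqrt{V_1''(0)/V_2''(0)}=|\tau|\sqrt{\omega}$ is irrational. Then $\mathcal E(P,V_1,V_2)=\emptyset$ for every $P\in\mathcal{RP}$.
   Context: $\mathcal{UM}$ is the family of real-analytic $V:\mathbb R\to\mathbb R_{\ge0}$ with $V(0)=0$, $yV'(y)>0$ for $y\ne0$, and $V(y)\to+\infty$ as $y\to\pm\infty$. For $V\in\mathcal{UM}$, $\deg(V,0)$ is the least $m$ with $V^{(m)}(0)\neq0$ (it is even and $\ge2$). For $V\in\mathcal{UM}$ write $\bar V(y)=V(-y)$ and $V^{-1}:[0,\infty)\to[0,\infty)$ for the inverse of $V|_{[0,\infty)}$. $\mathcal{RP}$ is the family of bounded planar polygons (not necessarily connected or simply connected) whose boundary is a finite union of vertical and horizontal segments; a corner is convex if its interior angle is $90^\circ$ and concave if it is $270^\circ$. Dynamics: for $V_1,V_2\in\mathcal{UM}$ and $P\in\mathcal{RP}$, a particle at $(q_1,q_2)\in P$ with momenta $(p_1,p_2)$ moves by $\dot p_j=-V_j'(q_j)$, $\dot q_j=p_j$ ($j=1,2$) (Hamiltonian $H=p_1^2/2+p_2^2/2+V_1(q_1)+V_2(q_2)$), and reflects elastically: at a vertical side $(p_1,p_2)\mapsto(-p_1,p_2)$,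 at a horizontal side $(p_1,p_2)\mapsto(p_1,-p_2)$, at a convex corner $(p_1,p_2)\mapsto(-p_1,-p_2)$. For $E\ge0$, $0\le\theta\le E$, the invariant set is $S_{E,\theta}=\{(p_1,p_2,q_1,q_2): p_1^2/2+V_1(q_1)=\theta,\ p_2^2/2+V_2(q_2)=E-\theta,\ (q_1,q_2)\in P\}$. The pair $(E,\theta)$ is resonant if the motion on $S_{E,\theta}$ has a resonant orbit, i.e. a periodic orbit, where orbits running between corners count as (singular) resonant orbits; precisely, $(E,\theta)$ is resonant iff some trajectory in $S_{E,\theta}$ joins two (not necessarily distinct) corners of the rectilinear polygon $P\cap\big([-\bar V_1^{-1}(\theta),V_1^{-1}(\theta)]\times[-\bar V_2^{-1}(E-\theta),V_2^{-1}(E-\theta)]\big)$. A number $E>0$ is a resonant energy level if $(E,\theta)$ is resonant for uncountably many $\theta\in(0,E)$; $\mathcal E(P,V_1,V_2)\subset(0,\infty)$ is the set of resonant energy levels. *)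

(* Defs.v *)
From Stdlib Require Import Reals Lra List QArith.
From Coquelicot Require Import Coquelicot.
Open Scope R_scope.

Definition real_analytic (V : R -> R) : Prop :=
  forall x0 : R, exists r : R, 0 < r /\ exists a : nat -> R,
    forall x : R, Rabs (x - x0) < r -> is_pseries a (x - x0) (V x).

Definition UM (V : R -> R) : Prop :=
  real_analytic V /\
  (forall y, 0 <= V y) /\
  V 0 = 0 /\
  (forall y, y <> 0 -> 0 < y * Derive V y) /\
  is_lim V p_infty p_infty /\
  is_lim V m_infty p_infty.

Definition is_deg0 (V : R -> R) (m : nat) : Prop :=
  Derive_n V m 0 <> 0 /\ (forall k : nat, (k < m)%nat -> Derive_n V k 0 = 0).

Definition irrational (r : R) : Prop := forall q : Q, Q2R q <> r.

Definition is_RP (P : R -> R -> Prop) : Prop :=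
  exists l : list (R * R * R * R),
    (forall a b c d, In (a, b, c, d) l -> a < b /\ c < d) /\
    (forall x y, P x y <->
       exists a b c d, In (a, b, c, d) l /\ a <= x <= b /\ c <= y <= d).

Definition sgn (s : bool) : R := if s then 1 else -1.

Definition quad (Q : R -> R -> Prop) (x y : R) (s1 s2 : bool) : Prop :=
  exists eps, 0 < eps /\ forall a b, 0 < a < eps -> 0 < b < eps ->
    Q (x + sgn s1 * a) (y + sgn s2 * b).

Definition dep_only_s1 Q x y : Prop :=
  forall s1, (quad Q x y s1 true <-> quad Q x y s1 false).
Definition dep_only_s2 Q x y : Prop :=
  forall s2, (quad Q x y true s2 <-> quad Q x y false s2).

(** corner: the boundary is not locally a straight line (interior angle 90 or 270) *)
Definition corner (Q : R -> R -> Prop) (x y : R) : Prop :=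
  Q x y /\ ~ dep_only_s1 Q x y /\ ~ dep_only_s2 Q x y.

Definition convex_corner (Q : R -> R -> Prop) (x y : R) : Prop :=
  Q x y /\ exists s1 s2, quad Q x y s1 s2 /\
    forall t1 t2, quad Q x y t1 t2 -> t1 = s1 /\ t2 = s2.

(** point of a vertical side: locally Q is a half-plane {x' >= x} or {x' <= x} *)
Definition vside (Q : R -> R -> Prop) (x y : R) : Prop :=
  Q x y /\ dep_only_s1 Q x y /\ ~ (quad Q x y true true <-> quad Q x y false true).
Definition hside (Q : R -> R -> Prop) (x y : R) : Prop :=
  Q x y /\ dep_only_s2 Q x y /\ ~ (quad Q x y true true <-> quad Q x y true false).

Definition reflection_law (P : R -> R -> Prop) (x y u1 u2 w1 w2 : R) : Prop :=
  (w1 = u1 /\ w2 = u2) \/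
  (vside P x y /\ w1 = - u1 /\ w2 = u2) \/
  (hside P x y /\ w1 = u1 /\ w2 = - u2) \/
  (convex_corner P x y /\ w1 = - u1 /\ w2 = - u2).

Definition trajectory (V1 V2 : R -> R) (P : R -> R -> Prop) (E th T : R)
    (q1 q2 p1 p2 : R -> R) : Prop :=
  0 < T /\
  (forall t, 0 <= t <= T ->
     P (q1 t) (q2 t) /\
     p1 t ^ 2 / 2 + V1 (q1 t) = th /\
     p2 t ^ 2 / 2 + V2 (q2 t) = E - th) /\
  filterlim q1 (at_right 0) (locally (q1 0)) /\
  filterlim q2 (at_right 0) (locally (q2 0)) /\
  filterlim q1 (at_left T) (locally (q1 T)) /\
  filterlim q2 (at_left T) (locally (q2 T)) /\
  exists ts : list R,
    (forall s, In s ts -> 0 < s < T) /\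
    (forall t, 0 < t < T -> ~ In t ts ->
       is_derive q1 t (p1 t) /\ is_derive q2 t (p2 t) /\
       is_derive p1 t (- Derive V1 (q1 t)) /\ is_derive p2 t (- Derive V2 (q2 t))) /\
    (forall s, In s ts ->
       continuous q1 s /\ continuous q2 s /\
       exists u1 u2 w1 w2,
         filterlim p1 (at_left s) (locally u1) /\
         filterlim p2 (at_left s) (locally u2) /\
         filterlim p1 (at_right s) (locally w1) /\
         filterlim p2 (at_right s) (locally w2) /\
         reflection_law P (q1 s) (q2 s) u1 u2 w1 w2).

(** membership in [-Vbar^{-1}(h), V^{-1}(h)], with Vbar(y) = V(-y) *)
Definition in_hill (V : R -> R) (h x : R) : Prop :=
  exists a b, 0 <= a /\ V a = h /\ 0 <= b /\ V (- b) = h /\ - b <= x <= a.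

Definition trunc_poly (V1 V2 : R -> R) (P : R -> R -> Prop) (E th : R) : R -> R -> Prop :=
  fun x y => P x y /\ in_hill V1 th x /\ in_hill V2 (E - th) y.

Definition resonant (V1 V2 : R -> R) (P : R -> R -> Prop) (E th : R) : Prop :=
  exists T q1 q2 p1 p2,
    trajectory V1 V2 P E th T q1 q2 p1 p2 /\
    corner (trunc_poly V1 V2 P E th) (q1 0) (q2 0) /\
    corner (trunc_poly V1 V2 P E th) (q1 T) (q2 T).

Definition countable_set (A : R -> Prop) : Prop :=
  exists f : nat -> R, forall x, A x -> exists n, f n = x.

Definition resonant_energy_level (V1 V2 : R -> R) (P : R -> R -> Prop) (E : R) : Prop :=
  0 < E /\ ~ countable_set (fun th => 0 < th < E /\ resonant V1 V2 P E th).

(* Main.v *)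
(** Each coordinate moves in its own potential, with energies [th] and [E - th], and is reflected
    only at one of finitely many abscissae.  So the duration of a trajectory between two corners
    equals, for either coordinate, an integer combination of the times of flight from [0] to these
    abscissae plus a combination with natural coefficients of the two times of flight from [0] to
    the turning points ([quarter V] and [quarter (refl V)]).  For fixed coefficients both durations
    are real-analytic in [th] as long as the abscissae used lie strictly inside the wells; hence they
    agree for countably many [th] only, or identically.

    Suppose they agree identically.  At the largest level [al = V x] of an abscissa used by the first
    coordinate, the times of flight have a square-root singularity in [th - al], whereas the duration
    for the second coordinate is analytic there.  The singular part must vanish, and then the terms of
    level [al] cancel identically, so they can be dropped and the identity extends to the next level,
    finally down to [th = 0].  If [V] is flat ([V'' 0 = 0]), the quarter periods blow up at [th = 0]
    while the other side stays bounded, so their coefficients are zero and the duration is zero.  In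
    the case [V1 x = omega * V2 (tau * x)], regularity at energy [0] (after the substitution
    [th = s^2], exchanging the two quarter periods means [s -> - s]) shows that only the half period
    matters; at the energy split [th = omega * (E - th)] the two half periods have the irrational
    ratio [|tau| * sqrt omega], so again all coefficients vanish. *)

Require Import Defs.
From Stdlib Require Import Reals QArith.
From Stdlib Require Import Ranalysis5 Lra Lia List Wf_nat Cantor.
From Stdlib Require Import Classical ClassicalEpsilon FunctionalExtensionality.
From Coquelicot Require Import Coquelicot.
Open Scope R_scope.

(** Everything stays on the real line: analyticity is obtained from estimates on Taylor
    coefficients. If [x' = phi x], the derivatives of [g x] are iterated Lie derivatives of [g], and
    bounds on these cover recentred series and inverse functions; reciprocals and square roots come
    from coefficient recursions. The singularity of a time of flight to level [v] is made explicit
    by the quarter period, which is analytic at every positive energy. Cut at level [v], the quarter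
    period at energy [v + x] consists of that time of flight and of the momentum integral
    [sqrt (2 * x) * abel (dpinv V) v x]. The Abel integral multiplies each Taylor coefficient by a
    positive number, so a vanishing singular part forces a linear relation between the derivatives
    of the two inverse branches of the well, near [v] and hence at all levels. This is why
    regularity at one energy gives cancellation at all higher ones. Quarter periods get natural
    coefficients because a turning point is always reached by outward motion. This sign forbids
    cancellation in the flat case, and in the irrational case it turns a vanishing sum of
    coefficients into vanishing coefficients. *)

(** * Weighted absolute sums of Taylor coefficients *)

Definition bnd (a : nat -> R) (r M : R) : Prop :=
  forall n, sum_f_R0 (fun k => Rabs (a k) * r ^ k) n <= M.

Lemma sum_f_R0_nonneg (u : nat -> R) n :
  (forall k, (k <= n)%nat -> 0 <= u k) -> 0 <= sum_f_R0 u n.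
Proof.
  induction n as [|n IH]; intros H; simpl.
  - apply H; lia.
  - apply Rplus_le_le_0_compat; [apply IH; intros; apply H; lia | apply H; lia].
Qed.

Lemma bnd_term a r M n : 0 <= r -> bnd a r M -> Rabs (a n) * r ^ n <= M.
Proof.
  intros Hr H. specialize (H n).
  assert (Hp : forall k, 0 <= Rabs (a k) * r ^ k)
    by (intros k; apply Rmult_le_pos; [apply Rabs_pos | now apply pow_le]).
  destruct n as [|n]; simpl in *; [exact H|].
  assert (0 <= sum_f_R0 (fun k => Rabs (a k) * r ^ k) n)
    by (apply sum_f_R0_nonneg; auto).
  lra.
Qed.

Lemma bnd_nonneg a r M : bnd a r M -> 0 <= M.
Proof.
  intros H. specialize (H 0%nat). simpl in H. pose proof (Rabs_pos (a 0%nat)). lra.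
Qed.

Lemma CV_radius_ge_term a r M :
  0 <= r -> (forall n, Rabs (a n) * r ^ n <= M) -> Rbar_le r (CV_radius a).
Proof.
  intros Hr H. apply (proj1 (CV_radius_bounded a)). exists M. intros n.
  rewrite Rabs_mult, (Rabs_pos_eq (r ^ n)) by now apply pow_le. apply H.
Qed.

Lemma bnd_radius a r M : 0 <= r -> bnd a r M -> Rbar_le r (CV_radius a).
Proof.
  intros Hr H. apply (CV_radius_ge_term a r M Hr). intros n; now apply bnd_term.
Qed.

Lemma bnd_radius_lt a r M x : bnd a r M -> Rabs x < r -> Rbar_lt (Rabs x) (CV_radius a).
Proof.
  intros H Hx. eapply Rbar_lt_le_trans; [|apply (bnd_radius a r M); [|exact H]].
  - exact Hx.
  - pose proof (Rabs_pos x). lra.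
Qed.

Lemma bnd_of_radius a r : 0 <= r -> Rbar_lt r (CV_radius a) -> exists M, bnd a r M.
Proof.
  intros Hr H.
  assert (Hs : ex_series (fun n => Rabs (a n) * r ^ n)).
  { apply (ex_series_ext (fun n => Rabs (a n * r ^ n))).
    - intros n. rewrite Rabs_mult. f_equal. apply Rabs_pos_eq. now apply pow_le.
    - apply CV_disk_inside. now rewrite Rabs_pos_eq. }
  exists (Series (fun n => Rabs (a n) * r ^ n)). intros n.
  rewrite <- sum_n_Reals.
  apply (is_lim_seq_incr_compare (sum_n (fun k => Rabs (a k) * r ^ k))).
  - destruct Hs as [l Hl]. erewrite is_series_unique by exact Hl. exact Hl.
  - intros k. rewrite sum_Sn. unfold plus; simpl.
    assert (0 <= Rabs (a (S k)) * (r * r ^ k)).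
    { apply Rmult_le_pos; [apply Rabs_pos|]. apply Rmult_le_pos; [lra | now apply pow_le]. }
    lra.
Qed.

Lemma bnd_of_geom a M L : 0 < L -> (forall n, Rabs (a n) <= M * L ^ n) ->
  Rbar_le (/ L) (CV_radius a).
Proof.
  intros HL H. apply (CV_radius_ge_term a (/ L) M).
  - left. now apply Rinv_0_lt_compat.
  - intros n. rewrite pow_inv. apply (Rmult_le_reg_r (L ^ n)); [now apply pow_lt|].
    rewrite Rmult_assoc, Rinv_l, Rmult_1_r; [apply H|]. apply pow_nonzero. lra.
Qed.

Lemma bnd_le a r r' M : 0 <= r' <= r -> bnd a r M -> bnd a r' M.
Proof.
  intros Hr H n. eapply Rle_trans; [|apply (H n)]. apply sum_Rle. intros k _.
  apply Rmult_le_compat_l; [apply Rabs_pos|]. now apply pow_incr.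
Qed.

Lemma sum_cauchy_product (A B : nat -> R) N :
  sum_f_R0 (fun n => sum_f_R0 (fun k => A k * B (n - k)%nat) n) N =
  sum_f_R0 (fun k => A k * sum_f_R0 B (N - k)) N.
Proof.
  induction N as [|N IH]; [simpl; ring|].
  rewrite tech5, IH, (tech5 (fun k => A k * sum_f_R0 B (S N - k))), (tech5 (fun k => A k * B (S N - k)%nat)).
  rewrite Nat.sub_diag. change (sum_f_R0 B 0) with (B 0%nat).
  rewrite <- !Rplus_assoc. f_equal.
  rewrite <- sum_plus. apply sum_eq. intros k Hk.
  replace (S N - k)%nat with (S (N - k)) by lia. simpl. ring.
Qed.

(** Absolute sums weighted by [r ^ k] are submultiplicative under the Cauchy product, with no loss
    of radius; bounds on single terms would cost a factor growing with the index. *)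
Lemma bnd_mult a b r M M' : 0 <= r -> bnd a r M -> bnd b r M' ->
  bnd (PS_mult a b) r (M * M').
Proof.
  intros Hr Ha Hb N.
  pose proof (bnd_nonneg _ _ _ Ha). pose proof (bnd_nonneg _ _ _ Hb).
  pose (A := fun k => Rabs (a k) * r ^ k). pose (B := fun k => Rabs (b k) * r ^ k).
  apply Rle_trans with (sum_f_R0 (fun n => sum_f_R0 (fun k => A k * B (n - k)%nat) n) N).
  - apply sum_Rle. intros n _. unfold PS_mult.
    eapply Rle_trans; [apply Rmult_le_compat_r; [now apply pow_le | apply Rsum_abs]|].
    rewrite Rmult_comm, scal_sum. right. apply sum_eq. intros k Hk.
    rewrite Rabs_mult. replace (r ^ n) with (r ^ k * r ^ (n - k)) by (rewrite <- pow_add; f_equal; lia).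
    unfold A, B. ring.
  - rewrite sum_cauchy_product.
    apply Rle_trans with (sum_f_R0 (fun k => A k * M') N).
    + apply sum_Rle. intros k _. apply Rmult_le_compat_l; [|apply Hb].
      apply Rmult_le_pos; [apply Rabs_pos | now apply pow_le].
    + rewrite <- scal_sum, Rmult_comm. apply Rmult_le_compat_r; [auto | apply Ha].
Qed.

Lemma pow_add_ge (x d : R) n : 0 <= x -> 0 <= d ->
  x ^ S n + INR (S n) * x ^ n * d <= (x + d) ^ S n.
Proof.
  intros Hx Hd. induction n as [|n IH]; [simpl; lra|].
  assert (0 <= x ^ n) by now apply pow_le.
  replace ((x + d) ^ S (S n)) with ((x + d) * (x + d) ^ S n) by reflexivity.
  apply Rle_trans with ((x + d) * (x ^ S n + INR (S n) * x ^ n * d)).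
  - rewrite (S_INR (S n)). simpl pow.
    assert (0 <= INR (S n) * x ^ n * d * d).
    { repeat apply Rmult_le_pos; auto. apply pos_INR. }
    nra.
  - apply Rmult_le_compat_l; lra.
Qed.

(** A Cauchy estimate with constant 1: by the first two binomial terms, [(n + 1) * (r - d) ^ n * d]
    is at most [r ^ (n + 1)]. *)
Lemma bnd_derive a r d M : 0 < d -> d <= r -> bnd a r M -> bnd (PS_derive a) (r - d) (M / d).
Proof.
  intros Hd Hdr H N. specialize (H (S N)). rewrite decomp_sum in H by lia. simpl pred in H.
  apply (Rmult_le_reg_r d); [exact Hd|].
  replace (M / d * d) with M by (field; lra).
  rewrite Rmult_comm, scal_sum.
  eapply Rle_trans; [|exact H].
  assert (0 <= Rabs (a 0%nat) * r ^ 0) by (simpl; pose proof (Rabs_pos (a 0%nat)); lra).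
  eapply Rle_trans; [|apply Rplus_le_compat_r; eassumption]. rewrite Rplus_0_l.
  apply sum_Rle. intros n _. unfold PS_derive.
  rewrite Rabs_mult, (Rabs_pos_eq (INR _)) by apply pos_INR.
  pose proof (pow_add_ge (r - d) d n ltac:(lra) ltac:(lra)) as Hp.
  replace (r - d + d) with r in Hp by ring.
  assert (0 <= (r - d) ^ S n) by (apply pow_le; lra).
  replace (INR (S n) * Rabs (a (S n)) * (r - d) ^ n * d) with
    (Rabs (a (S n)) * (INR (S n) * (r - d) ^ n * d)) by ring.
  apply Rmult_le_compat_l; [apply Rabs_pos | lra].
Qed.

Lemma bnd_value a r M x : bnd a r M -> Rabs x < r -> Rabs (PSeries a x) <= M.
Proof.
  intros H Hx.
  assert (Hr : Rbar_lt (Rabs x) (CV_radius a)) by (eapply bnd_radius_lt; eauto).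
  assert (Hs : is_lim_seq (sum_n (fun k => a k * x ^ k)) (PSeries a x)).
  { apply Series_correct. apply ex_series_Rabs. now apply CV_disk_inside. }
  apply (is_lim_seq_le (fun n => Rabs (sum_n (fun k => a k * x ^ k) n)) (fun _ => M) (Rabs (PSeries a x)) M).
  - intros n. eapply Rle_trans; [|apply (H n)]. rewrite sum_n_Reals.
    eapply Rle_trans; [apply Rsum_abs|]. apply sum_Rle. intros k _.
    rewrite Rabs_mult. apply Rmult_le_compat_l; [apply Rabs_pos|].
    rewrite <- RPow_abs. apply pow_incr. pose proof (Rabs_pos x). lra.
  - apply (is_lim_seq_abs _ (PSeries a x)). exact Hs.
  - apply is_lim_seq_const.
Qed.

Lemma exp_pow_INR x n : exp x ^ n = exp (INR n * x).
Proof.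
  induction n as [|n IH]; [simpl; now rewrite Rmult_0_l, exp_0|].
  simpl pow. rewrite IH, <- exp_plus, S_INR. f_equal. ring.
Qed.

(** The quotient [n ^ n / n!] is one term of the series of [exp n], and [exp 1 <= 3]. The power
    [n ^ n] arises when a radius is shared out among [n] derivatives. *)
Lemma pow_n_n_le_fact (n : nat) : INR n ^ n <= 3 ^ n * INR (Factorial.fact n).
Proof.
  pose proof (INR_fact_lt_0 n) as Hf. pose proof (pos_INR n) as Hn.
  apply (Rmult_le_reg_r (/ INR (Factorial.fact n))); [now apply Rinv_0_lt_compat|].
  rewrite Rmult_assoc, Rinv_r, Rmult_1_r by lra.
  apply Rle_trans with (exp (INR n)).
  - assert (H := exp_ge_taylor (INR n) n Hn). destruct n as [|n]; [exact H|].
    rewrite tech5 in H. eapply Rle_trans; [|exact H]. rewrite <- (Rplus_0_l (_ * _)).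
    apply Rplus_le_compat_r, sum_f_R0_nonneg. intros k _.
    apply Rmult_le_pos; [now apply pow_le | left; apply Rinv_0_lt_compat, INR_fact_lt_0].
  - rewrite <- (Rmult_1_r (INR n)), <- exp_pow_INR. apply pow_incr.
    split; [left; apply exp_pos | apply exp_le_3].
Qed.

Ltac Rmin_bounds a b := pose proof (Rmin_l a b); pose proof (Rmin_r a b).

Lemma locally_between (l u x : R) (Q : R -> Prop) :
  l < x < u -> (forall y, l < y < u -> Q y) -> locally x Q.
Proof.
  intros Hx H. assert (He : 0 < Rmin (x - l) (u - x)) by (apply Rmin_pos; lra).
  exists (mkposreal _ He). intros y Hy. apply H.
  change (Rabs (y - x) < Rmin (x - l) (u - x)) in Hy.
  Rmin_bounds (x - l) (u - x).
  apply Rabs_def2 in Hy. lra.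
Qed.

Lemma min4_pos a b c d : 0 < a -> 0 < b -> 0 < c -> 0 < d ->
  exists m, 0 < m /\ m <= a /\ m <= b /\ m <= c /\ m <= d.
Proof.
  intros. exists (Rmin (Rmin a b) (Rmin c d)).
  split; [now repeat apply Rmin_pos|].
  Rmin_bounds (Rmin a b) (Rmin c d).
  Rmin_bounds a b. Rmin_bounds c d. lra.
Qed.

Lemma ex_derive_cont (f : R -> R) x : ex_derive f x -> continuous f x.
Proof. apply (ex_derive_continuous (V := R_NormedModule)). Qed.

Lemma is_derive_cont (f : R -> R) x l : is_derive f x l -> continuous f x.
Proof. intros H. apply ex_derive_cont. now exists l. Qed.

(** * Taylor expansion along a chain of derivatives *)

Lemma Derive_n_chain (f : nat -> R -> R) l u :
  (forall n v, l < v < u -> is_derive (f n) v (f (S n) v)) ->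
  forall n v, l < v < u -> Derive_n (f 0%nat) n v = f n v /\ ex_derive_n (f 0%nat) n v.
Proof.
  intros H n. induction n as [|n IH]; intros v Hv; [simpl; auto|].
  assert (Hd : is_derive (Derive_n (f 0%nat) n) v (f (S n) v)).
  { apply (is_derive_ext_loc (f n)); [|now apply H].
    apply (locally_between l u); [exact Hv|]. intros y Hy. symmetry. now apply IH. }
  split; simpl; [now apply is_derive_unique | eexists; exact Hd].
Qed.

Lemma taylor_chain_right (f : nat -> R -> R) l u y z n :
  (forall n v, l < v < u -> is_derive (f n) v (f (S n) v)) ->
  l < y -> y < z -> z < u ->
  exists zeta, l < zeta < u /\
   f 0%nat z - sum_f_R0 (fun m => f m y / INR (Factorial.fact m) * (z - y) ^ m) n =
   (z - y) ^ S n / INR (Factorial.fact (S n)) * f (S n) zeta.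
Proof.
  intros H Hy Hyz Hz.
  destruct (Taylor_Lagrange (f 0%nat) n y z Hyz) as [zeta [Hzeta E]].
  { intros t Ht k _. apply (Derive_n_chain f l u H). lra. }
  exists zeta. split; [lra|]. rewrite E.
  rewrite (proj1 (Derive_n_chain f l u H (S n) zeta ltac:(lra))).
  match goal with |- ?A + ?B - ?C = ?B => enough (A = C) by lra end.
  apply sum_eq. intros k _. rewrite (proj1 (Derive_n_chain f l u H k y ltac:(lra))).
  unfold Rdiv. ring.
Qed.

Lemma taylor_chain (f : nat -> R -> R) l u y z n :
  (forall n v, l < v < u -> is_derive (f n) v (f (S n) v)) ->
  l < y < u -> l < z < u ->
  exists zeta, l < zeta < u /\
   Rabs (f 0%nat z - sum_f_R0 (fun m => f m y / INR (Factorial.fact m) * (z - y) ^ m) n) =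
   Rabs (z - y) ^ S n / INR (Factorial.fact (S n)) * Rabs (f (S n) zeta).
Proof.
  intros H Hy Hz.
  destruct (Rtotal_order y z) as [Hyz|[<-|Hyz]].
  - destruct (taylor_chain_right f l u y z n) as [zeta [Hzeta E]]; [easy|lra..|].
    exists zeta. split; [easy|]. rewrite E, Rabs_mult, Rabs_div, RPow_abs.
    + rewrite (Rabs_pos_eq (INR _)) by apply pos_INR. reflexivity.
    + apply INR_fact_neq_0.
  - exists y. split; [easy|]. rewrite Rminus_diag, Rabs_R0. simpl pow. rewrite Rmult_0_l.
    unfold Rdiv at 2. rewrite !Rmult_0_l.
    replace (sum_f_R0 _ n) with (f 0%nat y); [rewrite Rminus_diag; apply Rabs_R0|].
    symmetry. induction n as [|n IH]; [simpl; field|].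
    rewrite tech5, IH. simpl pow. ring.
  (* Expansion to the left is reflected into expansion to the right; the derivatives of
     [v -> f (- v)] form this chain. *)
  - pose (g := fun n v => (-1) ^ n * f n (- v)).
    destruct (taylor_chain_right g (-u) (-l) (-y) (-z) n) as [zeta [Hzeta E]]; [|lra..|].
    { intros k v Hv. unfold g.
      replace ((-1) ^ S k * f (S k) (- v)) with ((-1) ^ k * (-1 * f (S k) (- v))) by (simpl; ring).
      apply is_derive_scal. apply (is_derive_comp (f k) Ropp).
      - apply H. lra.
      - auto_derive; auto. }
    exists (- zeta). split; [lra|].
    assert (E1 : forall m, g m (- y) / INR (Factorial.fact m) * (- z - - y) ^ m
       = f m y / INR (Factorial.fact m) * (z - y) ^ m).
    { intros m. unfold g. replace (- z - - y) with (-1 * (z - y)) by ring.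
      rewrite Rpow_mult_distr, Ropp_involutive.
      replace ((-1) ^ m * f m y / INR (Factorial.fact m) * ((-1) ^ m * (z - y) ^ m)) with
        (((-1) ^ m * (-1) ^ m) * (f m y / INR (Factorial.fact m) * (z - y) ^ m)) by (unfold Rdiv; ring).
      rewrite <- Rpow_mult_distr. replace (-1 * -1) with 1 by ring. rewrite pow1. ring. }
    rewrite (sum_eq _ _ n (fun m _ => E1 m)) in E.
    unfold g at 1 in E. rewrite Ropp_involutive in E. simpl (_ ^ 0) in E. rewrite Rmult_1_l in E.
    rewrite E, Rabs_mult, Rabs_div by apply INR_fact_neq_0.
    rewrite (Rabs_pos_eq (INR _)) by apply pos_INR.
    rewrite <- RPow_abs. replace (- z - - y) with (- (z - y)) by ring. rewrite Rabs_Ropp.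
    f_equal. unfold g. rewrite Rabs_mult, pow_1_abs. ring.
Qed.

(** The Lagrange remainder is at most [C * q ^ (n + 1)] with [q = K * Rabs (z - y) < 1]. The radius
    [/ K] is common to all centres [y]. *)
Lemma is_pseries_of_bounds (f : nat -> R -> R) l u C K :
  0 < K ->
  (forall n v, l < v < u -> is_derive (f n) v (f (S n) v)) ->
  (forall n v, l < v < u -> Rabs (f n v) <= C * K ^ n * INR (Factorial.fact n)) ->
  forall y z, l < y < u -> l < z < u -> Rabs (z - y) < / K ->
  is_pseries (fun n => f n y / INR (Factorial.fact n)) (z - y) (f 0%nat z).
Proof.
  intros HK Hd Hb y z Hy Hz Hyz. apply is_pseries_R.
  set (q := K * Rabs (z - y)).
  assert (Hq : 0 <= q < 1).
  { unfold q. pose proof (Rabs_pos (z - y)). split; [nra|].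
    apply (Rmult_lt_compat_l K) in Hyz; [|easy]. rewrite Rinv_r in Hyz; lra. }
  change (is_lim_seq (sum_n (fun n => f n y / INR (Factorial.fact n) * (z - y) ^ n)) (f 0%nat z)).
  apply is_lim_seq_ext with (fun n => f 0%nat z - (f 0%nat z -
    sum_n (fun n => f n y / INR (Factorial.fact n) * (z - y) ^ n) n)); [intros n; ring|].
  replace (Finite (f 0%nat z)) with (Finite (f 0%nat z - 0)) by (f_equal; ring).
  apply is_lim_seq_minus'; [apply is_lim_seq_const|].
  apply is_lim_seq_abs_0.
  apply is_lim_seq_le_le with (fun _ => 0) (fun n => C * q * q ^ n).
  - intros n. split; [apply Rabs_pos|]. rewrite sum_n_Reals.
    destruct (taylor_chain f l u y z n Hd Hy Hz) as [zeta [Hzeta E]]. rewrite E.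
    specialize (Hb (S n) zeta Hzeta).
    assert (0 < INR (Factorial.fact (S n))) by apply INR_fact_lt_0.
    eapply Rle_trans; [apply Rmult_le_compat_l; [|exact Hb]|].
    + apply Rmult_le_pos; [apply pow_le, Rabs_pos|]. left. now apply Rinv_0_lt_compat.
    + right. unfold q. rewrite !Rpow_mult_distr. simpl pow. field. lra.
  - apply is_lim_seq_const.
  - replace (Finite 0) with (Rbar_mult (C * q) 0) by (simpl; f_equal; ring).
    apply is_lim_seq_scal_l. apply is_lim_seq_geom. rewrite Rabs_pos_eq; lra.
Qed.

(** * Analyticity along solutions of an autonomous equation *)

(** Iterated Lie derivatives: along a solution of [x' = phi x], these are the coefficients, in
    powers of [x], of the [n]-th time derivative of [g x]. *)
Fixpoint flow_deriv (phi g : nat -> R) (n : nat) : nat -> R :=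
  match n with
  | O => g
  | S n => PS_mult phi (PS_derive (flow_deriv phi g n))
  end.

(* Nagumo's trick: each derivative shrinks the radius by [d] and costs a factor [1 / d];
   [d = r / (2 n)] then gives the bound [K^n * n!] on the [n]-th term. *)
Lemma bnd_flow_deriv phi g r d M M' : 0 < d ->
  bnd phi r M -> bnd g r M' ->
  forall n, INR n * d <= r -> bnd (flow_deriv phi g n) (r - INR n * d) (M' * (M / d) ^ n).
Proof.
  intros Hd Hphi Hg n. induction n as [|n IH]; intros Hn.
  - simpl. replace (r - 0 * d) with r by ring. now rewrite Rmult_1_r.
  - rewrite S_INR in Hn. pose proof (pos_INR n).
    simpl flow_deriv. replace (M' * (M / d) ^ S n) with (M * ((M' * (M / d) ^ n) / d)) by (simpl; field; lra).
    apply bnd_mult.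
    + rewrite S_INR. lra.
    + apply bnd_le with r; [rewrite S_INR; split; nra | easy].
    + rewrite S_INR. replace (r - (INR n + 1) * d) with (r - INR n * d - d) by ring.
      apply bnd_derive; [easy|lra|]. apply IH. lra.
Qed.

(** One estimate for two purposes: [phi = 1] recentres a power series, and [phi = 1 / f'] expands
    the inverse function of [f]. The radius [rho] does not depend on the centre [y]. *)
Lemma is_pseries_flow phi g c r M M' (x : R -> R) l u :
  0 < r -> 0 < M -> bnd phi r M -> bnd g r M' ->
  (forall v, l < v < u -> Rabs (x v - c) < r / 2 /\ is_derive x v (PSeries phi (x v - c))) ->
  exists rho, 0 < rho /\ forall y, l < y < u -> exists a, forall z, l < z < u ->
    Rabs (z - y) < rho -> is_pseries a (z - y) (PSeries g (x z - c)).
Proof.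
  intros Hr HM Hphi Hg Hx.
  set (f := fun n v => PSeries (flow_deriv phi g n) (x v - c)).
  assert (Hb : forall n, bnd (flow_deriv phi g n) (r / 2) (M' * (6 * M / r) ^ n * INR (Factorial.fact n))).
  { intros n. destruct n as [|n].
    - simpl. rewrite !Rmult_1_r. apply bnd_le with r; [lra | easy].
    - assert (HI : 0 < INR (S n)) by (apply lt_0_INR; lia).
      set (d := r / (2 * INR (S n))).
      assert (Hd : 0 < d) by (apply Rdiv_lt_0_compat; lra).
      assert (E : INR (S n) * d = r / 2) by (unfold d; field; lra).
      pose proof (bnd_flow_deriv phi g r d M M' Hd Hphi Hg (S n)) as H.
      rewrite E in H. replace (r - r / 2) with (r / 2) in H by lra.
      intros k. eapply Rle_trans; [apply H; lra|].
      rewrite Rmult_assoc. apply Rmult_le_compat_l; [now apply bnd_nonneg in Hg|].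
      replace (M / d) with ((2 * M / r) * INR (S n)) by (unfold d; field; lra).
      replace (6 * M / r) with ((2 * M / r) * 3) by (field; lra).
      rewrite !Rpow_mult_distr, Rmult_assoc. apply Rmult_le_compat_l.
      + apply pow_le. apply Rmult_le_pos; [lra|]. left; now apply Rinv_0_lt_compat.
      + apply pow_n_n_le_fact. }
  (* With [d = r / (2 * n)] the derivatives use up half of the radius, and
     [(M / d) ^ n = (2 * M / r) ^ n * n ^ n] is at most [(6 * M / r) ^ n * n!]. *)
  exists (/ (6 * M / r)).
  assert (HK : 0 < 6 * M / r) by (apply Rdiv_lt_0_compat; lra).
  split; [now apply Rinv_0_lt_compat|].
  intros y Hy. exists (fun n => f n y / INR (Factorial.fact n)).
  intros z Hz Hyz. apply (is_pseries_of_bounds f l u M' (6 * M / r)); auto.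
  - intros n v Hv. destruct (Hx v Hv) as [H1 H2]. unfold f. simpl flow_deriv.
    assert (Hr1 : Rbar_lt (Rabs (x v - c)) (CV_radius (flow_deriv phi g n)))
      by (eapply bnd_radius_lt; [apply Hb | easy]).
    rewrite PSeries_mult.
    + apply (is_derive_comp (PSeries (flow_deriv phi g n)) (fun v => x v - c)).
      * now apply is_derive_PSeries.
      * replace (PSeries phi (x v - c)) with (PSeries phi (x v - c) - 0) by ring.
        apply (is_derive_minus (V := R_NormedModule)); [easy | apply (is_derive_const (V := R_NormedModule))].
    + apply (bnd_radius_lt _ r M); [easy | lra].
    + now rewrite CV_radius_derive.
  - intros n v Hv. eapply bnd_value; [apply Hb | now apply Hx].
Qed.

(** * Functions analytic at a point *)

Definition analytic_at (f : R -> R) (x : R) : Prop :=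
  exists r, 0 < r /\ exists a, forall y, Rabs (y - x) < r -> is_pseries a (y - x) (f y).

Lemma locally_abs x r : 0 < r -> locally x (fun y => Rabs (y - x) < r).
Proof. intros Hr. exists (mkposreal r Hr). intros y Hy. exact Hy. Qed.

Lemma locally_abs_inv x (Q : R -> Prop) :
  locally x Q -> exists r, 0 < r /\ forall y, Rabs (y - x) < r -> Q y.
Proof. intros [e H]. exists e. split; [apply cond_pos|]. intros y Hy. now apply H. Qed.

Lemma radius_inside a : Rbar_lt 0 (CV_radius a) -> exists r, 0 < r /\ Rbar_lt r (CV_radius a).
Proof.
  intros H. destruct (CV_radius a) as [l| |]; simpl in H.
  - exists (l / 2). simpl. lra.
  - exists 1. simpl. split; [lra|easy].
  - destruct H.
Qed.

Lemma locally_and (x : R) (P Q : R -> Prop) :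
  locally x P -> locally x Q -> locally x (fun y => P y /\ Q y).
Proof. apply filter_and. Qed.

Lemma locally_radius (a : nat -> R) x :
  Rbar_lt 0 (CV_radius a) -> locally x (fun y => Rbar_lt (Rabs (y - x)) (CV_radius a)).
Proof.
  intros H. destruct (radius_inside a H) as [r [Hr Hc]].
  apply (filter_imp (fun y => Rabs (y - x) < r)); [|now apply locally_abs].
  intros y Hy. eapply Rbar_lt_trans; [|exact Hc]. exact Hy.
Qed.

Lemma ex_pseries_radius_le a x : ex_pseries a x -> Rbar_le (Rabs x) (CV_radius a).
Proof.
  intros [l Hl]. destruct (Rbar_lt_le_dec (CV_radius a) (Rabs x)) as [Hlt|?]; [exfalso|easy].
  apply (CV_disk_outside a x Hlt).
  apply is_pseries_R in Hl. apply (ex_series_lim_0 (fun n => a n * x ^ n)). eexists; exact Hl.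
Qed.

Lemma radius_pos_of_ex_pseries a x : x <> 0 -> ex_pseries a x -> Rbar_lt 0 (CV_radius a).
Proof.
  intros Hx H. eapply Rbar_lt_le_trans; [|exact (ex_pseries_radius_le a x H)].
  now apply Rabs_pos_lt.
Qed.

Lemma analytic_series f x : analytic_at f x ->
  exists a, Rbar_lt 0 (CV_radius a) /\ locally x (fun y => f y = PSeries a (y - x)).
Proof.
  intros [r [Hr [a H]]]. exists a. split.
  - assert (Hp : is_pseries a (r / 2) (f (x + r / 2))).
    { replace (r / 2) with (x + r / 2 - x) at 1 by ring. apply H.
      replace (x + r / 2 - x) with (r / 2) by ring. rewrite Rabs_pos_eq; lra. }
    apply radius_pos_of_ex_pseries with (r / 2); [lra|]. now exists (f (x + r / 2)).
  - apply (filter_imp (fun y => Rabs (y - x) < r)); [|now apply locally_abs].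
    intros y Hy. symmetry. apply is_pseries_unique. now apply H.
Qed.

Lemma analytic_of_series f x a : Rbar_lt 0 (CV_radius a) ->
  locally x (fun y => f y = PSeries a (y - x)) -> analytic_at f x.
Proof.
  intros Ha H. assert (H2 := filter_and _ _ H (locally_radius a x Ha)).
  apply locally_abs_inv in H2 as [r [Hr H2]].
  exists r. split; [easy|]. exists a. intros y Hy. destruct (H2 y Hy) as [-> Hc].
  apply PSeries_correct. now apply CV_radius_inside.
Qed.

Lemma analytic_ext f g x :
  locally x (fun y => f y = g y) -> analytic_at f x -> analytic_at g x.
Proof.
  intros H Hf. apply analytic_series in Hf as [a [Ha Hf]].
  apply (analytic_of_series g x a Ha).
  generalize (filter_and _ _ H Hf). apply filter_imp. intros y [<- ?]. easy.
Qed.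

Lemma analytic_comp_opp f c x : analytic_at f (c - x) -> analytic_at (fun y => f (c - y)) x.
Proof.
  intros [r [Hr [a H]]]. exists r; split; [easy|]. exists (fun n => (-1) ^ n * a n).
  intros y Hy. apply is_pseries_R.
  assert (Hp : is_pseries a (c - y - (c - x)) (f (c - y))).
  { apply H. replace (c - y - (c - x)) with (- (y - x)) by ring. now rewrite Rabs_Ropp. }
  apply is_pseries_R in Hp. eapply is_series_ext; [|exact Hp]. intros n. simpl.
  replace (c - y - (c - x)) with (-1 * (y - x)) by ring. rewrite Rpow_mult_distr. ring.
Qed.

Lemma analytic_plus f g x : analytic_at f x -> analytic_at g x ->
  analytic_at (fun y => f y + g y) x.
Proof.
  intros [r [Hr [a Ha]]] [s [Hs [b Hb]]]. exists (Rmin r s). split; [now apply Rmin_pos|].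
  exists (PS_plus a b). intros y Hy. apply (is_pseries_plus (V := R_NormedModule)).
  - apply Ha. eapply Rlt_le_trans; [exact Hy | apply Rmin_l].
  - apply Hb. eapply Rlt_le_trans; [exact Hy | apply Rmin_r].
Qed.

Lemma analytic_scal c f x : analytic_at f x -> analytic_at (fun y => c * f y) x.
Proof.
  intros [r [Hr [a Ha]]]. exists r. split; [easy|].
  exists (PS_scal c a). intros y Hy. apply (is_pseries_scal (V := R_NormedModule)); [apply Rmult_comm|]. now apply Ha.
Qed.

Lemma analytic_opp f x : analytic_at f x -> analytic_at (fun y => - f y) x.
Proof.
  intros H. apply analytic_ext with (fun y => -1 * f y); [|now apply analytic_scal].
  apply filter_forall. intros y. ring.
Qed.

Lemma analytic_minus f g x : analytic_at f x -> analytic_at g x ->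
  analytic_at (fun y => f y - g y) x.
Proof. intros. apply analytic_plus; [easy | now apply analytic_opp]. Qed.

Lemma analytic_mult f g x : analytic_at f x -> analytic_at g x ->
  analytic_at (fun y => f y * g y) x.
Proof.
  intros Hf Hg. apply analytic_series in Hf, Hg.
  destruct Hf as [a [Ha Hf]], Hg as [b [Hb Hg]].
  assert (H : locally x (fun y => is_pseries (PS_mult a b) (y - x) (f y * g y))).
  { generalize (filter_and _ _ (filter_and _ _ Hf (locally_radius a x Ha))
      (filter_and _ _ Hg (locally_radius b x Hb))).
    apply filter_imp. intros y [[-> ?] [-> ?]].
    apply is_pseries_mult; auto; apply PSeries_correct; now apply CV_radius_inside. }
  apply locally_abs_inv in H as [r [Hr H]].
  exists r; split; [easy|]. now exists (PS_mult a b).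
Qed.

Definition PS_const (c : R) (n : nat) : R := match n with O => c | _ => 0 end.

Lemma is_pseries_const c x : is_pseries (PS_const c) x c.
Proof.
  apply is_pseries_R. apply filterlim_ext with (fun _ => c); [|apply filterlim_const].
  intros n. rewrite sum_n_Reals. induction n as [|n IH]; [simpl; ring|].
  rewrite tech5, <- IH. simpl. ring.
Qed.

Lemma PSeries_PS_const c x : PSeries (PS_const c) x = c.
Proof. apply is_pseries_unique, is_pseries_const. Qed.

Lemma bnd_PS_const c r : bnd (PS_const c) r (Rabs c).
Proof.
  intros n. right. induction n as [|n IH]; [simpl; ring|].
  rewrite tech5, IH. simpl. rewrite Rabs_R0. ring.
Qed.

Lemma analytic_const c x : analytic_at (fun _ => c) x.
Proof. exists 1. split; [lra|]. exists (PS_const c). intros; apply is_pseries_const. Qed.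

Lemma analytic_id x : analytic_at (fun y => y) x.
Proof.
  exists 1. split; [lra|]. exists (PS_plus (PS_incr_1 (PS_const 1)) (PS_const x)). intros y _.
  replace y with ((y - x) * 1 + x) at 2 by ring.
  apply (is_pseries_plus (V := R_NormedModule)); [|apply is_pseries_const].
  apply (is_pseries_incr_1 (V := R_NormedModule)). apply is_pseries_const.
Qed.

(** The flow of the constant field 1 is [v -> v], and its Lie derivatives are ordinary ones; this
    replaces the rearrangement of a binomial double series around the new centre. *)
Lemma analytic_uniform f x : analytic_at f x ->
  exists rho, 0 < rho /\ forall y, Rabs (y - x) < rho ->
    exists a, forall z, Rabs (z - y) < rho -> is_pseries a (z - y) (f z).
Proof.
  intros H. apply analytic_series in H as [a [Ha H]].
  generalize (filter_and _ _ H (locally_radius a x Ha)). clear H; intros H.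
  apply locally_abs_inv in H as [r [Hr H]].
  assert (Hra : Rbar_lt (r / 2) (CV_radius a)).
  { destruct (H (x + r / 2)) as [_ H2].
    - replace (x + r / 2 - x) with (r / 2) by ring. rewrite Rabs_pos_eq; lra.
    - replace (x + r / 2 - x) with (r / 2) in H2 by ring. rewrite Rabs_pos_eq in H2; [easy|lra]. }
  destruct (bnd_of_radius a (r / 2) ltac:(lra) Hra) as [M HM].
  pose proof (bnd_PS_const 1 (r / 2)) as HP. rewrite Rabs_R1 in HP.
  destruct (is_pseries_flow (PS_const 1) a x (r / 2) 1 M (fun v => v) (x - r / 4) (x + r / 4))
    as [rho [Hrho Hf]]; auto; try lra.
  { intros v Hv. split.
    - apply Rabs_def1; lra.
    - rewrite PSeries_PS_const. apply (is_derive_id (K := R_AbsRing)). }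
  exists (Rmin rho (r / 8)). split; [apply Rmin_pos; lra|].
  assert (Hm1 := Rmin_l rho (r / 8)). assert (Hm2 := Rmin_r rho (r / 8)).
  intros y Hy. apply Rabs_def2 in Hy. destruct (Hf y ltac:(lra)) as [b Hb].
  exists b. intros z Hz. rewrite (proj1 (H z ltac:(apply Rabs_def2 in Hz; apply Rabs_def1; lra))).
  apply Hb; [|lra]. apply Rabs_def2 in Hz. lra.
Qed.

Lemma analytic_locally f x : analytic_at f x -> locally x (fun y => analytic_at f y).
Proof.
  intros H. apply analytic_uniform in H. destruct H as [r [Hr H]].
  apply (filter_imp (fun y => Rabs (y - x) < r)); [|now apply locally_abs].
  intros y Hy. exists r. split; [easy|]. now apply H.
Qed.

Lemma is_derive_PSeries_shift a x y : Rbar_lt (Rabs (y - x)) (CV_radius a) ->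
  is_derive (fun z => PSeries a (z - x)) y (PSeries (PS_derive a) (y - x)).
Proof.
  intros H. replace (PSeries (PS_derive a) (y - x)) with (1 * PSeries (PS_derive a) (y - x)) by ring.
  apply (is_derive_comp (PSeries a) (fun z => z - x)).
  - now apply is_derive_PSeries.
  - auto_derive; auto.
Qed.

Lemma analytic_series_derive f x a : Rbar_lt 0 (CV_radius a) ->
  locally x (fun y => f y = PSeries a (y - x)) ->
  locally x (fun y => is_derive f y (PSeries (PS_derive a) (y - x))).
Proof.
  intros Ha H.
  generalize (filter_and _ _ (locally_locally _ _ H) (locally_radius a x Ha)).
  apply filter_imp. intros y [H1 H2].
  apply (is_derive_ext_loc (fun z => PSeries a (z - x))).
  - revert H1; apply filter_imp; intros; now symmetry.
  - now apply is_derive_PSeries_shift.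
Qed.

Lemma analytic_Derive f x : analytic_at f x -> analytic_at (Derive f) x.
Proof.
  intros H. apply analytic_series in H as [a [Ha H]].
  apply (analytic_of_series _ x (PS_derive a)); [now rewrite CV_radius_derive|].
  generalize (analytic_series_derive f x a Ha H). apply filter_imp.
  intros y Hy. now apply is_derive_unique.
Qed.

Lemma analytic_ex_derive f x : analytic_at f x -> ex_derive f x.
Proof.
  intros H. apply analytic_series in H as [a [Ha H]].
  eexists. exact (locally_singleton _ _ (analytic_series_derive f x a Ha H)).
Qed.

Lemma analytic_continuous f x : analytic_at f x -> continuous f x.
Proof.
  intros H. apply ex_derive_cont. now apply analytic_ex_derive.
Qed.

(** * Coefficient sequences defined by convolution recursion *)

(** Course-of-values recursion [h (n + 1) = c n * sum of p k * h (n - k)]: a new coefficient uses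
    all earlier ones, so stage [n] carries the whole table. Only its entries of index at most [n]
    are meaningful. *)
Fixpoint conv_rec_upto (p c : nat -> R) (h0 : R) (n : nat) : nat -> R :=
  match n with
  | O => fun _ => h0
  | S n => fun k => if Nat.leb k n then conv_rec_upto p c h0 n k
                    else c n * PS_mult p (conv_rec_upto p c h0 n) n
  end.

Definition conv_rec p c h0 (n : nat) : R := conv_rec_upto p c h0 n n.

Lemma conv_rec_upto_stable p c h0 n k : (k <= n)%nat ->
  conv_rec_upto p c h0 n k = conv_rec p c h0 k.
Proof.
  intros H. induction H as [|n H IH]; [reflexivity|].
  simpl. destruct (Nat.leb_spec k n); [exact IH | lia].
Qed.

Lemma conv_rec_S p c h0 n : conv_rec p c h0 (S n) = c n * PS_mult p (conv_rec p c h0) n.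
Proof.
  unfold conv_rec at 1. cbn [conv_rec_upto]. rewrite (proj2 (Nat.leb_gt (S n) n)) by lia.
  f_equal. apply sum_eq. intros k Hk. f_equal. apply conv_rec_upto_stable. lia.
Qed.

Lemma geom_sum_two (L K : R) n :
  sum_f_R0 (fun k => L ^ k * K ^ (n - k)) n * (K - L) = K ^ S n - L ^ S n.
Proof.
  induction n as [|n IH]; [simpl; ring|].
  rewrite tech5. replace (sum_f_R0 (fun k => L ^ k * K ^ (S n - k)) n) with
    (K * sum_f_R0 (fun k => L ^ k * K ^ (n - k)) n).
  - rewrite Rmult_plus_distr_r, Rmult_assoc, IH, Nat.sub_diag. simpl. ring.
  - rewrite scal_sum. apply sum_eq. intros k Hk.
    replace (S n - k)%nat with (S (n - k)) by lia. simpl. ring.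
Qed.

Lemma conv_rec_radius p c h0 C : Rbar_lt 0 (CV_radius p) -> (forall n, Rabs (c n) <= C) ->
  Rbar_lt 0 (CV_radius (conv_rec p c h0)).
Proof.
  intros Hp Hc.
  assert (HC : 0 <= C) by (pose proof (Hc 0%nat); pose proof (Rabs_pos (c 0%nat)); lra).
  destruct (radius_inside p Hp) as [r [Hr Hrp]].
  destruct (bnd_of_radius p r ltac:(lra) Hrp) as [M HM].
  pose proof (bnd_nonneg _ _ _ HM) as HM0.
  set (L := / r). assert (HL : 0 < L) by now apply Rinv_0_lt_compat.
  assert (Hpk : forall k, Rabs (p k) <= M * L ^ k).
  { intros k. apply (Rmult_le_reg_r (r ^ k)); [now apply pow_lt|].
    unfold L. rewrite pow_inv, Rmult_assoc, Rinv_l, Rmult_1_r by (apply pow_nonzero; lra).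
    apply bnd_term; [lra|easy]. }
  (* The induction needs [C * M * (K ^ (n + 1) - L ^ (n + 1)) / (K - L) <= K ^ (n + 1)], so
     [K - L >= C * M] is enough; the summand 1 keeps [K > L] when [C * M = 0]. *)
  set (K := L + C * M + 1). assert (HK : L < K) by (unfold K; nra).
  assert (Hb : forall n k, (k <= n)%nat -> Rabs (conv_rec p c h0 k) <= Rabs h0 * K ^ k).
  { induction n as [|n IH]; intros k Hk.
    - replace k with 0%nat by lia. unfold conv_rec. simpl. lra.
    - destruct (Nat.eq_dec k (S n)) as [->|]; [|apply IH; lia].
      rewrite conv_rec_S, Rabs_mult.
      apply Rle_trans with (C * (Rabs h0 * M * sum_f_R0 (fun k => L ^ k * K ^ (n - k)) n)).
      + apply Rmult_le_compat; try apply Rabs_pos; [apply Hc|].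
        unfold PS_mult. eapply Rle_trans; [apply Rsum_abs|].
        rewrite scal_sum. apply sum_Rle. intros j Hj. rewrite Rabs_mult.
        replace (L ^ j * K ^ (n - j) * (Rabs h0 * M)) with
          ((M * L ^ j) * (Rabs h0 * K ^ (n - j))) by ring.
        apply Rmult_le_compat; try apply Rabs_pos; [apply Hpk | apply IH; lia].
      + set (G := sum_f_R0 _ n).
        assert (HG : G * (K - L) <= K ^ S n).
        { unfold G. rewrite geom_sum_two. assert (0 < L ^ S n) by now apply pow_lt. lra. }
        assert (HG0 : 0 <= G).
        { apply sum_f_R0_nonneg. intros. apply Rmult_le_pos; apply pow_le; lra. }
        replace (C * (Rabs h0 * M * G)) with (Rabs h0 * (G * (C * M))) by ring.
        apply Rmult_le_compat_l; [apply Rabs_pos|].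
        eapply Rle_trans; [|exact HG]. apply Rmult_le_compat_l; [easy|]. unfold K. lra. }
  eapply Rbar_lt_le_trans; [|apply (bnd_of_geom _ (Rabs h0) K); [lra|]].
  - simpl. apply Rinv_0_lt_compat. lra.
  - intros n. now apply (Hb n n).
Qed.

(** * Reciprocals, square roots and inverse functions *)

(** Solving [a * g = 1] for the coefficient of order [n + 1] is a convolution recursion with the
    shifted series of [a] and the constant factor [- / a 0]. *)
Lemma analytic_inv f x : analytic_at f x -> f x <> 0 -> analytic_at (fun y => / f y) x.
Proof.
  intros Hf H0. apply analytic_series in Hf as [a [Ha Hf]].
  assert (Ea : a 0%nat = f x).
  { rewrite (locally_singleton _ _ Hf), Rminus_diag. now rewrite PSeries_0. }
  set (g := conv_rec (PS_decr_1 a) (fun _ => - / a 0%nat) (/ a 0%nat)).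
  assert (Hg : Rbar_lt 0 (CV_radius g)).
  { apply conv_rec_radius with (Rabs (- / a 0%nat)); [now rewrite CV_radius_decr_1|].
    intros; apply Rle_refl. }
  apply (analytic_of_series _ x g Hg).
  generalize (filter_and _ _ (filter_and _ _ Hf (locally_radius a x Ha)) (locally_radius g x Hg)).
  apply filter_imp. intros y [[-> H1] H2].
  assert (E : PSeries a (y - x) * PSeries g (y - x) = 1).
  { rewrite <- PSeries_mult by easy. rewrite (PSeries_ext _ (PS_const 1)); [apply PSeries_PS_const|].
    intros n. destruct n as [|n].
    - unfold PS_mult. simpl. unfold g, conv_rec. simpl. rewrite Ea. now field.
    - unfold PS_mult. rewrite decomp_sum by lia. simpl pred. rewrite Nat.sub_0_r.
      unfold g at 1. rewrite conv_rec_S. fold g. unfold PS_mult, PS_decr_1. simpl PS_const.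
      rewrite Ea. rewrite <- Rmult_assoc.
      replace (f x * - / f x) with (-1) by (field; easy).
      match goal with |- -1 * ?A + ?B = 0 => enough (A = B) by lra end.
      apply sum_eq. intros k Hk. f_equal. }
  apply (Rmult_eq_reg_l (PSeries a (y - x))).
  - rewrite E. apply Rinv_r. intros E0. rewrite E0 in E. lra.
  - intros E0. rewrite E0 in E. lra.
Qed.

Lemma const_of_derive_0 (f : R -> R) l u :
  (forall x, l < x < u -> is_derive f x 0) -> forall x y, l < x < u -> l < y < u -> f x = f y.
Proof.
  intros H x y Hx Hy.
  assert (Hz : forall z, Rmin x y <= z <= Rmax x y -> l < z < u).
  { intros z. unfold Rmin, Rmax; destruct Rle_dec; lra. }
  destruct (MVT_gen f x y (fun _ => 0)) as [c [_ E]].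
  - intros z Hz'. apply H, Hz. lra.
  - intros z Hz'. apply continuity_pt_filterlim. eapply is_derive_cont. now apply H, Hz.
  - lra.
Qed.

Lemma locally_const_of_derive_0 (f : R -> R) x :
  locally x (fun y => is_derive f y 0) -> locally x (fun y => f y = f x).
Proof.
  intros H. apply locally_abs_inv in H as [r [Hr H]].
  apply (locally_between (x - r) (x + r)); [lra|]. intros y Hy.
  apply (const_of_derive_0 f (x - r) (x + r)); [|lra..].
  intros z Hz. apply H. apply Rabs_def1; lra.
Qed.

(** The formal solution [g] of [g' = p * g] satisfies a convolution recursion with factors
    [1 / (n + 1)], hence converges; the quotient of [h] by its sum has derivative 0. *)
Lemma analytic_linear_ode h p x : analytic_at p x -> h x <> 0 ->
  locally x (fun y => is_derive h y (p y * h y)) -> analytic_at h x.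
Proof.
  intros Hp H0 Hh. apply analytic_series in Hp as [a [Ha Hp]].
  set (g := conv_rec a (fun n => / INR (S n)) (h x)).
  assert (Hg : Rbar_lt 0 (CV_radius g)).
  { apply conv_rec_radius with 1; [easy|]. intros n.
    assert (1 <= INR (S n)) by (rewrite S_INR; pose proof (pos_INR n); lra).
    rewrite Rabs_pos_eq by (left; apply Rinv_0_lt_compat; lra).
    rewrite <- Rinv_1. apply Rinv_le_contravar; lra. }
  assert (Dg : forall n, PS_derive g n = PS_mult a g n).
  { intros n. unfold PS_derive. unfold g at 1. rewrite conv_rec_S. fold g.
    field. apply not_0_INR. lia. }
  set (G := fun y => PSeries g (y - x)).
  assert (HG : locally x (fun y => is_derive G y (p y * G y))).
  { generalize (filter_and _ _ (filter_and _ _ Hp (locally_radius a x Ha)) (locally_radius g x Hg)).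
    apply filter_imp. intros y [[-> H1] H2]. unfold G.
    rewrite <- PSeries_mult by easy. rewrite <- (PSeries_ext _ _ _ Dg).
    now apply is_derive_PSeries_shift. }
  assert (G0 : G x = h x).
  { unfold G. rewrite Rminus_diag, PSeries_0. reflexivity. }
  apply (analytic_of_series _ x g Hg).
  assert (Hnz : locally x (fun y => G y <> 0)).
  { assert (Hc : continuous G x).
    { eapply is_derive_cont. apply (locally_singleton _ _ HG). }
    apply (Hc (fun z => z <> 0)). apply open_neq. now rewrite G0. }
  assert (HQ : locally x (fun y => is_derive (fun y => h y / G y) y 0)).
  { generalize (filter_and _ _ (filter_and _ _ Hh HG) Hnz). apply filter_imp.
    intros y [[H1 H2] H3].
    replace 0 with ((p y * h y * G y - h y * (p y * G y)) / G y ^ 2) by (field; easy).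
    now apply is_derive_div. }
  generalize (filter_and _ _ Hnz (locally_const_of_derive_0 _ _ HQ)). apply filter_imp.
  intros y [H1 H2]. rewrite G0 in H2. fold (G y).
  replace (h x / h x) with 1 in H2 by (field; easy).
  replace (h y) with (h y / G y * G y) by (field; easy). rewrite H2. ring.
Qed.

(** The square root [h] of [f] solves the linear equation [h' = f' / (2 * f) * h]. *)
Lemma analytic_sqrt f x : analytic_at f x -> 0 < f x -> analytic_at (fun y => sqrt (f y)) x.
Proof.
  intros Hf H0. apply analytic_linear_ode with (fun y => Derive f y / (2 * f y)).
  - apply analytic_mult; [now apply analytic_Derive|].
    apply (analytic_inv (fun y => 2 * f y)); [now apply analytic_scal | lra].
  - apply Rgt_not_eq. now apply sqrt_lt_R0.
  - assert (Hpos : locally x (fun y => 0 < f y)).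
    { apply (analytic_continuous f x Hf (fun z => 0 < z)). now apply open_gt. }
    generalize (filter_and _ _ Hpos (analytic_locally f x Hf)). apply filter_imp.
    intros y [H1 H2].
    replace (Derive f y / (2 * f y) * sqrt (f y)) with (Derive f y * / (2 * sqrt (f y))).
    + apply (is_derive_comp sqrt f).
      * auto_derive; [easy|]. ring.
      * now apply Derive_correct, analytic_ex_derive.
    + assert (0 < sqrt (f y)) by now apply sqrt_lt_R0.
      assert (E := sqrt_sqrt (f y) ltac:(lra)). set (D := Derive f y).
      set (w := sqrt (f y)) in *. rewrite <- E. field. lra.
Qed.

Lemma is_derive_inverse f g y d : is_derive f (g y) d -> d <> 0 ->
  locally y (fun z => f (g z) = z) -> continuous g y -> is_derive g y (/ d).
Proof.
  intros Hf Hd Hfg Hg.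
  (* Carathéodory's slope function: continuous at [g y] with value [d], and the difference quotient
     of [g] is the reciprocal of [phi] along [g]. *)
  set (phi := fun z => if Req_EM_T z (g y) then d else (f z - f (g y)) / (z - g y)).
  assert (Hphi : continuous phi (g y)).
  { apply is_derive_Reals in Hf. intros P [e HP]. unfold phi at 1 in HP.
    destruct Req_EM_T as [_|n]; [|now destruct n].
    destruct (Hf e (cond_pos e)) as [delta H].
    assert (Hall : forall z : R, Rabs (z - g y) < delta -> Rabs (phi z - d) < e).
    { intros z Hz. unfold phi. destruct Req_EM_T as [->|Hn].
      - rewrite Rminus_diag, Rabs_R0. apply cond_pos.
      - specialize (H (z - g y) ltac:(lra) Hz). now replace (g y + (z - g y)) with z in H by ring. }
    exists delta. intros z Hz. apply HP. now apply Hall. }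
  assert (Hc : continuous (fun z => / phi (g z)) y).
  { apply (continuous_comp (fun z => phi (g z)) Rinv).
    - now apply continuous_comp.
    - apply continuous_Rinv. unfold phi. destruct Req_EM_T as [_|n]; [easy|now destruct n]. }
  assert (Hy : / phi (g y) = / d).
  { unfold phi. destruct Req_EM_T as [_|n]; [easy|now destruct n]. }
  apply is_derive_Reals. intros e He.
  assert (HL : locally y (fun z => Rabs (/ phi (g z) - / d) < e)).
  { rewrite <- Hy. apply (Hc (fun t => Rabs (t - / phi (g y)) < e)). now apply locally_abs. }
  pose proof (locally_singleton _ _ Hfg) as Hfy.
  generalize (filter_and _ _ HL Hfg). intros [delta H]. exists delta.
  intros h Hh Hhd. destruct (H (y + h)) as [H1 H2].
  { change (Rabs (y + h - y) < delta). now replace (y + h - y) with h by ring. }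
  replace ((g (y + h) - g y) / h) with (/ phi (g (y + h))); [easy|].
  unfold phi. destruct Req_EM_T as [E|n].
  - rewrite E, Hfy in H2. lra.
  - rewrite H2, Hfy. replace (y + h - y) with h by ring. field. split; [easy|lra].
Qed.

Lemma bnd_weaken a r M M' : M <= M' -> bnd a r M -> bnd a r M'.
Proof. intros H Hb n. specialize (Hb n). lra. Qed.

Lemma PSeries_monomial_1 t : PSeries (PS_incr_1 (PS_const 1)) t = t.
Proof. rewrite PSeries_incr_1, PSeries_PS_const. ring. Qed.

Lemma bnd_monomial_1 r : 0 <= r -> bnd (PS_incr_1 (PS_const 1)) r r.
Proof.
  intros Hr n. destruct n as [|n].
  - simpl. unfold zero; simpl. rewrite Rabs_R0. lra.
  - rewrite decomp_sum by lia. simpl pred. right.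
    replace (sum_f_R0 _ n) with r; [simpl; unfold zero; simpl; rewrite Rabs_R0; ring|].
    induction n as [|n IH]; [simpl; rewrite Rabs_R1; ring|].
    rewrite tech5, <- IH. simpl. rewrite Rabs_R0. ring.
Qed.

(** The inverse solves [g' = phi g] with [phi = 1 / f'] analytic at [g y], so it is expanded as a
    flow, observed through the identity function. Continuity of [g] around [y] makes the equation
    hold on a neighbourhood. *)
Lemma analytic_inverse (f g : R -> R) (y : R) : analytic_at f (g y) -> Derive f (g y) <> 0 ->
  locally y (fun z => f (g z) = z) -> locally y (fun z => continuous g z) -> analytic_at g y.
Proof.
  intros Hf Hd Hfg Hg. set (c := g y).
  assert (Hphi : analytic_at (fun z => / Derive f z) c)
    by (apply analytic_inv; [now apply analytic_Derive | easy]).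
  apply analytic_series in Hphi as [phi [Hr Hphi]].
  destruct (radius_inside phi Hr) as [r [Hr0 Hr1]].
  destruct (bnd_of_radius phi r ltac:(lra) Hr1) as [M HM].
  assert (HM1 : bnd phi r (Rabs M + 1)) by (eapply bnd_weaken; [|exact HM]; pose proof (Rle_abs M); lra).
  assert (Hgc : continuous g y) by exact (locally_singleton _ _ Hg).
  assert (HD : locally c (fun z => Derive f z <> 0)).
  { apply (analytic_continuous _ _ (analytic_Derive f c Hf) (fun t => t <> 0)). now apply open_neq. }
  assert (Hx : locally y (fun v => Rabs (g v - c) < r / 2 /\ is_derive g v (PSeries phi (g v - c)))).
  { assert (T : forall Q : R -> Prop, locally c Q -> locally y (fun v => Q (g v))) by exact Hgc.
    assert (L1 := T _ (locally_abs c (r / 2) ltac:(lra))). assert (L2 := T _ Hphi).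
    assert (L3 := T _ HD). assert (L4 := T _ (analytic_locally f c Hf)).
    generalize (locally_and _ _ _ (locally_and _ _ _ (locally_locally _ _ Hfg) Hg)
      (locally_and _ _ _ L1 (locally_and _ _ _ L2 (locally_and _ _ _ L3 L4)))).
    apply filter_imp. intros v [[H1 H2] [H3 [H4 [H5 H6]]]]. split; [exact H3|].
    rewrite <- H4. apply is_derive_inverse with f; auto.
    now apply Derive_correct, analytic_ex_derive. }
  apply locally_abs_inv in Hx as [e [He Hx]].
  destruct (is_pseries_flow phi (PS_incr_1 (PS_const 1)) c r (Rabs M + 1) r g (y - e) (y + e))
    as [rho [Hrho H]]; auto.
  - pose proof (Rabs_pos M). lra.
  - apply bnd_monomial_1. lra.
  - intros v Hv. apply Hx. apply Rabs_def1; lra.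
  - destruct (H y ltac:(lra)) as [a Ha].
    apply analytic_ext with (fun z => (g z - c) + c); [apply filter_forall; intros; ring|].
    apply analytic_plus; [|apply analytic_const].
    exists (Rmin rho e). split; [now apply Rmin_pos|]. exists a. intros z Hz.
    Rmin_bounds rho e.
    rewrite <- (PSeries_monomial_1 (g z - c)). apply Ha; [|lra]. apply Rabs_def2 in Hz. lra.
Qed.

(** * The identity theorem *)

(** This takes the place of compactness: it spreads a local zero along an interval, and it follows a
    trajectory without counting its turns. *)
Lemma real_induction (a b : R) (Q : R -> Prop) :
  Q a ->
  (forall x, a <= x < b -> (forall y, a <= y <= x -> Q y) ->
     exists d, 0 < d /\ forall y, x < y < x + d -> y <= b -> Q y) ->
  (forall x, a < x <= b -> (forall y, a <= y < x -> Q y) -> Q x) ->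
  forall x, a <= x <= b -> Q x.
Proof.
  intros H0 Hr Hl x Hx.
  set (S := fun t => a <= t <= b /\ forall y, a <= y <= t -> Q y).
  assert (Sa : S a) by (split; [lra|]; intros y Hy; now replace y with a by lra).
  destruct (completeness S) as [m [Hub Hlub]].
  { exists b. intros t [Ht _]. lra. }
  { now exists a. }
  assert (Hm : a <= m <= b).
  { split; [now apply Hub|]. apply Hlub. intros t [Ht _]. lra. }
  assert (Hlt : forall y, a <= y < m -> Q y).
  { intros y Hy. apply NNPP. intros Hn. enough (m <= y) by lra.
    apply Hlub. intros t [Ht Hq]. apply Rnot_lt_le. intros Hyt. apply Hn, Hq. lra. }
  assert (Hle : forall y, a <= y <= m -> Q y).
  { intros y Hy. destruct (Req_dec y m) as [->|]; [|apply Hlt; lra].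
    destruct (Req_dec m a) as [->|]; [easy|]. apply Hl; [lra|easy]. }
  destruct (Rlt_dec m b) as [Hmb|]; [|apply Hle; lra].
  exfalso. destruct (Hr m ltac:(lra) Hle) as [d [Hd H]].
  set (m' := Rmin b (m + d / 2)).
  assert (Hm' : m < m' /\ m' <= b /\ m' <= m + d / 2).
  { unfold m'. split; [apply Rmin_glb_lt; lra|]. split; [apply Rmin_l | apply Rmin_r]. }
  enough (m' <= m) by lra. apply Hub. split; [lra|].
  intros y Hy. destruct (Rle_dec y m); [apply Hle; lra | apply H; lra].
Qed.

Lemma PS_decr_n_radius a n : CV_radius (PS_decr_n a n) = CV_radius a.
Proof.
  induction n as [|n IH].
  - apply CV_radius_ext. intros k. reflexivity.
  - rewrite <- IH, <- (CV_radius_decr_1 (PS_decr_n a n)). apply CV_radius_ext. intros k.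
    unfold PS_decr_n, PS_decr_1. f_equal. lia.
Qed.

Lemma analytic_isolated_zeros f x : analytic_at f x ->
  locally x (fun y => f y = 0) \/ locally x (fun y => y <> x -> f y <> 0).
Proof.
  intros H. apply analytic_series in H as [a [Ha Hf]].
  destruct (classic (exists n, a n <> 0)) as [Hex|Hall].
  - right. destruct (dec_inh_nat_subset_has_unique_least_element (fun n => a n <> 0)) as [n [[Hn Hmin] _]];
      [intros; apply classic | exact Hex |].
    assert (Hz : forall k, (k < n)%nat -> a k = 0).
    { intros k Hk. apply NNPP. intros Hk0. specialize (Hmin k Hk0). lia. }
    assert (Hb : Rbar_lt 0 (CV_radius (PS_decr_n a n))) by now rewrite PS_decr_n_radius.
    assert (Hc : continuous (fun y => PSeries (PS_decr_n a n) (y - x)) x).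
    { apply analytic_continuous. eapply analytic_of_series; [exact Hb|].
      now apply filter_forall. }
    assert (Hnz : locally x (fun y => PSeries (PS_decr_n a n) (y - x) <> 0)).
    { apply (Hc (fun t => t <> 0)). apply open_neq. rewrite Rminus_diag, PSeries_0.
      unfold PS_decr_n. now rewrite Nat.add_0_r. }
    generalize (filter_and _ _ Hf Hnz). apply filter_imp. intros y [-> H] Hyx.
    rewrite (PSeries_decr_n_aux a n) by exact Hz.
    apply Rmult_integral_contrapositive_currified; [apply pow_nonzero; lra | easy].
  - left. revert Hf. apply filter_imp. intros y ->.
    rewrite (PSeries_ext _ (fun _ => 0)); [apply PSeries_const_0|].
    intros n. apply NNPP. intros Hn. apply Hall. now exists n.
Qed.

Lemma analytic_identity_right f l u x0 :
  (forall x, l < x < u -> analytic_at f x) -> l < x0 ->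
  locally x0 (fun y => f y = 0) -> forall x, x0 <= x < u -> locally x (fun y => f y = 0).
Proof.
  intros Hf Hl H0 x Hx.
  apply (real_induction x0 x (fun x => locally x (fun y => f y = 0))); [exact H0| | |lra].
  - intros y Hy IH. specialize (IH y ltac:(lra)). apply locally_locally, locally_abs_inv in IH.
    destruct IH as [d [Hd IH]]. exists d. split; [easy|]. intros z Hz _. apply IH. apply Rabs_def1; lra.
  - intros y Hy IH. destruct (analytic_isolated_zeros f y (Hf y ltac:(lra))) as [|Hn]; [easy|exfalso].
    apply locally_abs_inv in Hn as [d [Hd Hn]].
    set (z := Rmax x0 (y - d / 2)).
    assert (Hz : x0 <= z < y /\ y - d / 2 <= z).
    { unfold z. split; [split; [apply Rmax_l | apply Rmax_lub_lt; lra] | apply Rmax_r]. }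
    apply (Hn z); [apply Rabs_def1; lra | lra |].
    exact (locally_singleton _ _ (IH z ltac:(lra))).
Qed.

Lemma analytic_identity f l u x0 :
  (forall x, l < x < u -> analytic_at f x) -> l < x0 < u ->
  locally x0 (fun y => f y = 0) -> forall x, l < x < u -> f x = 0.
Proof.
  intros Hf Hx0 H0 x Hx. destruct (Rle_dec x0 x) as [Hle|Hgt].
  - apply (locally_singleton x (fun y => f y = 0)), (analytic_identity_right f l u x0); auto; lra.
  - pose (g := fun y => f (0 - y)).
    replace (f x) with (g (- x)) by (unfold g; f_equal; ring).
    apply (locally_singleton (- x) (fun y => g y = 0)).
    apply (analytic_identity_right g (- u) (- l) (- x0)); try lra.
    + intros y Hy. apply analytic_comp_opp. apply Hf. lra.
    + apply locally_abs_inv in H0 as [d [Hd H0]].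
      apply (filter_imp (fun y => Rabs (y - - x0) < d)); [|now apply locally_abs].
      intros y Hy. apply H0. replace (0 - y - x0) with (- (y - - x0)) by ring. now rewrite Rabs_Ropp.
Qed.

(** From each interval of radius [2 / (k + 1)] around a rational [(i - j) / (k + 1)] one point of
    [A] is chosen. Two points of one interval are less than [4 / (k + 1)] apart, so for large [k]
    the choice near an isolated point is that point. *)
Lemma countable_isolated (A : R -> Prop) :
  (forall x, A x -> exists r, 0 < r /\ forall y, A y -> Rabs (y - x) < r -> y = x) ->
  countable_set A.
Proof.
  intros H.
  exists (fun n => let (k, ij) := Cantor.of_nat n in let (i, j) := Cantor.of_nat ij in
    epsilon (inhabits 0) (fun y => A y /\ Rabs (y - (INR i - INR j) / INR (S k)) < 2 * / INR (S k))).
  intros x Ax. destruct (H x Ax) as [r [Hr Hx]].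
  destruct (archimed_cor1 (r / 4) ltac:(lra)) as [k' [Hk' Hk0]].
  destruct k' as [|k]; [lia|]. clear Hk0.
  assert (HS : 0 < INR (S k)) by (apply lt_0_INR; lia).
  set (z := up (x * INR (S k))).
  assert (Hz : Rabs (x - IZR z / INR (S k)) < 2 * / INR (S k)).
  { destruct (archimed (x * INR (S k))) as [H1 H2]. fold z in H1, H2.
    replace (x - IZR z / INR (S k)) with ((x * INR (S k) - IZR z) * / INR (S k)) by (field; lra).
    rewrite Rabs_mult, (Rabs_pos_eq (/ INR (S k))) by (left; now apply Rinv_0_lt_compat).
    apply Rmult_lt_compat_r; [now apply Rinv_0_lt_compat|]. apply Rabs_def1; lra. }
  exists (Cantor.to_nat (k, Cantor.to_nat (Z.to_nat z, Z.to_nat (- z)))).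
  rewrite !Cantor.cancel_of_to.
  assert (E : INR (Z.to_nat z) - INR (Z.to_nat (- z)) = IZR z).
  { rewrite !INR_IZR_INZ, <- minus_IZR. f_equal. lia. }
  rewrite E.
  set (Pe := fun y => _ /\ _).
  assert (He : Pe (epsilon (inhabits 0) Pe)) by (apply epsilon_spec; now exists x).
  destruct He as [He1 He2]. apply Hx; [exact He1|].
  set (e := epsilon _ _) in *.
  replace (e - x) with ((e - IZR z / INR (S k)) - (x - IZR z / INR (S k))) by ring.
  eapply Rle_lt_trans; [apply Rabs_triang|]. rewrite Rabs_Ropp. lra.
Qed.

Lemma analytic_zeros_countable f l u :
  (forall x, l < x < u -> analytic_at f x) ->
  countable_set (fun x => l < x < u /\ f x = 0) \/ forall x, l < x < u -> f x = 0.
Proof.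
  intros Hf. destruct (classic (exists x0, l < x0 < u /\ locally x0 (fun y => f y = 0))) as [[x0 [Hx0 H0]]|Hn].
  - right. intros x Hx. now apply (analytic_identity f l u x0).
  - left. apply countable_isolated. intros x [Hx _].
    destruct (analytic_isolated_zeros f x (Hf x Hx)) as [H|H].
    + exfalso. apply Hn. now exists x.
    + apply locally_abs_inv in H as [d [Hd H]]. exists d. split; [easy|].
      intros y [_ Hy] Hyx. apply NNPP. intros Hne. now apply (H y).
Qed.

Lemma PSeries_zero_right a e : Rbar_lt 0 (CV_radius a) -> 0 < e ->
  (forall x, 0 < x < e -> PSeries a x = 0) -> forall n, a n = 0.
Proof.
  intros Ha He H n.
  assert (Han : analytic_at (PSeries a) 0).
  { apply (analytic_of_series _ _ a Ha). apply filter_forall. intros y. now rewrite Rminus_0_r. }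
  destruct (analytic_isolated_zeros _ _ Han) as [Hz|Hz].
  - apply (PSeries_ext_recip a (fun _ => 0)); [easy|now rewrite CV_radius_const_0|].
    revert Hz. apply filter_imp. intros y ->. now rewrite PSeries_const_0.
  - exfalso. apply locally_abs_inv in Hz as [d [Hd Hz]].
    set (z := Rmin e d / 2). assert (0 < Rmin e d) by now apply Rmin_pos.
    Rmin_bounds e d.
    apply (Hz z); [rewrite Rminus_0_r, Rabs_pos_eq; unfold z; lra | unfold z; lra |].
    apply H. unfold z. lra.
Qed.

(** * Even and odd parts of power series *)

Definition PS_interlace (a b : nat -> R) (n : nat) : R :=
  if Nat.even n then a (Nat.div2 n) else b (Nat.div2 n).

Lemma is_pseries_interlace a b s : Rbar_lt (Rabs (s ^ 2)) (CV_radius a) ->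
  Rbar_lt (Rabs (s ^ 2)) (CV_radius b) ->
  is_pseries (PS_interlace a b) s (PSeries a (s ^ 2) + s * PSeries b (s ^ 2)).
Proof.
  intros Ha Hb. apply is_pseries_odd_even.
  - apply (is_pseries_ext (V := R_NormedModule) a).
    + intros n. unfold PS_interlace. rewrite Nat.even_mul. simpl (Nat.even 2). simpl orb.
      now rewrite Nat.div2_double.
    + now apply PSeries_correct, CV_radius_inside.
  - apply (is_pseries_ext (V := R_NormedModule) b).
    + intros n. unfold PS_interlace. rewrite Nat.add_1_r, Nat.even_succ, Nat.odd_mul.
      simpl (Nat.odd 2). simpl andb. now rewrite Nat.div2_succ_double.
    + now apply PSeries_correct, CV_radius_inside.
Qed.

Lemma square_lt_radius a e : Rbar_lt 0 (CV_radius a) -> 0 < e ->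
  exists d, 0 < d <= e /\ forall s, Rabs s < d -> Rbar_lt (Rabs (s ^ 2)) (CV_radius a).
Proof.
  intros Ha He. destruct (radius_inside a Ha) as [r [Hr Hra]].
  set (d := Rmin e (Rmin 1 r)).
  assert (Hd : 0 < d <= e) by (unfold d; split; [apply Rmin_pos; [easy|apply Rmin_pos; lra] | apply Rmin_l]).
  assert (Hd1 : d <= 1 /\ d <= r).
  { pose proof (Rmin_r e (Rmin 1 r)). Rmin_bounds 1 r.
    unfold d. lra. }
  exists d. split; [easy|]. intros s Hs.
  eapply Rbar_lt_trans; [|exact Hra]. simpl. rewrite Rmult_1_r, Rabs_mult.
  pose proof (Rabs_pos s). nra.
Qed.

(** Agreement for small positive [s] already determines all coefficients. With [s] the root of an
    energy increment, an identity between analytic functions of the energy and multiples of its root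
    therefore splits into two. *)
Lemma PSeries_parity a b c e : Rbar_lt 0 (CV_radius a) -> Rbar_lt 0 (CV_radius b) ->
  Rbar_lt 0 (CV_radius c) -> 0 < e ->
  (forall s, 0 < s < e -> PSeries c s = PSeries a (s ^ 2) + s * PSeries b (s ^ 2)) ->
  forall n, c n = PS_interlace a b n.
Proof.
  intros Ha Hb Hc He H.
  destruct (square_lt_radius a e Ha He) as [d1 [Hd1 H1]].
  destruct (square_lt_radius b d1 Hb ltac:(lra)) as [d [Hd H2]].
  assert (Hp : forall s, Rabs s < d -> is_pseries (PS_interlace a b) s (PSeries a (s ^ 2) + s * PSeries b (s ^ 2))).
  { intros s Hs. apply is_pseries_interlace; [apply H1; lra | now apply H2]. }
  assert (Hi : Rbar_lt 0 (CV_radius (PS_interlace a b))).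
  { apply radius_pos_of_ex_pseries with (d / 2); [lra|]. eexists. apply Hp. rewrite Rabs_pos_eq; lra. }
  assert (Hz : forall n, PS_minus c (PS_interlace a b) n = 0).
  { destruct (radius_inside c Hc) as [r [Hr Hrc]].
    assert (Hmin : 0 < Rmin r d) by (apply Rmin_pos; lra).
    Rmin_bounds r d.
    assert (Hm : forall s, 0 < s < Rmin r d -> is_pseries (PS_minus c (PS_interlace a b)) s 0).
    { intros s Hs.
      replace 0 with (PSeries c s - (PSeries a (s ^ 2) + s * PSeries b (s ^ 2))) by (rewrite H; lra).
      apply (is_pseries_minus (V := R_NormedModule)).
      - apply PSeries_correct, CV_radius_inside. eapply Rbar_lt_trans; [|exact Hrc].
        simpl. rewrite Rabs_pos_eq; lra.
      - apply Hp. rewrite Rabs_pos_eq; lra. }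
    apply PSeries_zero_right with (Rmin r d); [|easy|].
    - apply radius_pos_of_ex_pseries with (Rmin r d / 2); [lra|]. eexists. apply Hm. lra.
    - intros x Hx. now apply is_pseries_unique, Hm. }
  intros n. specialize (Hz n). unfold PS_minus, PS_plus, PS_opp, plus, opp in Hz. simpl in Hz. lra.
Qed.

(** * Power series under the integral sign *)

Ltac eqR := match goal with |- @eq _ ?a ?b => change (@eq R a b) end.

Lemma sum_n_S (u : nat -> R) n : sum_n u (S n) = sum_n u n + u (S n).
Proof. now rewrite sum_Sn. Qed.

Lemma PSeries_tail (d : nat -> R) r : 0 <= r -> Rbar_lt r (CV_radius d) ->
  exists tau : nat -> R, is_lim_seq tau 0 /\ forall n y, Rabs y <= r ->
    Rabs (PSeries d y - sum_n (fun k => d k * y ^ k) n) <= tau n.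
Proof.
  intros Hr Hd. set (v := fun k => Rabs (d k * r ^ k)).
  assert (Hv : ex_series v) by (apply CV_disk_inside; now rewrite Rabs_pos_eq).
  assert (Hl : is_lim_seq (sum_n v) (Series v)) by now apply Series_correct.
  assert (Hv0 : forall k, 0 <= v k) by (intros; apply Rabs_pos).
  exists (fun n => Series v - sum_n v n). split.
  { replace (Finite 0) with (Finite (Series v - Series v)) by (f_equal; ring).
    apply is_lim_seq_minus'; [apply is_lim_seq_const | exact Hl]. }
  intros n y Hy. set (u := fun k => d k * y ^ k).
  assert (Hu : is_lim_seq (sum_n u) (PSeries d y)).
  { apply Series_correct. apply ex_series_Rabs. apply CV_disk_inside.
    eapply Rbar_le_lt_trans; [|exact Hd]. exact Hy. }
  assert (Huv : forall k, Rabs (u k) <= v k).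
  { intros k. unfold u, v. rewrite !Rabs_mult. apply Rmult_le_compat_l; [apply Rabs_pos|].
    rewrite <- !RPow_abs, (Rabs_pos_eq r) by easy. apply pow_incr. split; [apply Rabs_pos|easy]. }
  assert (Hm : forall m, Rabs (sum_n u (m + n) - sum_n u n) <= sum_n v (m + n) - sum_n v n).
  { induction m as [|m IH]; [simpl; rewrite !Rminus_diag, Rabs_R0; lra|].
    change (S m + n)%nat with (S (m + n)). rewrite !sum_n_S.
    replace (sum_n u (m + n) + u (S (m + n)) - sum_n u n) with
      ((sum_n u (m + n) - sum_n u n) + u (S (m + n))) by ring.
    eapply Rle_trans; [apply Rabs_triang|]. specialize (Huv (S (m + n))). lra. }
  apply (is_lim_seq_le (fun m => Rabs (sum_n u (m + n) - sum_n u n)) (fun _ => Series v - sum_n v n)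
    (Rabs (PSeries d y - sum_n u n)) (Series v - sum_n v n)).
  - intros m. eapply Rle_trans; [apply Hm|]. apply Rplus_le_compat_r.
    apply (is_lim_seq_incr_compare (sum_n v)); [exact Hl|].
    intros k. rewrite sum_n_S. specialize (Hv0 (S k)). lra.
  - apply (is_lim_seq_abs _ (Finite (PSeries d y - sum_n u n))).
    apply is_lim_seq_minus'; [|apply is_lim_seq_const].
    now apply is_lim_seq_incr_n.
  - apply is_lim_seq_const.
Qed.

Lemma ex_RInt_cont (f : R -> R) A B : (forall s, A <= s <= B -> continuous f s) -> A <= B ->
  ex_RInt f A B.
Proof.
  intros H HAB. apply (ex_RInt_continuous (V := R_CompleteNormedModule)). intros z.
  rewrite Rmin_left, Rmax_right by easy. apply H.
Qed.

Lemma continuous_Rmult (f g : R -> R) x :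
  continuous f x -> continuous g x -> continuous (fun y => f y * g y) x.
Proof. apply (continuous_mult (K := R_AbsRing)). Qed.

Lemma continuous_pow_fun (w : R -> R) k s : continuous w s -> continuous (fun s => w s ^ k) s.
Proof.
  intros H. induction k as [|k IH]; [apply continuous_const|].
  apply continuous_Rmult; assumption.
Qed.

(** The bound [W] makes the series converge uniformly in [s]. Times of flight use
    [w = 1 / (th - V s)], Abel integrals [w = 1 - u ^ 2], and averages over an angle [w = sin]. *)
Lemma is_pseries_RInt_termwise (d : nat -> R) (w0 w : R -> R) A B W x :
  A <= B -> (forall s, A <= s <= B -> continuous w0 s /\ continuous w s /\ Rabs (w s) <= W) ->
  Rbar_lt (Rabs x * W) (CV_radius d) ->
  is_pseries (fun k => d k * RInt (fun s => w0 s * w s ^ k) A B) x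
    (RInt (fun s => w0 s * PSeries d (x * w s)) A B).
Proof.
  intros HAB Hw Hd.
  assert (HW : 0 <= W) by (destruct (Hw A ltac:(lra)) as [_ [_ H]]; pose proof (Rabs_pos (w A)); lra).
  assert (Hr : 0 <= Rabs x * W) by (apply Rmult_le_pos; [apply Rabs_pos | easy]).
  assert (Hxw : forall s, A <= s <= B -> Rabs (x * w s) <= Rabs x * W).
  { intros s Hs. rewrite Rabs_mult. apply Rmult_le_compat_l; [apply Rabs_pos | now apply Hw]. }
  destruct (PSeries_tail d _ Hr Hd) as [tau [Ht0 Ht]].
  set (G := fun s => w0 s * PSeries d (x * w s)).
  assert (HG : forall s, A <= s <= B -> continuous G s).
  { intros s Hs. destruct (Hw s Hs) as [H1 [H2 H3]]. apply continuous_Rmult; [easy|].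
    apply (continuous_comp (fun s => x * w s) (PSeries d)).
    - apply continuous_Rmult; [apply continuous_const | easy].
    - apply continuity_pt_filterlim. apply PSeries_continuity.
      eapply Rbar_le_lt_trans; [|exact Hd]. now apply Hxw. }
  set (S_ := fun n s => w0 s * sum_n (fun k => d k * (x * w s) ^ k) n).
  assert (HS : forall n, (forall s, A <= s <= B -> continuous (S_ n) s) /\
     RInt (S_ n) A B = sum_n (fun k => d k * RInt (fun s => w0 s * w s ^ k) A B * x ^ k) n).
  { assert (Hc : forall k s, A <= s <= B -> continuous (fun s => w0 s * w s ^ k) s).
    { intros k s Hs. destruct (Hw s Hs) as [H1 [H2 _]].
      apply continuous_Rmult; [easy|]. now apply continuous_pow_fun. }
    assert (Hc2 : forall k s, A <= s <= B -> continuous (fun s => w0 s * (d k * (x * w s) ^ k)) s).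
    { intros k s Hs. apply (continuous_ext (fun s => (d k * x ^ k) * (w0 s * w s ^ k))).
      - intros t. rewrite Rpow_mult_distr. eqR. ring.
      - apply continuous_Rmult; [apply continuous_const | now apply Hc]. }
    assert (HI : forall k, RInt (fun s => w0 s * (d k * (x * w s) ^ k)) A B =
        d k * RInt (fun s => w0 s * w s ^ k) A B * x ^ k).
    { intros k. rewrite (RInt_ext _ (fun s => (d k * x ^ k) * (w0 s * w s ^ k))).
      - rewrite (RInt_scal (V := R_CompleteNormedModule)); [unfold scal; simpl; unfold mult; simpl; ring|].
        apply ex_RInt_cont; auto.
      - intros s _. rewrite Rpow_mult_distr. eqR. ring. }
    induction n as [|n [IH1 IH2]].
    - split.
      + intros s Hs. apply (continuous_ext (fun s => w0 s * (d 0%nat * (x * w s) ^ 0))); [|now apply Hc2].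
        intros t. unfold S_. now rewrite sum_O.
      + rewrite sum_O, <- HI. apply RInt_ext. intros s _. unfold S_. now rewrite sum_O.
    - assert (E : forall s, S_ (S n) s = S_ n s + w0 s * (d (S n) * (x * w s) ^ S n)).
      { intros s. unfold S_. rewrite sum_n_S. ring. }
      split.
      + intros s Hs. apply (continuous_ext (fun s => S_ n s + w0 s * (d (S n) * (x * w s) ^ S n))).
        * intros; now rewrite E.
        * apply (continuous_plus (V := R_NormedModule)); [now apply IH1 | now apply Hc2].
      + rewrite sum_n_S, <- IH2, <- HI.
        rewrite (RInt_ext (S_ (S n)) (fun s => S_ n s + w0 s * (d (S n) * (x * w s) ^ S n)) A B) by (intros; apply E).
        apply (RInt_plus (V := R_CompleteNormedModule)); apply ex_RInt_cont; auto. }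
  apply is_pseries_R.
  change (is_lim_seq (sum_n (fun k => d k * RInt (fun s => w0 s * w s ^ k) A B * x ^ k)) (RInt G A B)).
  apply is_lim_seq_ext with (fun n => RInt G A B - (RInt G A B - RInt (S_ n) A B)).
  { intros n. rewrite (proj2 (HS n)). ring. }
  replace (Finite (RInt G A B)) with (Finite (RInt G A B - 0)) by (f_equal; ring).
  apply is_lim_seq_minus'; [apply is_lim_seq_const|].
  apply is_lim_seq_abs_0.
  set (I0 := RInt (fun s => Rabs (w0 s)) A B).
  assert (Hw0 : forall s, A <= s <= B -> continuous (fun s => Rabs (w0 s)) s).
  { intros s Hs. apply (continuous_comp w0 Rabs); [now apply Hw | apply continuous_Rabs]. }
  apply is_lim_seq_le_le with (fun _ => 0) (fun n => I0 * tau n).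
  - intros n. split; [apply Rabs_pos|].
    assert (Hd1 : forall s, A <= s <= B -> continuous (fun s => G s - S_ n s) s).
    { intros s Hs. apply (continuous_minus (V := R_NormedModule)); [now apply HG | now apply HS]. }
    assert (E := RInt_minus (V := R_CompleteNormedModule) G (S_ n) A B (ex_RInt_cont _ _ _ HG HAB)
      (ex_RInt_cont _ _ _ (proj1 (HS n)) HAB)).
    unfold minus, plus, opp in E; simpl in E. unfold Rminus at 1. rewrite <- E.
    eapply Rle_trans; [apply abs_RInt_le; [easy|now apply ex_RInt_cont]|].
    rewrite Rmult_comm. unfold I0.
    assert (E2 := RInt_scal (V := R_CompleteNormedModule) (fun s => Rabs (w0 s)) A B (tau n) (ex_RInt_cont _ _ _ Hw0 HAB)).
    unfold scal in E2; simpl in E2; unfold mult in E2; simpl in E2. rewrite <- E2.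
    apply RInt_le; [easy| | |].
    + apply ex_RInt_cont; [|easy]. intros s Hs.
      apply (continuous_comp (fun s => G s - S_ n s) Rabs); [now apply Hd1 | apply continuous_Rabs].
    + apply ex_RInt_cont; [|easy]. intros s Hs.
      apply continuous_Rmult; [apply continuous_const | now apply Hw0].
    + intros s Hs. unfold G, S_.
      replace (w0 s * PSeries d (x * w s) + - (w0 s * sum_n (fun k => d k * (x * w s) ^ k) n)) with
       (w0 s * (PSeries d (x * w s) - sum_n (fun k => d k * (x * w s) ^ k) n)) by ring.
      rewrite Rabs_mult, Rmult_comm. apply Rmult_le_compat_r; [apply Rabs_pos|].
      apply Ht, Hxw. lra.
  - apply is_lim_seq_const.
  - replace (Finite 0) with (Rbar_mult I0 0) by (simpl; f_equal; ring).
    now apply is_lim_seq_scal_l.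
Qed.

Lemma analytic_PSeries a r x : 0 < r -> Rbar_lt r (CV_radius a) -> Rabs x < r / 2 ->
  analytic_at (PSeries a) x.
Proof.
  intros Hr Ha Hx. destruct (bnd_of_radius a r ltac:(lra) Ha) as [M HM].
  pose proof (bnd_PS_const 1 r) as HP. rewrite Rabs_R1 in HP.
  destruct (is_pseries_flow (PS_const 1) a 0 r 1 M (fun v => v) (- (r / 2)) (r / 2))
    as [rho [Hrho Hf]]; auto; try lra.
  { intros v Hv. rewrite Rminus_0_r. split.
    - apply Rabs_def1; lra.
    - rewrite PSeries_PS_const. apply (is_derive_id (K := R_AbsRing)). }
  apply Rabs_def2 in Hx. destruct (Hf x ltac:(lra)) as [b Hb].
  set (e := Rmin rho (Rmin (r / 2 - x) (x + r / 2))).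
  assert (He : 0 < e) by (apply Rmin_pos; [easy | apply Rmin_pos; lra]).
  Rmin_bounds rho (Rmin (r / 2 - x) (x + r / 2)).
  Rmin_bounds (r / 2 - x) (x + r / 2).
  fold e in H, H0.
  exists e. split; [easy|]. exists b. intros z Hz. rewrite <- (Rminus_0_r z) at 2.
  apply Hb; [apply Rabs_def2 in Hz|]; lra.
Qed.

Lemma is_derive_RInt_upper (h : R -> R) r b : (forall z, Rabs z < r -> continuous h z) ->
  Rabs b < r -> is_derive (fun b => RInt h 0 b) b (h b).
Proof.
  intros H Hb. apply (is_derive_RInt (V := R_NormedModule) h (fun b => RInt h 0 b) 0 b).
  - apply (filter_imp (fun y => Rabs (y - b) < r - Rabs b)).
    + intros y Hy. apply (RInt_correct (V := R_CompleteNormedModule)).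
      apply (ex_RInt_continuous (V := R_CompleteNormedModule)). intros z Hz. apply H.
      assert (Hyr : Rabs y < r).
      { replace y with ((y - b) + b) by ring. eapply Rle_lt_trans; [apply Rabs_triang|]. lra. }
      apply Rabs_def2 in Hyr. unfold Rmin, Rmax in Hz. destruct Rle_dec; apply Rabs_def1; lra.
    + apply locally_abs. lra.
  - now apply H.
Qed.

(** * Travel times in a one-well potential *)

(** Unboundedness on both sides stands in for the two limits: with monotonicity it yields
    surjectivity of each branch, and it is visibly preserved by reflection. *)
Definition well (V : R -> R) : Prop :=
  (forall x, analytic_at V x) /\ V 0 = 0 /\ (forall y, y <> 0 -> 0 < y * Derive V y) /\
  (forall M, exists x, 0 < x /\ M < V x) /\ (forall M, exists x, x < 0 /\ M < V x).

Lemma UM_well V : UM V -> well V.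
Proof.
  intros (Ha & _ & H0 & Hd & Hp & Hm). split; [exact Ha|]. split; [easy|]. split; [easy|].
  split; intros M.
  - apply is_lim_spec in Hp. destruct (Hp M) as [N HN]. exists (Rmax N 0 + 1).
    pose proof (Rmax_l N 0). pose proof (Rmax_r N 0). split; [lra|]. apply HN. lra.
  - apply is_lim_spec in Hm. destruct (Hm M) as [N HN]. exists (Rmin N 0 - 1).
    Rmin_bounds N 0. split; [lra|]. apply HN. lra.
Qed.

Definition refl (V : R -> R) : R -> R := fun x => V (- x).

Lemma refl_refl V : refl (refl V) = V.
Proof. apply functional_extensionality. intros x. unfold refl. now rewrite Ropp_involutive. Qed.

Lemma well_ex_derive V x : well V -> ex_derive V x.
Proof. intros H. apply analytic_ex_derive, H. Qed.

Lemma well_continuous V x : well V -> continuous V x.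
Proof. intros H. apply analytic_continuous, H. Qed.

Lemma Derive_refl V x : well V -> Derive (refl V) x = - Derive V (- x).
Proof.
  intros H. apply is_derive_unique. replace (- Derive V (- x)) with (-1 * Derive V (- x)) by ring.
  apply (is_derive_comp V Ropp).
  - apply Derive_correct. now apply well_ex_derive.
  - auto_derive; auto.
Qed.

Lemma well_refl V : well V -> well (refl V).
Proof.
  intros HV. pose proof HV as (Ha & H0 & Hd & Hp & Hm). unfold well, refl at 1 2 4 5. repeat split.
  - intros x. apply analytic_ext with (fun y => V (0 - y)).
    + apply filter_forall. intros y. unfold refl. now rewrite Rminus_0_l.
    + apply analytic_comp_opp. apply Ha.
  - now rewrite Ropp_0.
  - intros y Hy. rewrite Derive_refl by easy. specialize (Hd (- y) ltac:(lra)). lra.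
  - intros M. destruct (Hm M) as [x [Hx H]]. exists (- x). rewrite Ropp_involutive. split; [lra|easy].
  - intros M. destruct (Hp M) as [x [Hx H]]. exists (- x). rewrite Ropp_involutive. split; [lra|easy].
Qed.

Section Well.
Context (V : R -> R) (HV : well V).

Lemma well_0 : V 0 = 0. Proof. apply HV. Qed.

Lemma well_derive_pos x : 0 < x -> 0 < Derive V x.
Proof.
  intros Hx. assert (H : 0 < x * Derive V x) by (apply HV; lra).
  apply (Rmult_lt_reg_l x); lra.
Qed.

Lemma well_incr x y : 0 <= x -> x < y -> V x < V y.
Proof.
  intros Hx Hxy. destruct (MVT_cor2 V (Derive V) x y Hxy) as [c [E Hc]].
  - intros c _. apply is_derive_Reals, Derive_correct. now apply well_ex_derive.
  - pose proof (well_derive_pos c ltac:(lra)). nra.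
Qed.

Lemma well_incr_le x y : 0 <= x -> x <= y -> V x <= V y.
Proof. intros Hx [Hxy | ->]; [left; now apply well_incr | lra]. Qed.

Lemma well_inj x y : 0 <= x -> 0 <= y -> V x = V y -> x = y.
Proof.
  intros Hx Hy E. destruct (Rtotal_order x y) as [H|[H|H]]; [|easy|].
  - pose proof (well_incr x y Hx H). lra.
  - pose proof (well_incr y x Hy H). lra.
Qed.

Lemma well_lt_inv x y : 0 <= x -> 0 <= y -> V x < V y -> x < y.
Proof. intros Hx Hy E. apply Rnot_le_lt. intros H. pose proof (well_incr_le y x Hy H). lra. Qed.

Lemma well_pos_right x : 0 < x -> 0 < V x.
Proof. intros Hx. rewrite <- well_0. apply well_incr; lra. Qed.

Lemma well_surj v : 0 <= v -> exists x, 0 <= x /\ V x = v.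
Proof.
  intros Hv. pose proof HV as (_ & H0 & _ & Hp & _). destruct (Hp v) as [b [Hb Hvb]].
  destruct (IVT_gen V 0 b v) as [x [Hx E]].
  - intros z. apply continuity_pt_filterlim. now apply well_continuous.
  - rewrite H0, Rmin_left, Rmax_right by lra. lra.
  - rewrite Rmin_left in Hx by lra. exists x. split; [lra|easy].
Qed.

(** Right branch of the inverse, arbitrary for negative [v]; the left branch is
    [- pinv (refl V)]. *)
Definition pinv (v : R) : R := epsilon (inhabits 0) (fun x => 0 <= x /\ V x = v).

Lemma pinv_spec v : 0 <= v -> 0 <= pinv v /\ V (pinv v) = v.
Proof. intros Hv. exact (epsilon_spec (inhabits 0) _ (well_surj v Hv)). Qed.

Lemma pinv_V x : 0 <= x -> pinv (V x) = x.
Proof.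
  intros Hx. assert (Hv : 0 <= V x) by (rewrite <- well_0; apply well_incr_le; lra).
  destruct (pinv_spec _ Hv) as [H1 H2]. now apply well_inj.
Qed.

Lemma pinv_pos v : 0 < v -> 0 < pinv v.
Proof.
  intros Hv. destruct (pinv_spec v ltac:(lra)) as [[H|H] E]; [easy|].
  rewrite <- H, well_0 in E. lra.
Qed.

Lemma pinv_incr v w : 0 <= v -> v < w -> pinv v < pinv w.
Proof.
  intros Hv Hw. destruct (pinv_spec v Hv), (pinv_spec w ltac:(lra)). apply well_lt_inv; try easy. lra.
Qed.

Lemma pinv_continuous v : 0 < v -> continuous pinv v.
Proof.
  intros Hv P HP. apply locally_abs_inv in HP as [e [He HP]].
  set (x := pinv v). pose proof (pinv_pos v Hv) as Hx. fold x in Hx, HP.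
  set (e' := Rmin e x / 2).
  assert (He' : 0 < e' < e /\ e' < x).
  { assert (0 < Rmin e x) by now apply Rmin_pos.
    Rmin_bounds e x. unfold e'. lra. }
  assert (Ex : V x = v) by (apply pinv_spec; lra).
  assert (H1 : V (x - e') < v) by (rewrite <- Ex; apply well_incr; lra).
  assert (H2 : v < V (x + e')) by (rewrite <- Ex; apply well_incr; lra).
  assert (H3 : 0 < V (x - e')) by (apply well_pos_right; lra).
  apply (locally_between (V (x - e')) (V (x + e'))); [easy|].
  intros w Hw. apply HP.
  assert (E1 : pinv (V (x - e')) = x - e') by (apply pinv_V; lra).
  assert (E2 : pinv (V (x + e')) = x + e') by (apply pinv_V; lra).
  pose proof (pinv_incr (V (x - e')) w ltac:(lra) ltac:(lra)).
  pose proof (pinv_incr w (V (x + e')) ltac:(lra) ltac:(lra)).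
  apply Rabs_def1; lra.
Qed.

Lemma locally_gt_0 (v : R) (Q : R -> Prop) : 0 < v -> (forall w, 0 < w -> Q w) -> locally v Q.
Proof. intros Hv H. apply (locally_between 0 (v + 1)); [lra|]. intros; apply H; lra. Qed.

Lemma pinv_analytic v : 0 < v -> analytic_at pinv v.
Proof.
  intros Hv. pose proof (pinv_pos v Hv). apply (analytic_inverse V).
  - apply HV.
  - apply Rgt_not_eq. now apply well_derive_pos.
  - apply locally_gt_0; [easy|]. intros. apply pinv_spec. lra.
  - apply locally_gt_0; [easy|]. intros. now apply pinv_continuous.
Qed.

Lemma pinv_derive v : 0 < v -> is_derive pinv v (/ Derive V (pinv v)).
Proof.
  intros Hv. pose proof (pinv_pos v Hv). apply (is_derive_inverse V).
  - apply Derive_correct. now apply well_ex_derive.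
  - apply Rgt_not_eq. now apply well_derive_pos.
  - apply locally_gt_0; [easy|]. intros. apply pinv_spec. lra.
  - now apply pinv_continuous.
Qed.

Definition dpinv : R -> R := Derive pinv.

Lemma dpinv_eq v : 0 < v -> dpinv v = / Derive V (pinv v).
Proof. intros Hv. apply is_derive_unique. now apply pinv_derive. Qed.

Lemma dpinv_pos v : 0 < v -> 0 < dpinv v.
Proof.
  intros Hv. rewrite dpinv_eq by easy. apply Rinv_0_lt_compat, well_derive_pos. now apply pinv_pos.
Qed.

Lemma dpinv_analytic v : 0 < v -> analytic_at dpinv v.
Proof. intros Hv. now apply analytic_Derive, pinv_analytic. Qed.

(* Time of flight from [0] to [x] at energy [th]; junk unless [V x < th]. *)
Definition travel (x th : R) : R := RInt (fun s => / sqrt (2 * (th - V s))) 0 x.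

(* The travel time to the turning point in terms of the momentum [z]: on the energy level
   [z^2/2 + V q = th], [dt = - dz / V' q = - dpinv (th - z^2/2) dz]. *)
Definition ptime (th p : R) : R := RInt (fun z => dpinv (th - z ^ 2 / 2)) 0 p.

(* The time from [0] to the turning point, split at the energy level [V q = th / 2] so that
   both integrals are proper. *)
Definition quarter (th : R) : R := travel (pinv (th / 2)) th + ptime th (sqrt th).

Lemma speed_pos th s : V s < th -> 0 < sqrt (2 * (th - V s)).
Proof. intros H. apply sqrt_lt_R0. lra. Qed.

Lemma speed_continuous th s : V s < th -> continuous (fun s => / sqrt (2 * (th - V s))) s.
Proof.
  intros H. apply ex_derive_cont.
  auto_derive. repeat split; [now apply well_ex_derive | lra |].
  apply Rgt_not_eq. now apply speed_pos.
Qed.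

End Well.

Lemma well_between V x s : well V -> Rmin 0 x <= s <= Rmax 0 x -> V s <= V x.
Proof.
  intros HV Hs. destruct (Rle_dec 0 x) as [Hx|Hx].
  - rewrite Rmin_left, Rmax_right in Hs by easy. apply well_incr_le; [easy|lra..].
  - rewrite Rmin_right, Rmax_left in Hs by lra.
    assert (H := well_incr_le (refl V) (well_refl V HV) (- s) (- x) ltac:(lra) ltac:(lra)).
    unfold refl in H. now rewrite !Ropp_involutive in H.
Qed.

Lemma well_nonneg V x : well V -> 0 <= V x.
Proof.
  intros HV. rewrite <- (well_0 V HV). apply well_between; [easy|].
  unfold Rmin, Rmax; destruct Rle_dec; lra.
Qed.

Lemma travel_ex V x th : well V -> V x < th -> ex_RInt (fun s => / sqrt (2 * (th - V s))) 0 x.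
Proof.
  intros HV H. apply (ex_RInt_continuous (V := R_CompleteNormedModule)). intros s Hs.
  apply speed_continuous; [easy|]. pose proof (well_between V x s HV Hs). lra.
Qed.

Lemma travel_derive V x th : well V -> V x < th ->
  is_derive (fun x => travel V x th) x (/ sqrt (2 * (th - V x))).
Proof.
  intros HV H.
  apply (is_derive_RInt (V := R_NormedModule) (fun s => / sqrt (2 * (th - V s))) (fun x => travel V x th) 0 x).
  - assert (Hl : locally x (fun y => V y < th)).
    { apply (well_continuous V x HV (fun t => t < th)). now apply open_lt. }
    revert Hl. apply filter_imp. intros y Hy.
    apply (RInt_correct (V := R_CompleteNormedModule)). now apply travel_ex.
  - now apply speed_continuous.
Qed.

Lemma travel_0 V th : travel V 0 th = 0.
Proof. apply (RInt_point (V := R_CompleteNormedModule)). Qed.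

Lemma travel_refl V x th : well V -> V (- x) < th -> travel (refl V) x th = - travel V (- x) th.
Proof.
  intros HV H. apply (is_RInt_unique (V := R_CompleteNormedModule)).
  assert (E := RInt_correct (V := R_CompleteNormedModule) _ _ _ (travel_ex V (- x) th HV H)).
  rewrite <- Ropp_0 in E at 1. apply (is_RInt_comp_opp (V := R_NormedModule)) in E.
  apply (is_RInt_opp (V := R_NormedModule)) in E.
  eapply is_RInt_ext; [|exact E]. intros s _. unfold opp; simpl. apply Ropp_involutive.
Qed.

(** At energy [y] the integrand is its value at [th] times [/ sqrt (1 + z)] with
    [z = (y - th) / (th - V s)]. The smallest gap [m = th - V x] bounds [z] uniformly in [s], so the
    binomial series can be integrated termwise. *)
Lemma travel_analytic_right V x th : well V -> 0 <= x -> V x < th ->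
  analytic_at (fun th => travel V x th) th.
Proof.
  intros HV Hx H.
  assert (Hb : analytic_at (fun z => / sqrt (1 + z)) 0).
  { apply analytic_inv.
    - apply (analytic_sqrt (fun z => 1 + z)); [|lra].
      apply analytic_plus; [apply analytic_const | apply analytic_id].
    - apply Rgt_not_eq, sqrt_lt_R0. lra. }
  apply analytic_series in Hb as [b [Hb Eb]].
  assert (HL := locally_and _ _ _ Eb (locally_radius b 0 Hb)).
  apply locally_abs_inv in HL as [r [Hr HL]].
  set (m := th - V x). assert (Hm : 0 < m) by (unfold m; lra).
  assert (Hs : forall s, 0 <= s <= x -> m <= th - V s).
  { intros s Hs. pose proof (well_incr_le V HV s x ltac:(lra) ltac:(lra)). unfold m. lra. }
  set (w0 := fun s => / sqrt (2 * (th - V s))). set (w := fun s => / (th - V s)).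
  assert (Hw : forall s, 0 <= s <= x -> continuous w0 s /\ continuous w s /\ Rabs (w s) <= / m).
  { intros s Hsx. specialize (Hs s Hsx). split; [|split].
    - apply speed_continuous; [easy|lra].
    - apply ex_derive_cont. unfold w. auto_derive.
      split; [now apply well_ex_derive|lra].
    - unfold w. rewrite Rabs_pos_eq; [apply Rinv_le_contravar; lra|].
      left. apply Rinv_0_lt_compat. lra. }
  assert (Hr1 : 0 < Rmin r 1) by (apply Rmin_pos; lra).
  exists (m * Rmin r 1). split; [nra|].
  exists (fun k => b k * RInt (fun s => w0 s * w s ^ k) 0 x). intros y Hy.
  assert (Hq : Rabs (y - th) * / m < Rmin r 1).
  { apply (Rmult_lt_reg_r m); [easy|]. rewrite Rmult_assoc, Rinv_l; lra. }
  Rmin_bounds r 1.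
  assert (Hq0 : 0 <= Rabs (y - th) * / m).
  { apply Rmult_le_pos; [apply Rabs_pos|]. left. now apply Rinv_0_lt_compat. }
  replace (travel V x y) with (RInt (fun s => w0 s * PSeries b ((y - th) * w s)) 0 x).
  - apply is_pseries_RInt_termwise with (/ m); [easy | exact Hw |].
    destruct (HL (Rabs (y - th) * / m)) as [_ Hc].
    + rewrite Rminus_0_r, Rabs_pos_eq; lra.
    + now rewrite Rminus_0_r, Rabs_pos_eq in Hc.
  - apply RInt_ext. intros s Hsx. rewrite Rmin_left, Rmax_right in Hsx by easy.
    destruct (Hw s ltac:(lra)) as [_ [_ Hws]]. specialize (Hs s ltac:(lra)).
    assert (Hz : Rabs ((y - th) * w s) < Rmin r 1).
    { rewrite Rabs_mult. eapply Rle_lt_trans; [|exact Hq]. apply Rmult_le_compat_l; [apply Rabs_pos|easy]. }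
    destruct (HL ((y - th) * w s)) as [Hc _]; [rewrite Rminus_0_r; lra|].
    rewrite Rminus_0_r in Hc. rewrite <- Hc. unfold w0. apply Rabs_def2 in Hz.
    rewrite <- Rinv_mult, <- sqrt_mult by lra. f_equal. f_equal. unfold w. field. lra.
Qed.

Lemma travel_analytic V x th : well V -> V x < th -> analytic_at (fun th => travel V x th) th.
Proof.
  intros HV H. destruct (Rle_dec 0 x) as [Hx|Hx]; [now apply travel_analytic_right|].
  apply analytic_ext with (fun th => - travel (refl V) (- x) th).
  - apply (locally_between (V x) (th + 1)); [lra|]. intros y Hy.
    rewrite travel_refl, !Ropp_involutive; [easy|easy|]. rewrite Ropp_involutive. lra.
  - apply analytic_opp. apply travel_analytic_right; [now apply well_refl|lra|].
    unfold refl. now rewrite Ropp_involutive.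
Qed.

Lemma sq_lt_of_abs_lt_sqrt z t : 0 < t -> Rabs z < sqrt t -> z ^ 2 < t.
Proof.
  intros Ht H. rewrite <- (sqrt_sqrt t) by lra. rewrite <- (Rabs_pos_eq (z ^ 2)) by apply pow2_ge_0.
  simpl. rewrite Rmult_1_r, Rabs_mult. pose proof (Rabs_pos z). nra.
Qed.

(** * Abel integrals and quarter periods *)

(** The momentum integral at energy [v + x] down to level [v], after the substitution
    [z = sqrt (2 * x) * u] and without the factor [sqrt (2 * x)]. The factor 1 is the weight
    expected by the termwise integration lemma. *)
Definition abel (d : R -> R) (v x : R) : R := RInt (fun u => 1 * d (v + x * (1 - u ^ 2))) 0 1.

Definition abel_coef (k : nat) : R := RInt (fun u => 1 * (1 - u ^ 2) ^ k) 0 1.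

Lemma abel_weight_cont u : continuous (fun u => 1 - u ^ 2) u.
Proof. apply ex_derive_cont. auto_derive. auto. Qed.

Lemma abel_coef_pos k : 0 < abel_coef k.
Proof.
  unfold abel_coef. apply RInt_gt_0; [lra| |].
  - intros u Hu. rewrite Rmult_1_l. apply pow_lt. nra.
  - intros u _. apply continuous_Rmult; [apply continuous_const|].
    apply continuous_pow_fun, abel_weight_cont.
Qed.

(** The Abel integral acts diagonally on Taylor coefficients at [v], with positive factors; on germs
    it is therefore injective. *)
Lemma is_pseries_abel (d : R -> R) (a : nat -> R) v r x :
  (forall y, Rabs (y - v) < r -> is_pseries a (y - v) (d y)) -> Rabs x < r ->
  is_pseries (fun k => a k * abel_coef k) x (abel d v x).
Proof.
  intros H Hx.
  assert (Hd : Rbar_lt (Rabs x * 1) (CV_radius a)).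
  { set (s := (Rabs x + r) / 2). pose proof (Rabs_pos x).
    assert (Hs : Rabs s = s) by (apply Rabs_pos_eq; unfold s; lra).
    apply Rbar_lt_le_trans with s; [simpl; unfold s; lra|]. rewrite <- Hs.
    apply ex_pseries_radius_le. exists (d (v + s)).
    assert (Hp := H (v + s)). replace (v + s - v) with s in Hp by ring. apply Hp.
    rewrite Hs. unfold s. lra. }
  replace (abel d v x) with (RInt (fun u => 1 * PSeries a (x * (1 - u ^ 2))) 0 1).
  - apply is_pseries_RInt_termwise with 1; [lra| |easy].
    intros s Hs. split; [apply continuous_const|]. split; [apply abel_weight_cont|].
    rewrite Rabs_pos_eq; nra.
  - apply RInt_ext. intros s Hs. rewrite Rmin_left, Rmax_right in Hs by lra. f_equal.
    apply is_pseries_unique. assert (Hp := H (v + x * (1 - s ^ 2))).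
    replace (v + x * (1 - s ^ 2) - v) with (x * (1 - s ^ 2)) in Hp by ring. apply Hp.
    rewrite Rabs_mult, (Rabs_pos_eq (1 - s ^ 2)) by nra. pose proof (Rabs_pos x). nra.
Qed.

Section Quarter.
Context (V : R -> R) (HV : well V).

Lemma energy_pos th z : 0 < th -> Rabs z < sqrt (2 * th) -> 0 < th - z ^ 2 / 2.
Proof. intros Ht Hz. apply sq_lt_of_abs_lt_sqrt in Hz; lra. Qed.

Lemma ptime_integrand_cont th z : 0 < th -> Rabs z < sqrt (2 * th) ->
  continuous (fun z => dpinv V (th - z ^ 2 / 2)) z.
Proof.
  intros Ht Hz. apply (continuous_comp (fun z => th - z ^ 2 / 2) (dpinv V)).
  - apply ex_derive_cont. auto_derive. auto.
  - apply analytic_continuous. apply dpinv_analytic; [easy|]. now apply energy_pos.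
Qed.

Lemma ptime_derive th p : 0 < th -> Rabs p < sqrt (2 * th) ->
  is_derive (ptime V th) p (dpinv V (th - p ^ 2 / 2)).
Proof.
  intros Ht Hp. apply (is_derive_RInt_upper (fun z => dpinv V (th - z ^ 2 / 2)) (sqrt (2 * th))); [|easy].
  intros z Hz. now apply ptime_integrand_cont.
Qed.

Lemma ptime_0 th : ptime V th 0 = 0.
Proof. apply (RInt_point (V := R_CompleteNormedModule)). Qed.

Lemma ptime_nonneg th p : 0 < th -> 0 <= p < sqrt (2 * th) -> 0 <= ptime V th p.
Proof.
  intros Ht Hp. apply RInt_ge_0; [easy| |].
  - apply ex_RInt_cont; [|easy]. intros s Hs. apply ptime_integrand_cont; [easy|].
    rewrite Rabs_pos_eq; lra.
  - intros z Hz. left. apply dpinv_pos; [easy|]. apply energy_pos; [easy|]. rewrite Rabs_pos_eq; lra.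
Qed.

Lemma sqrt_energy_bounds th v : 0 < v < th -> 0 < sqrt (2 * (th - v)) < sqrt (2 * th).
Proof. intros H. split; [apply sqrt_lt_R0 | apply sqrt_lt_1]; lra. Qed.

(** Moving the cut transfers the same time element from the position integral to the momentum
    integral, so the derivative in the cut level is 0. Both integrals stay proper as long as the
    level is strictly between 0 and [th]. *)
Lemma quarter_split th v : 0 < v < th ->
  quarter V th = travel V (pinv V v) th + ptime V th (sqrt (2 * (th - v))).
Proof.
  intros Hv. set (f := fun v => travel V (pinv V v) th + ptime V th (sqrt (2 * (th - v)))).
  assert (E : quarter V th = f (th / 2)).
  { unfold f, quarter. do 3 f_equal. lra. }
  rewrite E. apply (const_of_derive_0 f 0 th); [|lra|lra].
  intros w Hw. destruct (sqrt_energy_bounds th w Hw) as [Hs1 Hs2].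
  assert (Hp : V (pinv V w) = w) by (apply (pinv_spec V HV); lra).
  set (s := sqrt (2 * (th - w))) in *.
  assert (Hss : s ^ 2 = 2 * (th - w)) by (unfold s; simpl; rewrite Rmult_1_r; apply sqrt_sqrt; lra).
  replace 0 with (dpinv V w * / s + (- / s) * dpinv V (th - s ^ 2 / 2)).
  - apply (is_derive_plus (V := R_NormedModule)).
    + apply (is_derive_comp (fun x => travel V x th) (pinv V)).
      * unfold s. rewrite <- Hp at 2. apply travel_derive; [easy|lra].
      * apply Derive_correct. apply analytic_ex_derive, pinv_analytic; [easy|lra].
    + apply (is_derive_comp (ptime V th) (fun w => sqrt (2 * (th - w)))).
      * apply ptime_derive; [lra|]. fold s. rewrite Rabs_pos_eq; lra.
      * auto_derive; [lra|]. change (2 * (th - w)) with (2 * (th - w)).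
        replace (2 * (th + - w)) with (2 * (th - w)) by ring. fold s. field. lra.
  - rewrite Hss. replace (th - 2 * (th - w) / 2) with w by field. ring.
Qed.

Lemma quarter_travel th x : 0 < x -> V x < th ->
  travel V x th + ptime V th (sqrt (2 * (th - V x))) = quarter V th.
Proof.
  intros Hx H. pose proof (well_pos_right V HV x Hx).
  rewrite (quarter_split th (V x)) by lra. rewrite pinv_V; [easy|easy|lra].
Qed.

Lemma ptime_abel v x : 0 < v -> 0 < x ->
  ptime V (v + x) (sqrt (2 * x)) = sqrt (2 * x) * abel (dpinv V) v x.
Proof.
  intros Hv Hx. set (s := sqrt (2 * x)).
  assert (Hs : 0 < s) by (apply sqrt_lt_R0; lra).
  assert (Hss : s * s = 2 * x) by (apply sqrt_sqrt; lra).
  assert (Hlt : s < sqrt (2 * (v + x))) by (apply sqrt_lt_1; lra).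
  unfold ptime, abel.
  assert (Hc : forall u, 0 <= u <= 1 -> continuous (fun u => 1 * dpinv V (v + x * (1 - u ^ 2))) u).
  { intros u Hu. apply continuous_Rmult; [apply continuous_const|].
    apply (continuous_comp (fun u => v + x * (1 - u ^ 2)) (dpinv V)).
    - apply ex_derive_cont. auto_derive. auto.
    - apply analytic_continuous. apply dpinv_analytic; [easy|].
      assert (0 <= x * (1 - u ^ 2)) by (apply Rmult_le_pos; nra). lra. }
  assert (E := RInt_comp_lin (V := R_CompleteNormedModule) (fun z => dpinv V (v + x - z ^ 2 / 2)) s 0 0 1).
  rewrite !Rplus_0_r, Rmult_0_r, Rmult_1_r in E. rewrite <- E.
  - rewrite <- (RInt_scal (V := R_CompleteNormedModule)).
    + apply RInt_ext. intros u _. unfold scal; simpl; unfold mult; simpl. eqR.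
      rewrite Rmult_1_l. do 2 f_equal. rewrite Rplus_0_r.
      replace (s * u * (s * u * 1)) with ((s * s) * u ^ 2) by ring. rewrite Hss. field.
    + apply ex_RInt_cont; [easy|lra].
  - apply ex_RInt_cont; [|lra]. intros z Hz. apply ptime_integrand_cont; [lra|].
    rewrite Rabs_pos_eq; lra.
Qed.

(** As the left side is analytic in [x] at 0, the singular part there of the time of flight to level
    [v] is exactly minus the second term. *)
Lemma quarter_abel v x : 0 < v -> 0 < x ->
  quarter V (v + x) = travel V (pinv V v) (v + x) + sqrt (2 * x) * abel (dpinv V) v x.
Proof.
  intros Hv Hx. rewrite <- ptime_abel by easy. rewrite (quarter_split (v + x) v) by lra.
  do 3 f_equal. ring.
Qed.

(** With the cut at a fixed level [v] below [th], the time of flight, the root of [y - v] and the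
    Abel integral are all analytic in the energy [y] near [th]. *)
Lemma quarter_analytic th : 0 < th -> analytic_at (quarter V) th.
Proof.
  intros Ht. destruct (analytic_uniform _ _ (dpinv_analytic V HV th Ht)) as [rho [Hrho H]].
  (* The level [v = th - e] lies within [rho] of [th], and the Taylor series of [dpinv V] at [v]
     reaches past [th]: its radius exceeds [3 * e], while [th - v = e] is within half of that. *)
  set (e := Rmin rho th / 4).
  assert (He : 0 < e /\ 4 * e <= rho /\ 4 * e <= th).
  { assert (0 < Rmin rho th) by now apply Rmin_pos. unfold e.
    Rmin_bounds rho th. lra. }
  set (v := th - e). destruct (H v) as [a Ha]; [unfold v; apply Rabs_def1; lra|].
  set (b := fun k => a k * abel_coef k).
  assert (Hb : forall x, Rabs x < rho -> is_pseries b x (abel (dpinv V) v x)).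
  { intros x Hx. now apply is_pseries_abel with rho. }
  assert (Hrb : Rbar_lt (3 * e) (CV_radius b)).
  { apply Rbar_lt_le_trans with (Rabs (7 / 2 * e)); [simpl; rewrite Rabs_pos_eq; lra|].
    apply ex_pseries_radius_le. eexists. apply Hb. rewrite Rabs_pos_eq; lra. }
  assert (Hab : analytic_at (PSeries b) (th - v)).
  { apply analytic_PSeries with (3 * e); [lra|easy|]. replace (th - v) with e by (unfold v; ring).
    rewrite Rabs_pos_eq; lra. }
  assert (Hsh : analytic_at (fun y => PSeries b (y - v)) th).
  { destruct Hab as [r [Hr [c Hc]]]. exists r. split; [easy|]. exists c. intros y Hy.
    replace (y - th) with (y - v - (th - v)) by ring. apply Hc.
    now replace (y - v - (th - v)) with (y - th) by ring. }
  apply analytic_ext with (fun y => travel V (pinv V v) y + sqrt (2 * (y - v)) * PSeries b (y - v)).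
  - apply (locally_between v (v + 2 * e)); [unfold v; lra|]. intros y Hy.
    replace y with (v + (y - v)) at 4 by ring. rewrite quarter_abel by (unfold v in *; lra).
    replace (v + (y - v)) with y by ring. do 2 f_equal. apply is_pseries_unique, Hb.
    apply Rabs_def1; lra.
  - apply analytic_plus.
    + apply travel_analytic; [easy|]. rewrite (proj2 (pinv_spec V HV v ltac:(unfold v; lra))).
      unfold v. lra.
    + apply analytic_mult; [|easy].
      apply (analytic_sqrt (fun y => 2 * (y - v))); [|unfold v; lra].
      apply analytic_scal, analytic_minus; [apply analytic_id | apply analytic_const].
Qed.

Lemma travel_ge th x : 0 <= x -> V x < th -> x / sqrt (2 * th) <= travel V x th.
Proof.
  intros Hx H. pose proof (well_nonneg V x HV).
  replace (x / sqrt (2 * th)) with (RInt (fun _ => / sqrt (2 * th)) 0 x).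
  - apply RInt_le; [easy|apply ex_RInt_const|now apply travel_ex|].
    intros s Hs. pose proof (well_incr_le V HV s x ltac:(lra) ltac:(lra)).
    pose proof (well_nonneg V s HV).
    apply Rinv_le_contravar; [apply speed_pos; lra|]. apply sqrt_le_1; lra.
  - rewrite RInt_const. unfold scal; simpl; unfold mult; simpl. unfold Rdiv. ring.
Qed.

Lemma quarter_ge th v : 0 < v < th -> pinv V v / sqrt (2 * th) <= quarter V th.
Proof.
  intros Hv. destruct (pinv_spec V HV v ltac:(lra)) as [H1 H2].
  rewrite (quarter_split th v Hv). pose proof (sqrt_energy_bounds th v Hv).
  pose proof (ptime_nonneg th (sqrt (2 * (th - v))) ltac:(lra) ltac:(lra)).
  pose proof (travel_ge th (pinv V v) H1 ltac:(lra)). lra.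
Qed.

Lemma quarter_pos th : 0 < th -> 0 < quarter V th.
Proof.
  intros Ht. eapply Rlt_le_trans; [|apply (quarter_ge th (th / 2)); lra].
  apply Rdiv_lt_0_compat; [apply pinv_pos; [easy|lra] | apply sqrt_lt_R0; lra].
Qed.

Lemma ptime_continuous_0 th : 0 < th -> continuous (ptime V th) 0.
Proof.
  intros Ht. eapply is_derive_cont. apply ptime_derive; [easy|].
  rewrite Rabs_R0. apply sqrt_lt_R0. lra.
Qed.

End Quarter.

(* [sqrt (2 x) * abel d v x] is odd in [s = sqrt x] while [k (v + s^2)] is even, so both vanish. *)
Lemma abel_regular_zero (d k : R -> R) v e : analytic_at d v -> analytic_at k v -> 0 < e ->
  (forall x, 0 < x < e -> sqrt (2 * x) * abel d v x = k (v + x)) ->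
  locally v (fun y => d y = 0).
Proof.
  intros [r [Hr [a Ha]]] Hk He H.
  apply analytic_series in Hk as [c [Hc Hk]].
  apply locally_abs_inv in Hk as [r' [Hr' Hk]].
  set (b := fun n => a n * abel_coef n).
  assert (Hb : forall x, Rabs x < r -> is_pseries b x (abel d v x)).
  { intros x Hx. now apply is_pseries_abel with r. }
  assert (Hrb : Rbar_lt 0 (CV_radius b)).
  { apply radius_pos_of_ex_pseries with (r / 2); [lra|]. eexists. apply Hb. rewrite Rabs_pos_eq; lra. }
  destruct (min4_pos e 1 r r') as (m & Hm); [lra..|].
  assert (H2 : 0 < sqrt 2) by (apply sqrt_lt_R0; lra).
  assert (Hz : forall n, (fun _ : nat => 0) n = PS_interlace c (PS_scal (- sqrt 2) b) n).
  { apply PSeries_parity with m; auto.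
    - rewrite CV_radius_scal; [easy|lra].
    - now rewrite CV_radius_const_0.
    - apply Hm.
    - intros s Hs. rewrite PSeries_const_0, PSeries_scal.
      assert (Hs2 : 0 < s ^ 2 < m) by nra.
      rewrite (is_pseries_unique b (s ^ 2) (abel d v (s ^ 2))).
      + replace (PSeries c (s ^ 2)) with (k (v + s ^ 2)).
        * rewrite <- H by lra. rewrite sqrt_mult by nra. rewrite sqrt_pow2 by lra. ring.
        * rewrite Hk; [f_equal; ring|]. replace (v + s ^ 2 - v) with (s ^ 2) by ring.
          rewrite Rabs_pos_eq; lra.
      + apply Hb. rewrite Rabs_pos_eq; lra. }
  assert (Ha0 : forall n, a n = 0).
  { intros n. specialize (Hz (2 * n + 1)%nat). unfold PS_interlace in Hz.
    rewrite Nat.add_1_r, Nat.even_succ, Nat.odd_mul in Hz. simpl Nat.odd in Hz. simpl andb in Hz.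
    cbn iota in Hz. rewrite Nat.div2_succ_double in Hz.
    unfold PS_scal, scal in Hz; simpl in Hz; unfold mult in Hz; simpl in Hz.
    pose proof (abel_coef_pos n). unfold b in Hz. symmetry in Hz.
    apply Rmult_integral in Hz. destruct Hz as [Hz|Hz]; [lra|].
    apply Rmult_integral in Hz. destruct Hz as [Hz|Hz]; [easy|lra]. }
  apply (filter_imp (fun y => Rabs (y - v) < r)); [|now apply locally_abs].
  intros y Hy. rewrite <- (is_pseries_unique _ _ _ (Ha y Hy)).
  rewrite (PSeries_ext _ (fun _ => 0)) by easy. apply PSeries_const_0.
Qed.

Lemma abel_lincomb (d1 d2 : R -> R) c1 c2 v x : 0 < x ->
  (forall y, v <= y -> continuous d1 y) -> (forall y, v <= y -> continuous d2 y) ->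
  abel (fun y => c1 * d1 y + c2 * d2 y) v x = c1 * abel d1 v x + c2 * abel d2 v x.
Proof.
  intros Hx H1 H2. unfold abel.
  assert (Hc : forall d : R -> R, (forall y, v <= y -> continuous d y) ->
    ex_RInt (fun u => 1 * d (v + x * (1 - u ^ 2))) 0 1).
  { intros d Hd. apply ex_RInt_cont; [|lra]. intros u Hu.
    apply continuous_Rmult; [apply continuous_const|].
    apply (continuous_comp (fun u => v + x * (1 - u ^ 2)) d).
    - apply ex_derive_cont. auto_derive. auto.
    - apply Hd. assert (0 <= x * (1 - u ^ 2)) by (apply Rmult_le_pos; nra). lra. }
  assert (E1 := RInt_scal (V := R_CompleteNormedModule) _ _ _ c1 (Hc d1 H1)).
  assert (E2 := RInt_scal (V := R_CompleteNormedModule) _ _ _ c2 (Hc d2 H2)).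
  assert (X1 := ex_RInt_scal (V := R_NormedModule) _ _ _ c1 (Hc d1 H1)).
  assert (X2 := ex_RInt_scal (V := R_NormedModule) _ _ _ c2 (Hc d2 H2)).
  assert (E := RInt_plus (V := R_CompleteNormedModule) _ _ _ _ X1 X2).
  unfold scal, plus in *; simpl in *; unfold mult in *; simpl in *.
  rewrite <- E1, <- E2, <- E. apply RInt_ext. intros u _. eqR. ring.
Qed.

Lemma travel_pinv_small V th e : well V -> 0 < th -> 0 < e ->
  exists d, 0 < d /\ forall v, 0 < v < d -> Rabs (travel V (pinv V v) th) < e.
Proof.
  intros HV Ht He.
  assert (Hc : continuous (fun x => travel V x th) 0).
  { eapply is_derive_cont. apply travel_derive; [easy|].
    now rewrite (well_0 V HV). }
  assert (Hl := Hc (fun t => Rabs (t - travel V 0 th) < e) (locally_abs _ _ He)).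
  apply locally_abs_inv in Hl as [r [Hr Hl]].
  exists (V (r / 2)). split; [apply well_pos_right; [easy|lra]|].
  intros v Hv. specialize (Hl (pinv V v)). rewrite travel_0, !Rminus_0_r in Hl.
  apply Hl. pose proof (pinv_incr V HV v (V (r / 2)) ltac:(lra) ltac:(lra)) as Hi.
  rewrite (pinv_V V HV) in Hi by lra. pose proof (pinv_pos V HV v ltac:(lra)).
  rewrite Rabs_pos_eq; lra.
Qed.

(* A combination of the two travel times to level [al] that stays analytic at [al] has
   [c1 * pinv V = c2 * pinv (refl V) + const] and hence vanishes identically. *)
Lemma travel_level_cancel V c1 c2 al (k : R -> R) e : well V -> 0 < al -> 0 < e ->
  analytic_at k al ->
  (forall th, al < th < al + e ->
     c1 * travel V (pinv V al) th - c2 * travel (refl V) (pinv (refl V) al) th = k th) ->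
  forall th, al < th ->
     c1 * travel V (pinv V al) th - c2 * travel (refl V) (pinv (refl V) al) th = 0.
Proof.
  intros HV Hal He Hk H. pose proof (well_refl V HV) as HW. set (W := refl V) in *.
  set (d := fun y => c1 * dpinv V y + (- c2) * dpinv W y).
  assert (Hd : forall y, 0 < y -> analytic_at d y).
  { intros y Hy. apply analytic_plus; apply analytic_scal; now apply dpinv_analytic. }
  assert (Hl : locally al (fun y => d y = 0)).
  { apply abel_regular_zero with (fun th => c1 * quarter V th - c2 * quarter W th - k th) e; auto.
    - apply analytic_minus; [|easy].
      apply analytic_minus; apply analytic_scal; now apply quarter_analytic.
    - intros x Hx. unfold d. rewrite abel_lincomb; [|lra| |].
      + rewrite <- H by lra. rewrite (quarter_abel V HV al x), (quarter_abel W HW al x) by lra. ring.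
      + intros y Hy. apply analytic_continuous, dpinv_analytic; [easy|lra].
      + intros y Hy. apply analytic_continuous, dpinv_analytic; [easy|lra]. }
  assert (Hd0 : forall y, 0 < y -> d y = 0).
  { intros y Hy. apply (analytic_identity d 0 (Rmax y al + 1) al); [intros; apply Hd; lra| |easy|];
      pose proof (Rmax_l y al); pose proof (Rmax_r y al); lra. }
  intros th Hth.
  set (h := fun v => c1 * travel V (pinv V v) th - c2 * travel W (pinv W v) th).
  assert (Hh : forall v w, 0 < v < th -> 0 < w < th -> h v = h w).
  { apply const_of_derive_0. intros v Hv.
    assert (Hder : forall U, well U -> is_derive (fun v => travel U (pinv U v) th) v
        (dpinv U v * / sqrt (2 * (th - v)))).
    { intros U HU. assert (E : U (pinv U v) = v) by (apply (pinv_spec U HU); lra).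
      apply (is_derive_comp (fun x => travel U x th) (pinv U)).
      - rewrite <- E at 2. apply travel_derive; [easy|lra].
      - apply Derive_correct, analytic_ex_derive, pinv_analytic; [easy|lra]. }
    replace 0 with (c1 * (dpinv V v * / sqrt (2 * (th - v))) - c2 * (dpinv W v * / sqrt (2 * (th - v)))).
    - apply (is_derive_minus (V := R_NormedModule)); apply is_derive_scal; now apply Hder.
    - specialize (Hd0 v ltac:(lra)). unfold d in Hd0.
      replace (c1 * (dpinv V v * / sqrt (2 * (th - v))) - c2 * (dpinv W v * / sqrt (2 * (th - v)))) with
        ((c1 * dpinv V v + - c2 * dpinv W v) * / sqrt (2 * (th - v))) by ring.
      rewrite Hd0. ring. }
  change (h al = 0). apply NNPP. intros Hn.
  pose proof (Rabs_pos_lt _ Hn) as Hpos.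
  set (C := Rabs c1 + Rabs c2 + 1).
  pose proof (Rabs_pos c1). pose proof (Rabs_pos c2).
  assert (HC : 0 < C) by (unfold C; lra).
  set (ep := Rabs (h al) / C). assert (Hep : 0 < ep) by now apply Rdiv_lt_0_compat.
  destruct (travel_pinv_small V th ep HV ltac:(lra) Hep) as [d1 [Hd1 S1]].
  destruct (travel_pinv_small W th ep HW ltac:(lra) Hep) as [d2 [Hd2 S2]].
  set (v := Rmin (Rmin d1 d2) th / 2).
  assert (Hv : 0 < v < d1 /\ v < d2 /\ v < th).
  { assert (0 < Rmin (Rmin d1 d2) th) by (repeat apply Rmin_pos; lra). unfold v.
    Rmin_bounds (Rmin d1 d2) th.
    Rmin_bounds d1 d2. lra. }
  specialize (S1 v ltac:(lra)). specialize (S2 v ltac:(lra)).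
  rewrite (Hh al v) in * by lra.
  assert (Hle : Rabs (h v) <= Rabs c1 * ep + Rabs c2 * ep).
  { unfold h. eapply Rle_trans; [apply Rabs_triang|]. rewrite Rabs_Ropp, !Rabs_mult.
    apply Rplus_le_compat; apply Rmult_le_compat_l; auto; lra. }
  assert (E : Rabs (h v) = C * ep) by (unfold ep; rewrite (Hh al v) by lra; field; lra).
  unfold C in E. lra.
Qed.

(** * Cancelling the times of flight level by level *)

Definition tsum (V : R -> R) (L : list (R * R)) (th : R) : R :=
  fold_right (fun xc s => snd xc * travel V (fst xc) th + s) 0 L.

Lemma tsum_analytic V L th : well V -> (forall xc, In xc L -> V (fst xc) < th) ->
  analytic_at (tsum V L) th.
Proof.
  intros HV. induction L as [|xc L IH]; intros H.
  - apply analytic_const.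
  - apply analytic_plus.
    + apply analytic_scal, travel_analytic; [easy|]. apply H. now left.
    + apply IH. intros; apply H. now right.
Qed.

Lemma list_sup {A} (L : list A) (f : A -> R) :
  exists l, 0 <= l /\ (forall a, In a L -> f a <= l) /\
    forall t, 0 < t -> (forall a, In a L -> f a < t) -> l < t.
Proof.
  induction L as [|a L (l & Hl & IH1 & IH2)].
  - exists 0. split; [lra|]. split; [intros a []|easy].
  - exists (Rmax l (f a)). split; [eapply Rle_trans; [exact Hl|apply Rmax_l]|]. split.
    + intros b [<-|Hb]; [apply Rmax_r|]. eapply Rle_trans; [now apply IH1 | apply Rmax_l].
    + intros t Ht H. apply Rmax_lub_lt; [|apply H; now left]. apply IH2; [easy|]. intros; apply H; now right.
Qed.

Lemma list_argmax {A} (L : list A) (f : A -> R) : L <> nil ->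
  exists a, In a L /\ forall b, In b L -> f b <= f a.
Proof.
  induction L as [|a L IH]; intros H; [easy|].
  destruct L as [|a' L].
  - exists a. split; [now left|]. intros b [<-|[]]. lra.
  - destruct IH as [m [Hm IH]]; [easy|].
    destruct (Rle_dec (f a) (f m)).
    + exists m. split; [now right|]. intros b [<-|Hb]; [easy|now apply IH].
    + exists a. split; [now left|]. intros b [<-|Hb]; [lra|]. specialize (IH b Hb). lra.
Qed.

Lemma well_eq_0 V x : well V -> V x <= 0 -> x = 0.
Proof.
  intros HV H. destruct (Rtotal_order x 0) as [Hx|[Hx|Hx]]; [|easy|].
  - pose proof (well_pos_right (refl V) (well_refl V HV) (- x) ltac:(lra)) as Hp.
    unfold refl in Hp. rewrite Ropp_involutive in Hp. lra.
  - pose proof (well_pos_right V HV x Hx). lra.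
Qed.

Lemma tsum_split V L (p : R * R -> bool) th :
  tsum V L th = tsum V (filter p L) th + tsum V (filter (fun xc => negb (p xc)) L) th.
Proof.
  induction L as [|xc L IH]; simpl; [ring|].
  rewrite IH. destruct (p xc); simpl; ring.
Qed.

Lemma well_level V x al : well V -> 0 < al -> V x = al -> x = pinv V al \/ x = - pinv (refl V) al.
Proof.
  intros HV Hal E. destruct (Rle_dec 0 x) as [Hx|Hx].
  - left. rewrite <- E. symmetry. now apply pinv_V.
  - right. replace al with (refl V (- x)) by (unfold refl; now rewrite Ropp_involutive).
    rewrite pinv_V; [ring|now apply well_refl|lra].
Qed.

(** A positive level is attained at just two abscissae, one on each side of 0. The minus sign comes
    from [travel] being negative to the left. *)
Lemma tsum_level V L al : well V -> 0 < al -> (forall xc, In xc L -> V (fst xc) = al) ->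
  exists c1 c2, forall th, al < th -> tsum V L th =
    c1 * travel V (pinv V al) th - c2 * travel (refl V) (pinv (refl V) al) th.
Proof.
  intros HV Hal. induction L as [|[x c] L IH]; intros H.
  - exists 0, 0. intros th _. simpl. ring.
  - destruct IH as [c1 [c2 IH]]; [intros; apply H; now right|].
    pose proof (H (x, c) (or_introl eq_refl)) as Hx. simpl in Hx.
    destruct (well_level V x al HV Hal Hx) as [E|E].
    + exists (c + c1), c2. intros th Hth. simpl. rewrite IH by easy. rewrite E. ring.
    + exists c1, (c + c2). intros th Hth. simpl. rewrite IH by easy.
      rewrite (travel_refl V); [rewrite <- E; ring|easy|]. rewrite <- E. lra.
Qed.

(** The function [g] stands for the duration of the other coordinate, analytic on all of [(0, be)].
    Just above the top level the entries of that level sum to a function analytic at the level, so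
    they cancel. Several entries may share the top level, whence the induction on a bound for the
    length. *)
Lemma tsum_reduction V : well V -> forall n L c1 c2 (g : R -> R) be, (length L <= n)%nat ->
  0 < be -> (forall th, 0 < th < be -> analytic_at g th) ->
  (forall xc, In xc L -> V (fst xc) < be) ->
  (forall th, 0 < th < be -> (forall xc, In xc L -> V (fst xc) < th) ->
     tsum V L th + (c1 * quarter V th + c2 * quarter (refl V) th) = g th) ->
  forall th, 0 < th < be -> c1 * quarter V th + c2 * quarter (refl V) th = g th.
Proof.
  intros HV. pose proof (well_refl V HV) as HW.
  induction n as [|n IH]; intros L c1 c2 g be Hn Hbe Hg HL H th Hth.
  { destruct L; [|simpl in Hn; lia]. rewrite <- H; [simpl; ring|easy|easy]. }
  destruct (classic (L = nil)) as [->|Hne].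
  { rewrite <- H; [simpl; ring|easy|easy]. }
  destruct (list_argmax L (fun xc => V (fst xc)) Hne) as [x0 [Hx0 Hmax]].
  set (al := V (fst x0)) in *.
  (* At top level 0 every abscissa is 0, and its time of flight is 0. *)
  destruct (Rle_dec al 0) as [Hal|Hal].
  { assert (Hz : tsum V L th = 0).
    { clear H Hn Hne Hx0 HL. induction L as [|xc L IHL]; [easy|]. simpl.
      rewrite IHL by (intros; apply Hmax; now right).
      pose proof (Hmax xc (or_introl eq_refl)).
      rewrite (well_eq_0 V (fst xc) HV) by lra. rewrite travel_0. ring. }
    rewrite <- H; [rewrite Hz; ring|easy|]. intros xc Hxc. specialize (Hmax xc Hxc). simpl in Hmax. lra. }
  apply Rnot_le_lt in Hal.
  assert (Halbe : al < be) by now apply HL.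
  set (p := fun xc : R * R => if Rlt_dec (V (fst xc)) al then true else false).
  set (L1 := filter p L). set (L2 := filter (fun xc => negb (p xc)) L).
  assert (HL1 : forall xc, In xc L1 -> In xc L /\ V (fst xc) < al).
  { intros xc Hxc. apply filter_In in Hxc. destruct Hxc as [Hi Hp]. split; [easy|].
    unfold p in Hp. destruct Rlt_dec; easy. }
  assert (HL2 : forall xc, In xc L2 -> V (fst xc) = al).
  { intros xc Hxc. apply filter_In in Hxc. destruct Hxc as [Hi Hp].
    specialize (Hmax xc Hi). simpl in Hmax. unfold p in Hp. destruct Rlt_dec; [easy|lra]. }
  assert (Hlen : (length L1 <= n)%nat).
  { assert (length L1 < length L)%nat; [|lia].
    assert (Hin : In x0 L2).
    { apply filter_In. split; [easy|]. unfold p. destruct Rlt_dec; [unfold al in *; lra|easy]. }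
    pose proof (filter_length p L) as Hfl. fold L1 L2 in Hfl.
    destruct L2; [destruct Hin | simpl in Hfl; lia]. }
  assert (Hsum : forall th, tsum V L th = tsum V L1 th + tsum V L2 th) by (intros; apply tsum_split).
  destruct (tsum_level V L2 al HV Hal HL2) as [k1 [k2 HT2]].
  set (k := fun th => g th - (tsum V L1 th + (c1 * quarter V th + c2 * quarter (refl V) th))).
  assert (Hk : forall th, 0 < th < be -> (forall xc, In xc L1 -> V (fst xc) < th) -> analytic_at k th).
  { intros t Ht Hlt. apply analytic_minus; [now apply Hg|].
    apply analytic_plus; [now apply tsum_analytic|].
    apply analytic_plus; apply analytic_scal; apply quarter_analytic; easy. }
  assert (Hk2 : forall th, al < th < be -> tsum V L2 th = k th).
  { intros t Ht. unfold k. rewrite <- H; [rewrite Hsum; ring|lra|].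
    intros xc Hxc. specialize (Hmax xc Hxc). simpl in Hmax. lra. }
  assert (HT0 : forall th, al < th -> tsum V L2 th = 0).
  { intros t Ht. rewrite HT2 by easy. apply (travel_level_cancel V k1 k2 al k (be - al)); auto; try lra.
    - apply Hk; [lra|]. intros xc Hxc. now apply HL1.
    - intros s Hs. rewrite <- HT2 by lra. apply Hk2. lra. }
  apply (IH L1 c1 c2 g be); auto.
  { intros xc Hxc. specialize (HL1 xc Hxc). lra. }
  intros t Ht Hlt.
  destruct (list_sup L1 (fun xc => V (fst xc))) as (l & Hl & Hb & Hsup).
  assert (Hlt' : l < t) by now apply Hsup.
  assert (Hlal : l < al) by (apply Hsup; [easy|]; intros; now apply HL1).
  (* The defect [k] vanishes just above [al] and, with the top entries gone, is analytic down to the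
     next level [l]. *)
  enough (k t = 0) by (unfold k in *; lra).
  apply (analytic_identity k l be ((al + be) / 2)); try lra.
  - intros s Hs. apply Hk; [lra|]. intros xc Hxc. specialize (Hb xc Hxc). simpl in Hb. lra.
  - apply (locally_between al be); [lra|]. intros y Hy. rewrite <- Hk2 by easy. now apply HT0.
Qed.

(** * Quarter periods near energy 0 *)

Lemma Derive_n_series V a n : Rbar_lt 0 (CV_radius a) ->
  locally 0 (fun y => V y = PSeries a (y - 0)) -> Derive_n V n 0 = a n * INR (Factorial.fact n).
Proof.
  intros Ha H. rewrite <- Derive_n_coef by easy. apply Derive_n_ext_loc.
  revert H. apply filter_imp. intros y ->. now rewrite Rminus_0_r.
Qed.

Lemma well_Derive_0 V : well V -> Derive V 0 = 0.
Proof.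
  intros HV. rewrite <- (Derive_Reals V 0 (ex_derive_Reals_0 V 0 (well_ex_derive V 0 HV))).
  apply (deriv_minimum V (-1) 1); try lra. intros x _ _. rewrite (well_0 V HV). now apply well_nonneg.
Qed.

Lemma well_factor_2 V : well V -> exists u, Rbar_lt 0 (CV_radius u) /\
  locally 0 (fun x => V x = x ^ 2 * PSeries u x) /\ u 0%nat = Derive_n V 2 0 / 2.
Proof.
  intros HV. destruct (analytic_series V 0 (proj1 HV 0)) as [a [Ha H]].
  exists (PS_decr_n a 2). split; [now rewrite PS_decr_n_radius|]. split.
  - generalize H. apply filter_imp. intros x ->. rewrite Rminus_0_r. apply PSeries_decr_n_aux.
    intros k Hk. assert (Hc : k = 0%nat \/ k = 1%nat) by lia.
    pose proof (Derive_n_series V a k Ha H) as E.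
    destruct Hc as [-> | ->]; simpl in E.
    + rewrite (well_0 V HV) in E. lra.
    + rewrite (Derive_ext _ V) in E by easy. rewrite (well_Derive_0 V HV) in E. lra.
  - rewrite (Derive_n_series V a 2 Ha H). unfold PS_decr_n. simpl. field.
Qed.

Lemma well_flat_bound V : well V -> Derive_n V 2 0 = 0 ->
  exists M r, 0 < M /\ 0 < r /\ forall x, Rabs x < r -> V x <= M * Rabs x ^ 3.
Proof.
  intros HV H0. destruct (well_factor_2 V HV) as [u [Hu [H Hu0]]].
  assert (Hc : continuous (PSeries (PS_decr_1 u)) 0).
  { apply continuity_pt_filterlim, PSeries_continuity. now rewrite Rabs_R0, CV_radius_decr_1. }
  set (m := PSeries (PS_decr_1 u) 0) in *.
  assert (Hl := Hc (fun t => Rabs (t - m) < 1) (locally_abs m 1 ltac:(lra))).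
  apply (locally_and _ _ _ H) in Hl. apply locally_abs_inv in Hl as [r [Hr Hl]].
  exists (Rabs m + 1), r. pose proof (Rabs_pos m). split; [lra|]. split; [easy|].
  intros x Hx. destruct (Hl x) as [E Hb]; [now rewrite Rminus_0_r|].
  rewrite E, PSeries_decr_1_aux by (rewrite Hu0, H0; lra).
  eapply Rle_trans; [apply Rle_abs|]. rewrite !Rabs_mult, <- RPow_abs.
  assert (Rabs (PSeries (PS_decr_1 u) x) <= Rabs m + 1).
  { replace (PSeries (PS_decr_1 u) x) with (m + (PSeries (PS_decr_1 u) x - m)) by ring.
    eapply Rle_trans; [apply Rabs_triang|]. lra. }
  pose proof (Rabs_pos x). assert (0 <= Rabs x ^ 3) by now apply pow_le.
  replace (Rabs x ^ 2 * (Rabs x * Rabs (PSeries (PS_decr_1 u) x))) with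
    (Rabs (PSeries (PS_decr_1 u) x) * Rabs x ^ 3) by ring.
  now apply Rmult_le_compat_r.
Qed.

(** The speed is at most [sqrt (2 * th)], so reaching the point [x] of level [th / 2] takes at least
    [x / (2 * sqrt (V x))], and a cubic bound on [V] makes this at least a multiple of
    [/ sqrt x]. *)
Lemma quarter_blowup V M r K : well V -> 0 < M -> 0 < r -> 0 < K ->
  (forall x, 0 < x < r -> V x <= M * x ^ 3) ->
  exists d, 0 < d /\ forall th, 0 < th < d -> K < quarter V th.
Proof.
  intros HV HM Hr HK H.
  (* The final comparison needs [4 * K ^ 2 * M * x < 1]; the 8 leaves a factor 2 to spare. *)
  set (q := / (8 * K ^ 2 * M)). assert (HK2 : 0 < K ^ 2) by now apply pow_lt.
  assert (Hq : 0 < q) by (apply Rinv_0_lt_compat; nra).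
  set (x1 := Rmin r q). assert (Hx1 : 0 < x1) by now apply Rmin_pos.
  exists (2 * V x1). pose proof (well_pos_right V HV x1 Hx1). split; [lra|].
  intros th Hth. set (x := pinv V (th / 2)).
  assert (Hx : 0 < x) by (apply pinv_pos; [easy|lra]).
  assert (HVx : V x = th / 2) by (apply (pinv_spec V HV); lra).
  assert (Hxx1 : x < x1) by (apply (well_lt_inv V HV); lra).
  Rmin_bounds r q. fold x1 in H1, H2.
  specialize (H x ltac:(lra)).
  assert (Hs : 0 < sqrt (2 * th)) by (apply sqrt_lt_R0; lra).
  assert (Hss : sqrt (2 * th) * sqrt (2 * th) = 2 * th) by (apply sqrt_sqrt; lra).
  eapply Rlt_le_trans; [|apply (quarter_ge V HV th (th / 2)); lra]. fold x.
  apply (Rmult_lt_reg_r (sqrt (2 * th))); [easy|].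
  replace (x / sqrt (2 * th) * sqrt (2 * th)) with x by (field; lra).
  assert (HKx : 8 * K ^ 2 * M * x < 1).
  { replace 1 with (8 * K ^ 2 * M * q) by (unfold q; field; nra).
    apply Rmult_lt_compat_l; [nra|lra]. }
  assert (Hfin : (K * sqrt (2 * th)) ^ 2 < x ^ 2).
  { replace ((K * sqrt (2 * th)) ^ 2) with (K ^ 2 * (sqrt (2 * th) * sqrt (2 * th))) by ring.
    rewrite Hss. apply Rle_lt_trans with (x ^ 2 * (4 * K ^ 2 * M * x)).
    - replace (2 * th) with (4 * (th / 2)) by field. rewrite <- HVx.
      replace (x ^ 2 * (4 * K ^ 2 * M * x)) with (4 * K ^ 2 * (M * x ^ 3)) by ring.
      replace (K ^ 2 * (4 * V x)) with (4 * K ^ 2 * V x) by ring.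
      apply Rmult_le_compat_l; [lra|easy].
    - assert (0 < x ^ 2) by (apply pow_lt; lra).
      rewrite <- (Rmult_1_r (x ^ 2)) at 2. apply Rmult_lt_compat_l; [easy|].
      assert (0 < 4 * K ^ 2 * M * x) by (repeat apply Rmult_lt_0_compat; lra). lra. }
  apply Rnot_le_lt. intros Hle. assert (0 < K * sqrt (2 * th)) by (apply Rmult_lt_0_compat; lra). nra.
Qed.

(** Both quarter periods tend to plus infinity, and nonnegative coefficients leave no room for
    compensation. *)
Lemma quarter_bounded_zero V c1 c2 (g : R -> R) be : well V -> Derive_n V 2 0 = 0 ->
  0 <= c1 -> 0 <= c2 -> 0 < be -> continuous g 0 ->
  (forall th, 0 < th < be -> c1 * quarter V th + c2 * quarter (refl V) th = g th) ->
  c1 = 0 /\ c2 = 0.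
Proof.
  intros HV H2 H0c1 H0c2 Hbe Hg H. pose proof (well_refl V HV) as HW.
  destruct (well_flat_bound V HV H2) as [M [r [HM [Hr Hb]]]].
  enough (c1 + c2 <= 0) by lra. apply Rnot_lt_le. intros Hc.
  assert (Hl := Hg (fun t => Rabs (t - g 0) < 1) (locally_abs _ 1 ltac:(lra))).
  apply locally_abs_inv in Hl as [r' [Hr' Hl]].
  set (K := (Rabs (g 0) + 1) / (c1 + c2)).
  pose proof (Rabs_pos (g 0)).
  assert (HK : 0 < K) by (apply Rdiv_lt_0_compat; lra).
  destruct (quarter_blowup V M r K HV HM Hr HK) as [d1 [Hd1 Q1]].
  { intros x Hx. specialize (Hb x). rewrite Rabs_pos_eq in Hb by lra. apply Hb. lra. }
  destruct (quarter_blowup (refl V) M r K HW HM Hr HK) as [d2 [Hd2 Q2]].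
  { intros x Hx. specialize (Hb (- x)). rewrite Rabs_Ropp, Rabs_pos_eq in Hb by lra. apply Hb. lra. }
  destruct (min4_pos d1 d2 be r') as (m & Hm); [lra..|].
  specialize (H (m / 2) ltac:(lra)). specialize (Q1 (m / 2) ltac:(lra)). specialize (Q2 (m / 2) ltac:(lra)).
  specialize (Hl (m / 2)). rewrite Rminus_0_r, Rabs_pos_eq in Hl by lra. specialize (Hl ltac:(lra)).
  assert (E : (c1 + c2) * K = Rabs (g 0) + 1) by (unfold K; field; lra).
  apply Rabs_def2 in Hl. pose proof (Rle_abs (g 0)). nra.
Qed.

(** Angle substitution [V q = (s * sin phi) ^ 2], [p = sqrt 2 * s * cos phi]: here [A] is the
    derivative of [q] as a function of the root of the potential energy, and the time element
    becomes [A (s * sin phi) / sqrt 2] times that of [phi]. *)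
Lemma quarter_sin_integral (V A : R -> R) (r s : R) : well V ->
  (forall t, Rabs t < r -> continuous A t) ->
  (forall t, 0 < t < r -> A t = 2 * t * dpinv V (t ^ 2)) -> 0 < s < r ->
  quarter V (s ^ 2) = / sqrt 2 * RInt (fun phi => 1 * A (s * sin phi)) 0 (PI / 2).
Proof.
  intros HV HA HA2 Hs. pose proof PI_RGT_0 as HPI.
  assert (Hs2 : 0 < s ^ 2) by (apply pow_lt; lra).
  assert (H2 : 0 < sqrt 2) by (apply sqrt_lt_R0; lra).
  assert (H22 : sqrt 2 * sqrt 2 = 2) by (apply sqrt_sqrt; lra).
  assert (Hsq : sqrt (2 * s ^ 2) = sqrt 2 * s) by (rewrite sqrt_mult, sqrt_pow2 by lra; easy).
  set (J := fun phi => RInt (fun phi => 1 * A (s * sin phi)) 0 phi).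
  assert (HJ : forall phi, is_derive J phi (A (s * sin phi))).
  { intros phi. replace (A (s * sin phi)) with (1 * A (s * sin phi)) by ring.
    apply (is_derive_RInt_upper (fun phi => 1 * A (s * sin phi)) (Rabs phi + 1)); [|lra].
    intros z _. apply continuous_Rmult; [apply continuous_const|].
    apply (continuous_comp (fun z => s * sin z) A).
    - apply ex_derive_cont. auto_derive. auto.
    - apply HA. rewrite Rabs_mult, Rabs_pos_eq by lra.
      pose proof (SIN_bound z). assert (Rabs (sin z) <= 1) by (apply Rabs_le; lra). nra. }
  (* Remaining time to the turning point plus the angular integral so far, constant on [(0, PI)].
     The point [PI / 2], where the momentum term is 0, is interior to this interval. *)
  set (e := fun phi => ptime V (s ^ 2) (sqrt 2 * s * cos phi) + / sqrt 2 * J phi).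
  assert (He : forall x y, 0 < x < PI -> 0 < y < PI -> e x = e y).
  { apply const_of_derive_0. intros x Hx.
    assert (Hsin : 0 < sin x) by (apply sin_gt_0; lra).
    pose proof (sin2_cos2 x) as Hsc. unfold Rsqr in Hsc.
    assert (Hssin : 0 < s * sin x < r).
    { pose proof (SIN_bound x). split; [apply Rmult_lt_0_compat; lra|nra]. }
    replace 0 with ((- (sqrt 2 * s * sin x)) * dpinv V (s ^ 2 - (sqrt 2 * s * cos x) ^ 2 / 2)
       + / sqrt 2 * A (s * sin x)).
    - apply (is_derive_plus (V := R_NormedModule)); [|apply is_derive_scal, HJ].
      apply (is_derive_comp (ptime V (s ^ 2)) (fun x => sqrt 2 * s * cos x)).
      + apply ptime_derive; [easy|easy|]. rewrite Hsq, !Rabs_mult, !(Rabs_pos_eq) by lra.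
        assert (Rabs (cos x) < 1) by (apply Rabs_def1; nra).
        assert (0 < sqrt 2 * s) by (apply Rmult_lt_0_compat; lra). nra.
      + auto_derive; [easy|]. ring.
    - rewrite HA2 by easy.
      replace (s ^ 2 - (sqrt 2 * s * cos x) ^ 2 / 2) with ((s * sin x) ^ 2).
      + set (D := dpinv V _). replace 2 with (sqrt 2 * sqrt 2) at 3 by easy. field. lra.
      + replace ((sqrt 2 * s * cos x) ^ 2) with ((sqrt 2 * sqrt 2) * s ^ 2 * (cos x * cos x)) by ring.
        rewrite H22. replace (cos x * cos x) with (1 - sin x * sin x) by lra. field. }
  change (quarter V (s ^ 2) = / sqrt 2 * J (PI / 2)).
  assert (E0 : / sqrt 2 * J (PI / 2) = e (PI / 2)).
  { unfold e. rewrite cos_PI2, Rmult_0_r, ptime_0. ring. }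
  (* At angle 0 the momentum integral would be improper, so the comparison is made at a small
     positive angle, where both the time of flight to level [v] and [J phi] are small. *)
  rewrite E0. apply NNPP. intros Hn.
  assert (Hpos : 0 < Rabs (quarter V (s ^ 2) - e (PI / 2))) by (apply Rabs_pos_lt; lra).
  set (ep := Rabs (quarter V (s ^ 2) - e (PI / 2)) / 2) in *.
  destruct (travel_pinv_small V (s ^ 2) ep HV Hs2 ltac:(unfold ep; lra)) as [d [Hd Ht]].
  assert (HJ0 : J 0 = 0) by apply (RInt_point (V := R_CompleteNormedModule)).
  assert (HJc : continuous (fun phi => / sqrt 2 * J phi) 0).
  { apply continuous_Rmult; [apply continuous_const|].
    eapply is_derive_cont. apply HJ. }
  assert (HLJ := HJc (fun t => Rabs (t - / sqrt 2 * J 0) < ep) (locally_abs _ ep ltac:(unfold ep; lra))).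
  assert (Hvc : continuous (fun phi => (s * sin phi) ^ 2) 0).
  { apply ex_derive_cont. auto_derive. auto. }
  assert (Hv0 : (s * sin 0) ^ 2 < d) by (rewrite sin_0, Rmult_0_r; simpl; lra).
  assert (HLv := Hvc (fun t => t < d) (open_lt d _ Hv0)).
  apply (locally_and _ _ _ HLJ) in HLv. apply locally_abs_inv in HLv as [rho [Hrho HL]].
  set (phi := Rmin rho PI / 4).
  assert (Hphi : 0 < phi < rho /\ phi < PI / 2).
  { assert (0 < Rmin rho PI) by (apply Rmin_pos; lra). Rmin_bounds rho PI.
    unfold phi. lra. }
  destruct (HL phi) as [HL1 HL2]; [rewrite Rminus_0_r, Rabs_pos_eq; lra|].
  rewrite HJ0, Rmult_0_r, Rminus_0_r in HL1.
  assert (Hsin : 0 < sin phi) by (apply sin_gt_0; lra).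
  assert (Hcos : 0 < cos phi) by (apply cos_gt_0; lra).
  pose proof (sin2_cos2 phi) as Hsc. unfold Rsqr in Hsc.
  set (v := (s * sin phi) ^ 2) in *.
  assert (Hv : 0 < v) by (apply pow_lt, Rmult_lt_0_compat; lra).
  assert (Ev : 2 * (s ^ 2 - v) = (sqrt 2 * s * cos phi) ^ 2).
  { unfold v. replace ((sqrt 2 * s * cos phi) ^ 2) with ((sqrt 2 * sqrt 2) * s ^ 2 * (cos phi * cos phi)) by ring.
    rewrite H22. replace (cos phi * cos phi) with (1 - sin phi * sin phi) by lra. ring. }
  assert (Hpc : 0 < sqrt 2 * s * cos phi) by (repeat apply Rmult_lt_0_compat; lra).
  assert (Hvs : v < s ^ 2) by nra.
  assert (EQ : quarter V (s ^ 2) - e (PI / 2) = travel V (pinv V v) (s ^ 2) - / sqrt 2 * J phi).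
  { rewrite (quarter_split V HV (s ^ 2) v) by lra. rewrite Ev, sqrt_pow2 by lra.
    rewrite (He (PI / 2) phi) by lra. unfold e. ring. }
  specialize (Ht v ltac:(lra)).
  assert (Rabs (quarter V (s ^ 2) - e (PI / 2)) < ep + ep); [|unfold ep in *; lra].
  rewrite EQ. eapply Rle_lt_trans; [apply Rabs_triang|]. rewrite Rabs_Ropp. lra.
Qed.

(* Inverse of the coordinate [x * sqrt (V x / x^2)] of the well, whose square is [V x]. *)
Definition root_inv (V : R -> R) (s : R) : R :=
  if Rle_dec 0 s then pinv V (s ^ 2) else - pinv (refl V) (s ^ 2).

Lemma pinv_small V r : well V -> 0 < r -> exists d, 0 < d /\ forall s, Rabs s < d ->
  0 <= pinv V (s ^ 2) < r.
Proof.
  intros HV Hr. exists (sqrt (V r)). pose proof (well_pos_right V HV r Hr).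
  split; [now apply sqrt_lt_R0|]. intros s Hs.
  pose proof (pow2_ge_0 s). apply sq_lt_of_abs_lt_sqrt in Hs; [|easy].
  destruct (pinv_spec V HV (s ^ 2) H0) as [H1 H2]. split; [easy|].
  apply (well_lt_inv V HV); lra.
Qed.

Lemma root_inv_pos V s : 0 < s -> locally s (fun t => root_inv V t = pinv V (t ^ 2)).
Proof.
  intros Hs. apply (locally_gt_0); [easy|]. intros t Ht. unfold root_inv. destruct Rle_dec; [easy|lra].
Qed.

Lemma root_inv_neg V s : s < 0 -> locally s (fun t => root_inv V t = - pinv (refl V) (t ^ 2)).
Proof.
  intros Hs. apply (locally_between (s - 1) 0); [lra|]. intros t Ht. unfold root_inv.
  destruct Rle_dec; [lra|easy].
Qed.

Lemma pinv_sq_derive V s : well V -> s <> 0 ->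
  is_derive (fun t => pinv V (t ^ 2)) s (2 * s * dpinv V (s ^ 2)).
Proof.
  intros HV Hs. apply (is_derive_comp (pinv V) (fun t => t ^ 2)).
  - apply Derive_correct, analytic_ex_derive, pinv_analytic; [easy|]. now apply pow2_gt_0.
  - auto_derive; [easy|ring].
Qed.

Lemma root_inv_continuous V s : well V -> continuous (root_inv V) s.
Proof.
  intros HV. pose proof (well_refl V HV) as HW. destruct (Rtotal_order s 0) as [Hs|[->|Hs]].
  - apply ex_derive_cont. apply (ex_derive_ext_loc (fun t => - pinv (refl V) (t ^ 2))).
    + generalize (root_inv_neg V s Hs). apply filter_imp. intros; now symmetry.
    + apply (ex_derive_opp (V := R_NormedModule)). eexists. apply pinv_sq_derive; [easy|lra].
  - intros P HP. apply locally_abs_inv in HP as [e [He HP]].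
    destruct (pinv_small V e HV He) as [d1 [Hd1 H1]].
    destruct (pinv_small (refl V) e HW He) as [d2 [Hd2 H2]].
    assert (E0 : root_inv V 0 = 0).
    { unfold root_inv. destruct Rle_dec; [|lra]. replace (0 ^ 2) with (V 0) by (rewrite (well_0 V HV); ring).
      apply pinv_V; [easy|lra]. }
    rewrite E0 in HP. change (locally 0 (fun x => P (root_inv V x))).
    apply (filter_imp (fun y => Rabs (y - 0) < Rmin d1 d2)); [|apply locally_abs; now apply Rmin_pos].
    intros t Ht. rewrite Rminus_0_r in Ht. Rmin_bounds d1 d2.
    specialize (H1 t ltac:(lra)). specialize (H2 t ltac:(lra)).
    apply HP. rewrite Rminus_0_r. unfold root_inv. destruct Rle_dec; apply Rabs_def1; lra.
  - apply ex_derive_cont. apply (ex_derive_ext_loc (fun t => pinv V (t ^ 2))).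
    + generalize (root_inv_pos V s Hs). apply filter_imp. intros; now symmetry.
    + eexists. apply pinv_sq_derive; [easy|lra].
Qed.

Lemma root_inv_analytic V : well V -> Derive_n V 2 0 <> 0 -> analytic_at (root_inv V) 0.
Proof.
  intros HV H2. pose proof (well_refl V HV) as HW.
  destruct (well_factor_2 V HV) as [u [Hu [Hfac Hu0]]].
  assert (HU : analytic_at (PSeries u) 0).
  { apply (analytic_of_series _ _ u Hu). apply filter_forall. intros y. now rewrite Rminus_0_r. }
  assert (HUc := analytic_continuous _ _ HU).
  assert (Hupos : 0 < PSeries u 0).
  { rewrite PSeries_0, Hu0. destruct (Rtotal_order (Derive_n V 2 0) 0) as [Hn|[Hn|Hn]]; [exfalso|easy|lra].
    assert (Hneg : PSeries u 0 < 0) by (rewrite PSeries_0, Hu0; lra).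
    assert (Hl := HUc (fun t => t < 0) (open_lt 0 _ Hneg)).
    apply (locally_and _ _ _ Hfac) in Hl. apply locally_abs_inv in Hl as [r [Hr Hl]].
    destruct (Hl (r / 2)) as [E1 E2]; [rewrite Rminus_0_r, Rabs_pos_eq; lra|].
    pose proof (well_pos_right V HV (r / 2) ltac:(lra)) as Hp. rewrite E1 in Hp.
    assert (0 < (r / 2) ^ 2) by (apply pow_lt; lra). nra. }
  set (h := fun x => sqrt (PSeries u x)).
  assert (Hh : analytic_at h 0) by now apply analytic_sqrt.
  set (f := fun x => x * h x).
  assert (Hf : analytic_at f 0) by (apply analytic_mult; [apply analytic_id|easy]).
  assert (E0 : root_inv V 0 = 0).
  { unfold root_inv. destruct Rle_dec; [|lra]. replace (0 ^ 2) with (V 0) by (rewrite (well_0 V HV); ring).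
    apply pinv_V; [easy|lra]. }
  apply (analytic_inverse f); rewrite ?E0; auto.
  - rewrite (is_derive_unique f 0 (1 * h 0 + 0 * Derive h 0)).
    + rewrite Rmult_0_l, Rplus_0_r, Rmult_1_l. apply Rgt_not_eq. now apply sqrt_lt_R0.
    + apply (is_derive_mult (fun x => x) h).
      * apply (is_derive_id (K := R_AbsRing)).
      * now apply Derive_correct, analytic_ex_derive.
      * intros; apply Rmult_comm.
  - assert (Hl := HUc (fun t => 0 < t) (open_gt 0 _ Hupos)).
    apply (locally_and _ _ _ Hfac) in Hl. apply locally_abs_inv in Hl as [r [Hr Hl]].
    destruct (pinv_small V r HV Hr) as [d1 [Hd1 P1]].
    destruct (pinv_small (refl V) r HW Hr) as [d2 [Hd2 P2]].
    apply (filter_imp (fun y => Rabs (y - 0) < Rmin d1 d2)); [|apply locally_abs; now apply Rmin_pos].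
    intros s Hs. rewrite Rminus_0_r in Hs. Rmin_bounds d1 d2.
    specialize (P1 s ltac:(lra)). specialize (P2 s ltac:(lra)).
    unfold f, h, root_inv. destruct Rle_dec as [Hs0|Hs0].
    + set (x := pinv V (s ^ 2)) in *.
      assert (HVx : V x = s ^ 2) by (apply (pinv_spec V HV), pow2_ge_0).
      destruct (Hl x) as [E1 E2]; [rewrite Rminus_0_r, Rabs_pos_eq; lra|].
      rewrite <- (sqrt_pow2 x) at 1 by lra. rewrite <- sqrt_mult by (try apply pow2_ge_0; lra).
      rewrite <- E1, HVx. now apply sqrt_pow2.
    + set (x := pinv (refl V) (s ^ 2)) in *.
      assert (HVx : V (- x) = s ^ 2) by (apply (pinv_spec (refl V) HW), pow2_ge_0).
      destruct (Hl (- x)) as [E1 E2]; [rewrite Rminus_0_r, Rabs_Ropp, Rabs_pos_eq; lra|].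
      rewrite <- Ropp_mult_distr_l.
      rewrite <- (sqrt_pow2 x) at 1 by lra. rewrite <- sqrt_mult by (try apply pow2_ge_0; lra).
      replace (x ^ 2) with ((- x) ^ 2) by ring.
      rewrite <- E1, HVx. replace (s ^ 2) with ((- s) ^ 2) by ring. rewrite sqrt_pow2 by lra. ring.
  - apply filter_forall. intros s. now apply root_inv_continuous.
Qed.

Lemma PSeries_opp_arg b s : PSeries b (- s) = PSeries (fun k => (-1) ^ k * b k) s.
Proof.
  unfold PSeries. apply Series_ext. intros n. replace (- s) with (-1 * s) by ring.
  rewrite Rpow_mult_distr. ring.
Qed.

(** With energy [s ^ 2], the quarter periods of [V] and [refl V] are [B s] and [B (- s)] for one
    power series [B]. Regularity of [k] makes [c1 * B s + c2 * B (- s)] even, so [c1 - c2] times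
    each odd coefficient of [B] is 0. If [B] is even, the quarter periods agree at small energies,
    hence at all. *)
Lemma quarter_symmetric_of_regular V c1 c2 (k : R -> R) be : well V -> Derive_n V 2 0 <> 0 ->
  0 < be -> analytic_at k 0 ->
  (forall th, 0 < th < be -> c1 * quarter V th + c2 * quarter (refl V) th = k th) ->
  c1 = c2 \/ forall th, 0 < th -> quarter V th = quarter (refl V) th.
Proof.
  intros HV H2 Hbe Hk H. pose proof (well_refl V HV) as HW. pose proof PI_RGT_0 as HPI.
  set (A := Derive (root_inv V)).
  assert (HA : analytic_at A 0) by now apply analytic_Derive, root_inv_analytic.
  destruct (analytic_series A 0 HA) as [a [Ha HAs]].
  destruct (analytic_series k 0 Hk) as [c [Hc Hks]].
  assert (HL := locally_and _ _ _ (locally_and _ _ _ HAs (locally_radius a 0 Ha)) (analytic_locally A 0 HA)).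
  apply locally_abs_inv in HL as [r [Hr HL]].
  apply locally_abs_inv in Hks as [r' [Hr' Hks]].
  set (b := fun n => a n * RInt (fun phi => 1 * sin phi ^ n) 0 (PI / 2)).
  assert (Hb : forall s, Rabs s < r ->
     is_pseries b s (RInt (fun phi => 1 * A (s * sin phi)) 0 (PI / 2))).
  { intros s Hs.
    replace (RInt (fun phi => 1 * A (s * sin phi)) 0 (PI / 2)) with
      (RInt (fun phi => 1 * PSeries a (s * sin phi)) 0 (PI / 2)).
    - apply is_pseries_RInt_termwise with 1; [lra| |].
      + intros phi _. split; [apply continuous_const|]. split; [apply continuous_sin|].
        pose proof (SIN_bound phi). apply Rabs_le. lra.
      + rewrite Rmult_1_r. destruct (HL s) as [[_ Hc'] _]; [now rewrite Rminus_0_r|].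
        now rewrite Rminus_0_r in Hc'.
    - apply RInt_ext. intros phi _. f_equal. destruct (HL (s * sin phi)) as [[E _] _].
      + rewrite Rminus_0_r, Rabs_mult. pose proof (SIN_bound phi).
        assert (Rabs (sin phi) <= 1) by (apply Rabs_le; lra). pose proof (Rabs_pos s). nra.
      + now rewrite Rminus_0_r in E. }
  assert (Hw : forall n, 0 < RInt (fun phi => 1 * sin phi ^ n) 0 (PI / 2)).
  { intros n. apply RInt_gt_0; [lra| |].
    - intros x Hx. rewrite Rmult_1_l. apply pow_lt, sin_gt_0; lra.
    - intros x _. apply continuous_Rmult; [apply continuous_const|].
      apply continuous_pow_fun, continuous_sin. }
  assert (HQV : forall s, 0 < s < r -> quarter V (s ^ 2) = / sqrt 2 * PSeries b s).
  { intros s Hs. rewrite (is_pseries_unique _ _ _ (Hb s ltac:(rewrite Rabs_pos_eq; lra))).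
    apply quarter_sin_integral with r; [easy| | |easy].
    - intros t Ht. apply analytic_continuous, HL. now rewrite Rminus_0_r.
    - intros t Ht. apply is_derive_unique.
      apply (is_derive_ext_loc (fun t => pinv V (t ^ 2))); [|apply pinv_sq_derive; [easy|lra]].
      generalize (root_inv_pos V t ltac:(lra)). apply filter_imp. intros; now symmetry. }
  assert (HQW : forall s, 0 < s < r -> quarter (refl V) (s ^ 2) = / sqrt 2 * PSeries b (- s)).
  { intros s Hs.
    assert (Hms : Rabs (- s) < r) by (rewrite Rabs_Ropp, Rabs_pos_eq; lra).
    rewrite (is_pseries_unique _ _ _ (Hb (- s) Hms)).
    rewrite (quarter_sin_integral (refl V) (fun t => A (- t)) r s); [|easy| | |easy].
    - f_equal. apply RInt_ext. intros phi _. do 2 f_equal. ring.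
    - intros t Ht. apply (continuous_comp Ropp A).
      + apply (continuous_opp (V := R_NormedModule)), continuous_id.
      + apply analytic_continuous, HL. now rewrite Rminus_0_r, Rabs_Ropp.
    - intros t Ht. apply is_derive_unique.
      apply (is_derive_ext_loc (fun t => - pinv (refl V) (t ^ 2))).
      + generalize (root_inv_neg V (- t) ltac:(lra)). apply filter_imp. intros; now symmetry.
      + replace (2 * t * dpinv (refl V) (t ^ 2)) with (- (2 * (- t) * dpinv (refl V) ((- t) ^ 2))).
        * apply (is_derive_opp (V := R_NormedModule)). apply pinv_sq_derive; [easy|lra].
        * replace ((- t) ^ 2) with (t ^ 2) by ring. ring. }
  destruct (classic (c1 = c2)) as [|Hne]; [now left|right].
  assert (Hsq2 : 0 < sqrt 2) by (apply sqrt_lt_R0; lra).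
  destruct (min4_pos r 1 r' be) as (m & Hm); [lra..|].
  set (e := fun n => c1 * b n + c2 * ((-1) ^ n * b n)).
  assert (He : forall s, Rabs s < r -> is_pseries e s (c1 * PSeries b s + c2 * PSeries b (- s))).
  { intros s Hs. apply is_pseries_R.
    assert (B1 := PSeries_correct _ _ (ex_intro _ _ (Hb s Hs))).
    assert (B2 := PSeries_correct _ _ (ex_intro _ _ (Hb (- s) ltac:(now rewrite Rabs_Ropp)))).
    apply is_pseries_R in B1, B2.
    apply (is_series_ext (fun n => c1 * (b n * s ^ n) + c2 * (b n * (- s) ^ n))).
    - intros n. unfold e. replace (- s) with (-1 * s) by ring. rewrite Rpow_mult_distr. eqR. ring.
    - apply (is_series_plus (V := R_NormedModule)); now apply (is_series_scal (V := R_NormedModule)). }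
  assert (Hpar : forall n, e n = PS_interlace (PS_scal (sqrt 2) c) (fun _ => 0) n).
  { apply PSeries_parity with m; [| | | apply Hm |].
    - rewrite CV_radius_scal; [easy|lra].
    - now rewrite CV_radius_const_0.
    - apply radius_pos_of_ex_pseries with (r / 2); [lra|]. eexists. apply He. rewrite Rabs_pos_eq; lra.
    - intros s Hs. rewrite (is_pseries_unique _ _ _ (He s ltac:(rewrite Rabs_pos_eq; lra))).
      assert (Hs2 : 0 < s ^ 2 < m) by nra.
      rewrite PSeries_const_0, PSeries_scal.
      specialize (Hks (s ^ 2)). rewrite !Rminus_0_r in Hks. rewrite <- Hks by (rewrite Rabs_pos_eq; lra).
      rewrite <- H, HQV, HQW by lra. field. lra. }
  assert (Hodd : forall n, b (2 * n + 1)%nat = 0).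
  { intros n. specialize (Hpar (2 * n + 1)%nat). unfold PS_interlace in Hpar.
    rewrite Nat.add_1_r, Nat.even_succ, Nat.odd_mul in Hpar. simpl Nat.odd in Hpar. simpl andb in Hpar.
    cbn iota in Hpar. unfold e in Hpar. rewrite pow_1_odd in Hpar. rewrite Nat.add_1_r.
    assert (Hz : (c1 - c2) * b (S (2 * n)) = 0) by lra.
    apply Rmult_integral in Hz. destruct Hz; [lra|easy]. }
  assert (Hsym : forall s, PSeries b (- s) = PSeries b s).
  { intros s. rewrite PSeries_opp_arg. apply PSeries_ext. intros n.
    destruct (Nat.Even_or_Odd n) as [[j ->]|[j ->]].
    - rewrite pow_1_even. ring.
    - rewrite Hodd. ring. }
  intros th Hth.
  enough (quarter V th - quarter (refl V) th = 0) by lra.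
  set (d := fun th => quarter V th - quarter (refl V) th).
  assert (Hmm : 0 < m ^ 2 <= 1) by nra.
  apply (analytic_identity d 0 (th + 1) (Rmin (m ^ 2) th / 2)).
  - intros x Hx. apply analytic_minus; now apply quarter_analytic.
  - assert (0 < Rmin (m ^ 2) th) by (apply Rmin_pos; lra). pose proof (Rmin_r (m ^ 2) th). lra.
  - assert (0 < Rmin (m ^ 2) th) by (apply Rmin_pos; lra). pose proof (Rmin_l (m ^ 2) th).
    apply (locally_between 0 (m ^ 2)); [lra|]. intros y Hy.
    assert (Hsy : sqrt y < m) by (rewrite <- (sqrt_pow2 m) by lra; apply sqrt_lt_1; lra).
    assert (Hsy0 : 0 < sqrt y) by (apply sqrt_lt_R0; lra).
    assert (Ey : y = sqrt y ^ 2) by (simpl; rewrite Rmult_1_r, sqrt_sqrt; lra).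
    unfold d. rewrite Ey, HQV, HQW by lra. rewrite Hsym. ring.
  - lra.
Qed.

(** * One-sided limits and the sign of the momentum *)

Definition rlim (f : R -> R) (t0 l : R) : Prop :=
  forall e, 0 < e -> exists d, 0 < d /\ forall t, t0 < t < t0 + d -> Rabs (f t - l) < e.

Definition llim (f : R -> R) (t0 l : R) : Prop :=
  forall e, 0 < e -> exists d, 0 < d /\ forall t, t0 - d < t < t0 -> Rabs (f t - l) < e.

Lemma rlim_of_filterlim f t0 l : filterlim f (at_right t0) (locally l) -> rlim f t0 l.
Proof.
  intros H e He. assert (Hl := H _ (locally_abs l e He)). apply locally_abs_inv in Hl as [d [Hd Hl]]. exists d. split; [easy|]. intros t Ht. apply Hl.
  - apply Rabs_def1; lra.
  - apply Ht.
Qed.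

Lemma llim_of_filterlim f t0 l : filterlim f (at_left t0) (locally l) -> llim f t0 l.
Proof.
  intros H e He. assert (Hl := H _ (locally_abs l e He)). apply locally_abs_inv in Hl as [d [Hd Hl]]. exists d. split; [easy|]. intros t Ht. apply Hl.
  - apply Rabs_def1; lra.
  - apply Ht.
Qed.

Lemma rlim_of_continuous (f : R -> R) t0 : continuous f t0 -> rlim f t0 (f t0).
Proof. intros H. apply rlim_of_filterlim. eapply filterlim_filter_le_1; [apply filter_le_within | exact H]. Qed.

Lemma llim_of_continuous (f : R -> R) t0 : continuous f t0 -> llim f t0 (f t0).
Proof. intros H. apply llim_of_filterlim. eapply filterlim_filter_le_1; [apply filter_le_within | exact H]. Qed.

Lemma rlim_eventually (f : R -> R) t0 l (Q : R -> Prop) : rlim f t0 l -> locally l Q ->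
  exists d, 0 < d /\ forall t, t0 < t < t0 + d -> Q (f t).
Proof.
  intros H HQ. apply locally_abs_inv in HQ as [e [He HQ]].
  destruct (H e He) as [d [Hd Hl]]. exists d. split; [easy|]. intros t Ht. now apply HQ, Hl.
Qed.

Lemma rlim_reverse f t0 l : llim f t0 l -> rlim (fun t => f (2 * t0 - t)) t0 l.
Proof.
  intros H e He. destruct (H e He) as [d [Hd Hl]]. exists d. split; [easy|].
  intros t Ht. apply Hl. lra.
Qed.

Lemma sgn_sq e : sgn e * sgn e = 1.
Proof. destruct e; simpl; ring. Qed.

Lemma sign_constant (p : R -> R) l u : l < u -> (forall t, l < t < u -> continuous p t) ->
  (forall t, l < t < u -> p t <> 0) -> exists e, forall t, l < t < u -> 0 < sgn e * p t.
Proof.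
  intros Hlu Hc Hn.
  assert (Hkey : forall x y, l < x < u -> l < y < u -> p x < 0 -> 0 < p y -> False).
  { intros x y Hx Hy Hpx Hpy. destruct (Rtotal_order x y) as [H|[->|H]]; [|lra|].
    - destruct (IVT_interv p x y) as [z [Hz Hz0]]; auto.
      + intros z Hz. apply continuity_pt_filterlim. apply Hc. lra.
      + apply (Hn z); [lra|easy].
    - destruct (IVT_interv (fun t => - p t) y x) as [z [Hz Hz0]]; try lra.
      + intros z Hz. apply continuity_pt_filterlim. apply (continuous_opp (V := R_NormedModule) p). apply Hc. lra.
      + apply (Hn z); lra. }
  set (m := (l + u) / 2). assert (Hm : l < m < u) by (unfold m; lra).
  destruct (Rtotal_order (p m) 0) as [H|[H|H]]; [|now apply Hn in H|].
  - exists false. intros t Ht. simpl. destruct (Rtotal_order (p t) 0) as [H1|[H1|H1]]; [lra|now apply Hn in H1|].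
    exfalso. now apply (Hkey m t).
  - exists true. intros t Ht. simpl. destruct (Rtotal_order (p t) 0) as [H1|[H1|H1]]; [|now apply Hn in H1|lra].
    exfalso. now apply (Hkey t m).
Qed.

Section OneDegree.
Context (V : R -> R) (HV : well V) (th : R) (Hth : 0 < th).

Definition solves (q p : R -> R) l u : Prop :=
  forall t, l < t < u -> is_derive q t (p t) /\ is_derive p t (- Derive V (q t)) /\
    p t ^ 2 / 2 + V (q t) = th.

Lemma well_Derive_nonzero x : V x = th -> Derive V x <> 0.
Proof.
  intros H E. assert (Hx : x <> 0) by (intros ->; rewrite (well_0 V HV) in H; lra).
  destruct HV as (_ & _ & Hd & _). specialize (Hd x Hx). rewrite E in Hd. lra.
Qed.

(** Strictly inside the well, conservation of energy keeps [p] away from 0. At a turning point the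
    force is nonzero and directed inward, so it fixes the sign; no limit of [p] at [t0] is
    assumed. *)
Lemma germ_right q p t0 d q0 : 0 < d -> solves q p t0 (t0 + d) -> rlim q t0 q0 -> V q0 <= th ->
  exists de e, 0 < de <= d /\ (forall t, t0 < t < t0 + de -> 0 < sgn e * p t) /\
    (V q0 = th -> sgn e * Derive V q0 < 0).
Proof.
  intros Hd Hs Hq [Hlt|Heq].
  - assert (HL : locally q0 (fun x => V x < th)).
    { apply (well_continuous V q0 HV (fun t => t < th)). now apply open_lt. }
    destruct (rlim_eventually q t0 q0 _ Hq HL) as [d1 [Hd1 H1]].
    set (de := Rmin d d1). assert (Hde : 0 < de) by now apply Rmin_pos.
    Rmin_bounds d d1. fold de in H, H0.
    destruct (sign_constant p t0 (t0 + de)) as [e He]; [lra| | |].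
    + intros t Ht. eapply is_derive_cont. apply Hs. lra.
    + intros t Ht E. specialize (H1 t ltac:(lra)). simpl in H1.
      destruct (Hs t ltac:(lra)) as [_ [_ HE]]. rewrite E in HE. simpl in HE. lra.
    + exists de, e. split; [lra|]. split; [easy|]. intros; lra.
  - set (c := Derive V q0). assert (Hc : c <> 0) by now apply well_Derive_nonzero.
    assert (He : exists e, sgn e * c < 0).
    { destruct (Rtotal_order c 0) as [H|[H|H]]; [exists true; simpl; lra|easy|exists false; simpl; lra]. }
    destruct He as [e He].
    assert (HL : locally q0 (fun x => sgn e * Derive V x < 0)).
    { assert (Hc2 : continuous (fun x => sgn e * Derive V x) q0).
      { apply continuous_Rmult; [apply continuous_const|].
        apply analytic_continuous, analytic_Derive, HV. }
      apply (Hc2 (fun t => t < 0)). now apply open_lt. }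
    destruct (rlim_eventually q t0 q0 _ Hq HL) as [d1 [Hd1 H1]].
    set (de := Rmin d d1). assert (Hde : 0 < de) by now apply Rmin_pos.
    Rmin_bounds d d1. fold de in H, H0.
    exists de, e. split; [lra|]. split; [|easy].
    assert (Hmono : forall x y, t0 < x -> x < y -> y < t0 + de -> sgn e * p x < sgn e * p y).
    { intros x y Hx Hxy Hy.
      destruct (MVT_cor2 (fun t => sgn e * p t) (fun t => sgn e * - Derive V (q t)) x y Hxy) as [z [E Hz]].
      - intros z Hz. apply is_derive_Reals. apply is_derive_scal. apply Hs. lra.
      - specialize (H1 z ltac:(lra)). simpl in H1. nra. }
    (* Otherwise the increasing function [sgn e * p] stays at or below a negative [b] near [t0], and
       the kinetic energy [b ^ 2 / 2] keeps [V q] away from its limit [th]. *)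
    intros t1 Ht1. apply Rnot_le_lt. intros Hneg.
    set (t2 := (t0 + t1) / 2). assert (Ht2 : t0 < t2 < t1) by (unfold t2; lra).
    assert (H2 : sgn e * p t2 < 0) by (pose proof (Hmono t2 t1); lra).
    set (b := sgn e * p t2) in *.
    assert (HLV : locally q0 (fun x => th - b ^ 2 / 2 < V x)).
    { apply (well_continuous V q0 HV (fun t => th - b ^ 2 / 2 < t)). apply open_gt. rewrite Heq.
      assert (0 < b ^ 2) by (apply pow2_gt_0; lra). lra. }
    destruct (rlim_eventually q t0 q0 _ Hq HLV) as [d2 [Hd2 H3]].
    set (t3 := Rmin t2 (t0 + d2 / 2)).
    assert (Ht3 : t0 < t3 /\ t3 <= t2 /\ t3 <= t0 + d2 / 2).
    { unfold t3. split; [apply Rmin_glb_lt; lra|]. split; [apply Rmin_l|apply Rmin_r]. }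
    specialize (H3 t3 ltac:(lra)). simpl in H3.
    destruct (Hs t3 ltac:(lra)) as [_ [_ HE]].
    assert (Hle : sgn e * p t3 <= b).
    { destruct (Req_dec t3 t2) as [->|]; [unfold b; lra|]. left. apply Hmono; lra. }
    assert (Hsq : p t3 ^ 2 = (sgn e * p t3) ^ 2).
    { replace ((sgn e * p t3) ^ 2) with ((sgn e * sgn e) * p t3 ^ 2) by ring. rewrite sgn_sq. ring. }
    simpl in *. nra.
Qed.

(** Time reversal about [t0] with [p] negated; arriving at a turning point, the momentum points
    outward. *)
Lemma germ_left q p t0 d q0 : 0 < d -> solves q p (t0 - d) t0 -> llim q t0 q0 -> V q0 <= th ->
  exists de e, 0 < de <= d /\ (forall t, t0 - de < t < t0 -> 0 < sgn e * p t) /\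
    (V q0 = th -> 0 < sgn e * Derive V q0).
Proof.
  intros Hd Hs Hq H0.
  destruct (germ_right (fun t => q (2 * t0 - t)) (fun t => - p (2 * t0 - t)) t0 d q0)
    as [de [e [H1 [H2 H3]]]]; auto.
  - intros t Ht. destruct (Hs (2 * t0 - t) ltac:(lra)) as [D1 [D2 HE]]. split; [|split].
    + replace (- p (2 * t0 - t)) with (-1 * p (2 * t0 - t)) by ring.
      apply (is_derive_comp q (fun t => 2 * t0 - t)); [easy|]. auto_derive; [easy|ring].
    + apply (is_derive_opp (V := R_NormedModule) (fun t => p (2 * t0 - t))).
      replace (Derive V (q (2 * t0 - t))) with (-1 * - Derive V (q (2 * t0 - t))) by ring.
      apply (is_derive_comp p (fun t => 2 * t0 - t)); [easy|]. auto_derive; [easy|ring].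
    + rewrite <- HE. field.
  - now apply rlim_reverse.
  - exists de, (negb e). split; [easy|].
    assert (Hn : sgn (negb e) = - sgn e) by (destruct e; simpl; ring). split.
    + intros t Ht. specialize (H2 (2 * t0 - t) ltac:(lra)). simpl in H2.
      replace (2 * t0 - (2 * t0 - t)) with t in H2 by ring. rewrite Hn. lra.
    + intros E. specialize (H3 E). rewrite Hn. lra.
Qed.

(* Extension of [travel] by continuity to the two turning points. *)
Definition travel_bar (x : R) : R :=
  if Rlt_dec (V x) th then travel V x th
  else if Rlt_dec 0 x then quarter V th else - quarter (refl V) th.

End OneDegree.

(** The missing time is the momentum integral up to [sqrt (2 * (th - V x))], which is proper and
    continuous at momentum 0. *)
Lemma travel_to_turning V th x0 e : well V -> 0 < th -> 0 < x0 -> V x0 = th -> 0 < e ->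
  exists d, 0 < d /\ forall x, Rabs (x - x0) < d -> V x < th -> Rabs (travel V x th - quarter V th) < e.
Proof.
  intros HV Hth Hx0 E He.
  assert (Hc1 : continuous (fun x => sqrt (2 * (th - V x))) x0).
  { apply (continuous_comp (fun x => 2 * (th - V x)) sqrt).
    - apply ex_derive_cont. auto_derive. now apply well_ex_derive.
    - apply continuous_sqrt. }
  assert (Hc : continuous (fun x => ptime V th (sqrt (2 * (th - V x)))) x0).
  { apply (continuous_comp (fun x => sqrt (2 * (th - V x))) (ptime V th)); [easy|].
    rewrite E, Rminus_diag, Rmult_0_r, sqrt_0. now apply ptime_continuous_0. }
  assert (Hl := Hc _ (locally_abs _ e He)). simpl in Hl.
  rewrite E, Rminus_diag, Rmult_0_r, sqrt_0, ptime_0 in Hl.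
  apply locally_abs_inv in Hl as [d [Hd Hl]].
  exists (Rmin d x0). split; [now apply Rmin_pos|].
  Rmin_bounds d x0.
  intros x Hx HVx. specialize (Hl x ltac:(lra)). apply Rabs_def2 in Hx.
  rewrite <- (quarter_travel V HV th x) by lra. rewrite Rminus_0_r in Hl.
  replace (travel V x th - (travel V x th + ptime V th (sqrt (2 * (th - V x))))) with
    (- ptime V th (sqrt (2 * (th - V x)))) by ring. now rewrite Rabs_Ropp.
Qed.

Lemma travel_bar_cont V th x0 e : well V -> 0 < th -> V x0 <= th -> 0 < e ->
  exists d, 0 < d /\ forall x, Rabs (x - x0) < d -> V x < th ->
    Rabs (travel V x th - travel_bar V th x0) < e.
Proof.
  intros HV Hth [Hlt|Heq] He; unfold travel_bar; destruct Rlt_dec; try lra.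
  - assert (Hc : continuous (fun x => travel V x th) x0).
    { eapply is_derive_cont. now apply travel_derive. }
    assert (Hl := Hc _ (locally_abs _ e He)). apply locally_abs_inv in Hl as [d [Hd Hl]]. exists d. split; [easy|]. intros; now apply Hl.
  - destruct Rlt_dec as [Hp|Hp]; [now apply travel_to_turning|].
    assert (Hx0 : x0 <> 0) by (intros ->; rewrite (well_0 V HV) in Heq; lra).
    destruct (travel_to_turning (refl V) th (- x0) e) as [d [Hd H]];
      auto; [now apply well_refl|lra|unfold refl; now rewrite Ropp_involutive|].
    exists d. split; [easy|]. intros x Hx HVx.
    specialize (H (- x)). replace (- x - - x0) with (- (x - x0)) in H by ring.
    rewrite Rabs_Ropp in H. specialize (H Hx). unfold refl in H at 1. rewrite Ropp_involutive in H.
    specialize (H HVx). rewrite travel_refl in H by (rewrite ?Ropp_involutive; easy).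
    rewrite Ropp_involutive in H.
    replace (travel V x th - - quarter (refl V) th) with (- (- travel V x th - quarter (refl V) th)) by ring.
    now rewrite Rabs_Ropp.
Qed.

(** * Durations as words in times of flight *)

Definition zcoef (L : list (R * Z)) : list (R * R) := map (fun xc => (fst xc, IZR (snd xc))) L.

Definition time_word (V : R -> R) (L : list (R * Z)) (n m : nat) (th : R) : R :=
  tsum V (zcoef L) th + (INR n * quarter V th + INR m * quarter (refl V) th).

(** Integer and natural coefficients leave countably many words when [X] is finite; nonnegativity of
    the two quarter coefficients is essential to both final arguments. *)
Definition is_time (V : R -> R) (X : R -> Prop) (th t : R) : Prop :=
  exists L n m, (forall xc, In xc L -> X (fst xc) /\ V (fst xc) < th) /\ t = time_word V L n m th.

Lemma is_time_0 V X th : is_time V X th 0.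
Proof.
  exists nil, 0%nat, 0%nat. split; [intros _ []|]. unfold time_word. simpl. ring.
Qed.

Lemma is_time_travel V X th t x c : X x -> V x < th -> is_time V X th t ->
  is_time V X th (t + IZR c * travel V x th).
Proof.
  intros HX Hx (L & n & m & HL & ->). exists ((x, c) :: L), n, m. split.
  - intros xc [<-|H]; [easy|now apply HL].
  - unfold time_word. simpl. ring.
Qed.

Lemma is_time_quarter V X th t : is_time V X th t -> is_time V X th (t + quarter V th).
Proof.
  intros (L & n & m & HL & ->). exists L, (S n), m. split; [easy|].
  unfold time_word. rewrite S_INR. ring.
Qed.

Lemma is_time_quarter_refl V X th t : is_time V X th t -> is_time V X th (t + quarter (refl V) th).
Proof.
  intros (L & n & m & HL & ->). exists L, n, (S m). split; [easy|].
  unfold time_word. rewrite S_INR. ring.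
Qed.

(** * Duration of the motion of one coordinate *)

Section Trajectory.
Context (V : R -> R) (HV : well V) (th : R) (Hth : 0 < th) (T : R) (HT : 0 < T)
  (X : R -> Prop) (q p : R -> R) (ts : list R)
  (HE : forall t, 0 <= t <= T -> p t ^ 2 / 2 + V (q t) = th)
  (Hq0 : rlim q 0 (q 0)) (HqT : llim q T (q T))
  (Hts : forall s, In s ts -> 0 < s < T)
  (Hode : forall t, 0 < t < T -> ~ In t ts ->
     is_derive q t (p t) /\ is_derive p t (- Derive V (q t)))
  (Hjump : forall s, In s ts -> continuous q s /\ exists u w, llim p s u /\ rlim p s w /\
     (w = u \/ (w = - u /\ X (q s))))
  (H0 : X (q 0) \/ V (q 0) = th) (H1 : X (q T) \/ V (q T) = th).

Lemma traj_level t : 0 <= t <= T -> V (q t) <= th.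
Proof. intros Ht. specialize (HE t Ht). pose proof (pow2_ge_0 (p t)). lra. Qed.

Lemma traj_q_cont t : 0 < t < T -> continuous q t.
Proof.
  intros Ht. destruct (classic (In t ts)) as [Hin|Hn]; [now apply Hjump|].
  eapply is_derive_cont. now apply Hode.
Qed.

Lemma traj_rlim t : 0 <= t < T -> rlim q t (q t).
Proof.
  intros Ht. destruct (Req_dec t 0) as [->|]; [exact Hq0|]. apply rlim_of_continuous, traj_q_cont. lra.
Qed.

Lemma traj_llim t : 0 < t <= T -> llim q t (q t).
Proof.
  intros Ht. destruct (Req_dec t T) as [->|]; [exact HqT|]. apply llim_of_continuous, traj_q_cont. lra.
Qed.

Lemma list_gap (l : list R) t0 d : 0 < d ->
  exists de, 0 < de <= d /\ forall t, In t l -> t <> t0 -> de <= Rabs (t - t0).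
Proof.
  intros Hd. induction l as [|a l IH].
  - exists d. split; [lra|]. intros t [].
  - destruct IH as [de [Hde IH]]. destruct (Req_dec a t0) as [->|Ha].
    + exists de. split; [easy|]. intros t [<-|Ht] Hne; [easy|now apply IH].
    + assert (0 < Rabs (a - t0)) by (apply Rabs_pos_lt; lra).
      exists (Rmin de (Rabs (a - t0))). pose proof (Rmin_l de (Rabs (a - t0))).
      split; [split; [now apply Rmin_pos|lra]|].
      intros t [<-|Ht] Hne; [apply Rmin_r|]. specialize (IH t Ht Hne). lra.
Qed.

Lemma traj_germ_right t0 : 0 <= t0 < T ->
  exists de e, 0 < de /\ t0 + de <= T /\ solves V th q p t0 (t0 + de) /\
    (forall t, t0 < t < t0 + de -> 0 < sgn e * p t) /\
    (V (q t0) = th -> sgn e * Derive V (q t0) < 0).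
Proof.
  intros Ht0. destruct (list_gap ts t0 (T - t0) ltac:(lra)) as [d [Hd Hgap]].
  assert (Hs : solves V th q p t0 (t0 + d)).
  { intros t Ht. assert (Hn : ~ In t ts).
    { intros Hin. specialize (Hgap t Hin ltac:(lra)). rewrite Rabs_pos_eq in Hgap; lra. }
    destruct (Hode t ltac:(lra) Hn). split; [easy|]. split; [easy|]. apply HE. lra. }
  destruct (germ_right V HV th Hth q p t0 d (q t0)) as [de [e [H2 [H3 H4]]]]; auto; try lra.
  - now apply traj_rlim.
  - apply traj_level. lra.
  - exists de, e. split; [lra|]. split; [lra|]. split; [|now split].
    intros t Ht. apply Hs. lra.
Qed.

Lemma traj_germ_left t0 : 0 < t0 <= T ->
  exists de e, 0 < de /\ 0 <= t0 - de /\ solves V th q p (t0 - de) t0 /\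
    (forall t, t0 - de < t < t0 -> 0 < sgn e * p t) /\
    (V (q t0) = th -> 0 < sgn e * Derive V (q t0)).
Proof.
  intros Ht0. destruct (list_gap ts t0 t0 ltac:(lra)) as [d [Hd Hgap]].
  assert (Hs : solves V th q p (t0 - d) t0).
  { intros t Ht. assert (Hn : ~ In t ts).
    { intros Hin. specialize (Hgap t Hin ltac:(lra)). rewrite Rabs_left in Hgap; lra. }
    destruct (Hode t ltac:(lra) Hn). split; [easy|]. split; [easy|]. apply HE. lra. }
  destruct (germ_left V HV th Hth q p t0 d (q t0)) as [de [e [H2 [H3 H4]]]]; auto; try lra.
  - now apply traj_llim.
  - apply traj_level. lra.
  - exists de, e. split; [lra|]. split; [lra|]. split; [|now split].
    intros t Ht. apply Hs. lra.
Qed.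

Lemma left_sign_unique t d1 e1 d2 e2 : 0 < d1 -> 0 < d2 ->
  (forall s, t - d1 < s < t -> 0 < sgn e1 * p s) ->
  (forall s, t - d2 < s < t -> 0 < sgn e2 * p s) -> e1 = e2.
Proof.
  intros Hd1 Hd2 P1 P2. assert (Hm : 0 < Rmin d1 d2) by now apply Rmin_pos.
  Rmin_bounds d1 d2.
  specialize (P1 (t - Rmin d1 d2 / 2) ltac:(lra)). specialize (P2 (t - Rmin d1 d2 / 2) ltac:(lra)).
  destruct e1, e2; simpl in *; try easy; lra.
Qed.

Lemma solves_below l u e t : solves V th q p l u -> l < t < u -> 0 < sgn e * p t -> V (q t) < th.
Proof.
  intros Hs Ht Hp. destruct (Hs t Ht) as [_ [_ E]].
  assert (p t <> 0) by (intros Ez; rewrite Ez in Hp; lra).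
  pose proof (pow2_gt_0 (p t) H). lra.
Qed.

(** While the sign of [p] is [e], the speed is [sgn e * p], so signed time of flight grows at unit
    rate. *)
Lemma phase_constant l u e : solves V th q p l u -> (forall t, l < t < u -> 0 < sgn e * p t) ->
  forall s t, l < s < u -> l < t < u ->
    s - sgn e * travel V (q s) th = t - sgn e * travel V (q t) th.
Proof.
  intros Hs Hp. apply const_of_derive_0. intros t Ht.
  assert (Hb : V (q t) < th) by (now apply (solves_below l u e); auto).
  destruct (Hs t Ht) as [D1 [_ E]]. specialize (Hp t Ht).
  assert (Hsq : sqrt (2 * (th - V (q t))) = sgn e * p t).
  { replace (2 * (th - V (q t))) with ((sgn e * p t) ^ 2).
    - apply sqrt_pow2. lra.
    - replace ((sgn e * p t) ^ 2) with ((sgn e * sgn e) * p t ^ 2) by ring. rewrite sgn_sq. lra. }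
  replace 0 with (1 - sgn e * (p t * / sqrt (2 * (th - V (q t))))).
  - apply (is_derive_minus (V := R_NormedModule)); [apply (is_derive_id (K := R_AbsRing))|].
    apply is_derive_scal. apply (is_derive_comp (fun x => travel V x th) q); [now apply travel_derive|easy].
  - rewrite Hsq. field. split; intros Ez; rewrite Ez in Hp; lra.
Qed.

Lemma limit_value (f : R -> R) c l : (forall e, 0 < e -> exists y, f y = c /\ Rabs (f y - l) < e) -> c = l.
Proof.
  intros H. apply NNPP. intros Hn. destruct (H (Rabs (c - l))) as [y [E Hy]].
  - apply Rabs_pos_lt. lra.
  - rewrite E in Hy. lra.
Qed.

Lemma phase_limit_value l u t0 e : 0 <= t0 <= T -> solves V th q p l u ->
  (forall t, l < t < u -> 0 < sgn e * p t) ->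
  (forall d, 0 < d -> exists s, l < s < u /\ Rabs (s - t0) < d /\ Rabs (q s - q t0) < d) ->
  forall t, l < t < u ->
  t - sgn e * travel V (q t) th = t0 - sgn e * travel_bar V th (q t0).
Proof.
  intros Ht0 Hs Hp Hlim t Ht. apply (limit_value (fun s => s - sgn e * travel V (q s) th)).
  intros ep Hep.
  destruct (travel_bar_cont V th (q t0) (ep / 2) HV Hth (traj_level t0 Ht0) ltac:(lra)) as [d1 [Hd1 C1]].
  destruct (Hlim (Rmin d1 (ep / 2))) as [s [Hsl [C2 C3]]]; [apply Rmin_pos; lra|].
  Rmin_bounds d1 (ep / 2).
  exists s. split; [now apply (phase_constant l u)|].
  specialize (C1 (q s) ltac:(lra) (solves_below l u e s Hs Hsl (Hp s Hsl))).
  set (A := travel V _ th) in *. set (B := travel_bar V th (q t0)) in *.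
  replace (s - sgn e * A - (t0 - sgn e * B)) with (s - t0 + - sgn e * (A - B)) by ring.
  eapply Rle_lt_trans; [apply Rabs_triang|]. rewrite Rabs_mult.
  replace (Rabs (- sgn e)) with 1 by (destruct e; simpl; unfold Rabs; destruct Rcase_abs; lra). lra.
Qed.

Lemma phase_right_value t0 d e : 0 <= t0 < T -> 0 < d -> solves V th q p t0 (t0 + d) ->
  (forall t, t0 < t < t0 + d -> 0 < sgn e * p t) -> forall t, t0 < t < t0 + d ->
  t - sgn e * travel V (q t) th = t0 - sgn e * travel_bar V th (q t0).
Proof.
  intros Ht0 Hd Hs Hp. apply (phase_limit_value t0 (t0 + d)); auto; [lra|].
  intros d1 Hd1. destruct (traj_rlim t0 Ht0 d1 Hd1) as [d2 [Hd2 C]].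
  destruct (min4_pos d d1 d2 d2) as (m & Hm); [lra..|].
  exists (t0 + m / 2). split; [lra|]. split; [apply Rabs_def1; lra|]. apply C. lra.
Qed.

Lemma phase_left_value t0 d e : 0 < t0 <= T -> 0 < d -> solves V th q p (t0 - d) t0 ->
  (forall t, t0 - d < t < t0 -> 0 < sgn e * p t) -> forall t, t0 - d < t < t0 ->
  t - sgn e * travel V (q t) th = t0 - sgn e * travel_bar V th (q t0).
Proof.
  intros Ht0 Hd Hs Hp. apply (phase_limit_value (t0 - d) t0); auto; [lra|].
  intros d1 Hd1. destruct (traj_llim t0 Ht0 d1 Hd1) as [d2 [Hd2 C]].
  destruct (min4_pos d d1 d2 d2) as (m & Hm); [lra..|].
  exists (t0 - m / 2). split; [lra|]. split; [apply Rabs_def1; lra|]. apply C. lra.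
Qed.

Lemma travel_bar_below x : V x < th -> travel_bar V th x = travel V x th.
Proof. intros H. unfold travel_bar. destruct Rlt_dec; [easy|lra]. Qed.

(** The hypothesis says that [e] is the outward sign at [x]. It cancels the sign of [travel_bar], so
    a quarter period always enters with a plus. *)
Lemma turning_value x e : V x = th -> 0 < sgn e * Derive V x ->
  (sgn e * travel_bar V th x = quarter V th \/ sgn e * travel_bar V th x = quarter (refl V) th).
Proof.
  intros E Hd. unfold travel_bar. destruct Rlt_dec; [lra|].
  assert (Hx : x <> 0) by (intros ->; rewrite (well_0 V HV) in E; lra).
  pose proof HV as (_ & _ & Hxd & _). specialize (Hxd x Hx).
  destruct Rlt_dec as [Hp|Hp]; [left|right]; destruct e; simpl in *; try ring; exfalso; nra.
Qed.

Lemma is_time_turning t x e : V x = th -> 0 < sgn e * Derive V x ->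
  is_time V X th t -> is_time V X th (t + sgn e * travel_bar V th x).
Proof.
  intros E Hd Ht. destruct (turning_value x e E Hd) as [-> | ->];
    [now apply is_time_quarter | now apply is_time_quarter_refl].
Qed.

Lemma is_time_sgn_travel t x e : X x -> V x < th -> is_time V X th t ->
  is_time V X th (t + sgn e * travel_bar V th x).
Proof.
  intros HX Hx Ht. rewrite travel_bar_below by easy.
  replace (sgn e) with (IZR (if e then 1 else -1)) by (now destruct e). now apply is_time_travel.
Qed.

(* Up to an admissible time [la], the elapsed time is the signed time of flight to [q t], where
   [e] is the sign of the momentum just before (resp. after) [t]. *)
Definition phase_left (t : R) : Prop :=
  exists e la d, is_time V X th la /\ t = sgn e * travel_bar V th (q t) + la /\ 0 < d /\
    forall s, t - d < s < t -> 0 < sgn e * p s.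

Definition phase_right (t : R) : Prop :=
  exists e la d, is_time V X th la /\ t = sgn e * travel_bar V th (q t) + la /\ 0 < d /\
    t + d <= T /\ solves V th q p t (t + d) /\ forall s, t < s < t + d -> 0 < sgn e * p s.

Lemma phase_right_start : phase_right 0.
Proof.
  destruct (traj_germ_right 0 ltac:(lra)) as [d [e [Hd [HdT [Hs [Hp Htp]]]]]].
  (* A departure from a turning point is inward, so [- sgn e] is the outward sign and the quarter
     period is again added. The leading 0 is the empty word being extended. *)
  exists e, (0 + - (sgn e * travel_bar V th (q 0))), d. split; [|split; [ring|auto]].
  assert (Hn : - (sgn e * travel_bar V th (q 0)) = sgn (negb e) * travel_bar V th (q 0))
    by (destruct e; simpl; ring).
  rewrite Hn. destruct (traj_level 0 ltac:(lra)) as [Hlt|Heq].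
  - destruct H0 as [HX|HX]; [|lra]. apply is_time_sgn_travel; [easy|easy|apply is_time_0].
  - apply is_time_turning; [easy| |apply is_time_0]. specialize (Htp Heq). destruct e; simpl in *; lra.
Qed.

(** Off the turning points the kinetic energy is bounded below near [t], so the limit is strictly
    signed. Together with the weak inequality from the right, this excludes a change of sign without
    a reflection. *)
Lemma llim_sign t d e u : 0 < t < T -> 0 < d -> V (q t) < th ->
  (forall s, t - d < s < t -> 0 < sgn e * p s) -> llim p t u -> 0 < sgn e * u.
Proof.
  intros Ht Hd Hlt Hp Hu. set (ka := th - V (q t)). assert (Hka : 0 < ka) by (unfold ka; lra).
  assert (Hs : 0 < sqrt ka) by now apply sqrt_lt_R0.
  assert (Hss : sqrt ka * sqrt ka = ka) by (apply sqrt_sqrt; lra).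
  apply Rnot_le_lt. intros Hneg.
  destruct (Hu (sqrt ka) Hs) as [d1 [Hd1 C1]].
  assert (HL : locally (q t) (fun x => V x < th - ka / 2)).
  { apply (well_continuous V (q t) HV (fun y => y < th - ka / 2)). apply open_lt. unfold ka. lra. }
  apply locally_abs_inv in HL as [d2 [Hd2 HL]].
  destruct (llim_of_continuous q t (traj_q_cont t Ht) d2 Hd2) as [d3 [Hd3 C3]].
  destruct (min4_pos d d1 d3 t) as (m & Hm); [lra..|].
  set (s := t - m / 2).
  specialize (Hp s ltac:(unfold s; lra)). specialize (C1 s ltac:(unfold s; lra)).
  specialize (HL (q s) (C3 s ltac:(unfold s; lra))). simpl in HL.
  specialize (HE s ltac:(unfold s; lra)).
  apply Rabs_def2 in C1. destruct e; simpl in *; nra.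
Qed.

Lemma rlim_sign t d e u : 0 < t < T -> 0 < d -> V (q t) < th ->
  (forall s, t < s < t + d -> 0 < sgn e * p s) -> rlim p t u -> 0 <= sgn e * u.
Proof.
  intros Ht Hd Hlt Hp Hu. apply Rnot_lt_le. intros Hneg.
  destruct (Hu (- (sgn e * u)) ltac:(lra)) as [d1 [Hd1 C1]].
  set (m := Rmin d d1). assert (Hm : 0 < m) by now apply Rmin_pos.
  Rmin_bounds d d1. fold m in H, H2.
  specialize (Hp (t + m / 2) ltac:(lra)). specialize (C1 (t + m / 2) ltac:(lra)).
  apply Rabs_def2 in C1. destruct e; simpl in *; lra.
Qed.

(** When the sign flips, [la] must grow by twice the signed time of flight to [q t]. A flip happens
    only at a reflecting abscissa or at a turning point, and in both cases this increment extends
    the word. *)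
Lemma phase_left_right t : 0 < t < T -> phase_left t -> phase_right t.
Proof.
  intros Ht (e & la & d & Hla & Et & Hd & Hp).
  destruct (traj_germ_right t ltac:(lra)) as [d' [e' [Hd' [HdT [Hs [Hp' Htp]]]]]].
  destruct (Bool.bool_dec e e') as [<-|Hne].
  { exists e, la, d'. auto 10. }
  assert (Hee : sgn e' = - sgn e) by (destruct e, e'; simpl; try easy; ring).
  exists e', (la + sgn e * travel_bar V th (q t) + sgn e * travel_bar V th (q t)), d'.
  split; [|split; [rewrite Hee; lra|auto]].
  destruct (traj_level t ltac:(lra)) as [Hlt|Heq].
  - assert (Hj : exists u w, llim p t u /\ rlim p t w /\ (w = u \/ (w = - u /\ X (q t)))).
    { destruct (classic (In t ts)) as [Hin|Hn]; [now apply Hjump|].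
      assert (Hc : continuous p t).
      { eapply is_derive_cont. now apply Hode. }
      exists (p t), (p t). split; [now apply llim_of_continuous|]. split; [now apply rlim_of_continuous|now left]. }
    destruct Hj as (u & w & Hu & Hw & Hj).
    pose proof (llim_sign t d e u Ht Hd Hlt Hp Hu).
    pose proof (rlim_sign t d' e' w Ht Hd' Hlt Hp' Hw).
    destruct Hj as [->|[_ HX]]; [rewrite Hee in *; lra|].
    now repeat apply is_time_sgn_travel.
  - destruct (traj_germ_left t ltac:(lra)) as [d2 [e2 [Hd2 [_ [_ [Hp2 Htp2]]]]]].
    assert (E : e = e2) by (eapply left_sign_unique; [exact Hd | exact Hd2 | exact Hp | exact Hp2]).
    subst e2. specialize (Htp2 Heq). now repeat apply is_time_turning.
Qed.

(** Real induction needs no bound on the number of turns: a known phase extends a little to the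
    right, and a phase known before [t] reaches [t]. *)
Theorem trajectory_time : is_time V X th T.
Proof.
  assert (Hall : forall t, 0 <= t <= T -> t = 0 \/ phase_left t).
  { apply real_induction.
    - now left.
    - intros t Ht IH.
      assert (Hr : phase_right t).
      { destruct (Req_dec t 0) as [->|Hn]; [apply phase_right_start|].
        destruct (IH t ltac:(lra)) as [|Hl]; [easy|]. apply phase_left_right; [lra|easy]. }
      destruct Hr as (e & la & d & Hla & Et & Hd & HdT & Hs & Hp).
      exists d. split; [easy|]. intros s Hst _. right.
      exists e, la, (s - t). split; [easy|]. split; [|split; [lra|]].
      + rewrite travel_bar_below by (apply (solves_below t (t + d) e); [easy|lra|apply Hp; lra]).
        pose proof (phase_right_value t d e ltac:(lra) Hd Hs Hp s ltac:(lra)). lra.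
      + intros s' Hs'. apply Hp. lra.
    (* The germ to the left of [t] has one sign on [(t - d, t)]; it matches the sign known at the
       inner point [t1], and constancy of the phase carries [la] from [t1] to [t]. *)
    - intros t Ht IH. right.
      destruct (traj_germ_left t ltac:(lra)) as [d [e [Hd [Hd0 [Hs [Hp _]]]]]].
      set (t1 := t - d / 2).
      destruct (IH t1 ltac:(unfold t1; lra)) as [Hz|(e1 & la & d1 & Hla & Et & Hd1 & Hp1)];
        [unfold t1 in Hz; lra|].
      assert (E : e1 = e).
      { apply (left_sign_unique t1 d1 e1 (d / 2) e Hd1 ltac:(lra) Hp1).
        intros s Hs1. apply Hp. unfold t1 in *. lra. }
      subst e1. exists e, la, d. split; [easy|]. split; [|split; [easy|easy]].
      rewrite travel_bar_below in Et
        by (apply (solves_below (t - d) t e); [easy|unfold t1; lra|apply Hp; unfold t1; lra]).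
      pose proof (phase_left_value t d e ltac:(lra) Hd Hs Hp t1 ltac:(unfold t1; lra)). lra. }
  destruct (Hall T ltac:(lra)) as [|(e & la & d & Hla & Et & Hd & Hp)]; [lra|].
  rewrite Et, Rplus_comm.
  destruct (traj_level T ltac:(lra)) as [Hlt|Heq].
  - destruct H1 as [HX|HX]; [|lra]. now apply is_time_sgn_travel.
  - destruct (traj_germ_left T ltac:(lra)) as [d2 [e2 [Hd2 [_ [_ [Hp2 Htp2]]]]]].
    assert (E : e = e2) by (eapply left_sign_unique; [exact Hd | exact Hd2 | exact Hp | exact Hp2]).
    subst e2. apply is_time_turning; auto.
Qed.

End Trajectory.

(** * Corners and sides *)

(** The negation serves as the set of reflecting abscissae: it covers vertical sides, convex corners
    and corners, survives truncation in the other coordinate, and holds at finitely many [x]. *)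
Definition col_const (Q : R -> R -> Prop) (x : R) : Prop :=
  exists d, 0 < d /\ forall x', Rabs (x' - x) < d -> forall y, Q x' y <-> Q x y.

Definition row_const (Q : R -> R -> Prop) (y : R) : Prop :=
  exists d, 0 < d /\ forall y', Rabs (y' - y) < d -> forall x, Q x y' <-> Q x y.

Lemma sgn_abs s a d : 0 < a < d -> Rabs (sgn s * a) < d.
Proof. intros H. destruct s; simpl; apply Rabs_def1; lra. Qed.

Lemma col_const_quad Q x y s1 s1' s2 : col_const Q x -> quad Q x y s1 s2 -> quad Q x y s1' s2.
Proof.
  intros [d [Hd H]] [e [He Hq]]. exists (Rmin d e). split; [now apply Rmin_pos|].
  Rmin_bounds d e.
  intros a b Ha Hb. apply H; [replace (x + sgn s1' * a - x) with (sgn s1' * a) by ring; apply sgn_abs; lra|].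
  apply (H (x + sgn s1 * a)); [replace (x + sgn s1 * a - x) with (sgn s1 * a) by ring; apply sgn_abs; lra|].
  apply Hq; lra.
Qed.

Lemma row_const_quad Q x y s1 s2 s2' : row_const Q y -> quad Q x y s1 s2 -> quad Q x y s1 s2'.
Proof.
  intros [d [Hd H]] [e [He Hq]]. exists (Rmin d e). split; [now apply Rmin_pos|].
  Rmin_bounds d e.
  intros a b Ha Hb. apply H; [replace (y + sgn s2' * b - y) with (sgn s2' * b) by ring; apply sgn_abs; lra|].
  apply (H (y + sgn s2 * b)); [replace (y + sgn s2 * b - y) with (sgn s2 * b) by ring; apply sgn_abs; lra|].
  apply Hq; lra.
Qed.

Lemma corner_not_const Q x y : corner Q x y -> ~ col_const Q x /\ ~ row_const Q y.
Proof.
  intros (_ & H1 & H2). split; intros H.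
  - apply H2. intros s2. split; now apply col_const_quad.
  - apply H1. intros s1. split; now apply row_const_quad.
Qed.

Lemma reflection_law_fst P x y u1 u2 w1 w2 : reflection_law P x y u1 u2 w1 w2 ->
  w1 = u1 \/ (w1 = - u1 /\ ~ col_const P x).
Proof.
  intros [[H _]|[[Hv [H _]]|[[_ [H _]]|[Hc [H _]]]]]; auto; right; split; auto; intros HP.
  - destruct Hv as (_ & _ & Hv). apply Hv. split; now apply col_const_quad.
  - destruct Hc as (_ & s1 & s2 & Hq & Hu).
    destruct (Hu (negb s1) s2) as [E _]; [eapply col_const_quad; eassumption|]. now destruct s1.
Qed.

Lemma reflection_law_snd P x y u1 u2 w1 w2 : reflection_law P x y u1 u2 w1 w2 ->
  w2 = u2 \/ (w2 = - u2 /\ ~ row_const P y).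
Proof.
  intros [[_ H]|[[_ [_ H]]|[[Hv [_ H]]|[Hc [_ H]]]]]; auto; right; split; auto; intros HP.
  - destruct Hv as (_ & _ & Hv). apply Hv. split; now apply row_const_quad.
  - destruct Hc as (_ & s1 & s2 & Hq & Hu).
    destruct (Hu s1 (negb s2)) as [_ E]; [eapply row_const_quad; eassumption|]. now destruct s2.
Qed.

Lemma interval_locally_const a b x : x <> a -> x <> b ->
  exists d, 0 < d /\ forall x', Rabs (x' - x) < d -> (a <= x' <= b <-> a <= x <= b).
Proof.
  intros Ha Hb. exists (Rmin (Rabs (x - a)) (Rabs (x - b))).
  split; [apply Rmin_pos; apply Rabs_pos_lt; lra|]. intros x' Hx.
  Rmin_bounds (Rabs (x - a)) (Rabs (x - b)).
  assert (H1 : Rabs (x' - x) < Rabs (x - a)) by lra. assert (H2 : Rabs (x' - x) < Rabs (x - b)) by lra.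
  unfold Rabs in H1, H2. repeat destruct Rcase_abs; lra.
Qed.

Lemma is_RP_transpose P : is_RP P -> is_RP (fun x y => P y x).
Proof.
  intros [l [Hl HP]]. exists (map (fun '(a, b, c, d) => (c, d, a, b)) l). split.
  - intros a b c d Hin. apply in_map_iff in Hin.
    destruct Hin as [[[[a' b'] c'] d'] [E Hin]]. injection E as <- <- <- <-.
    specialize (Hl _ _ _ _ Hin). tauto.
  - intros x y. rewrite HP. split; intros (a & b & c & d & Hin & Hx & Hy).
    + exists c, d, a, b. split; [|tauto]. apply in_map_iff. now exists (a, b, c, d).
    + apply in_map_iff in Hin.
      destruct Hin as [[[[a' b'] c'] d'] [E Hin]]. injection E as <- <- <- <-.
      exists a', b', c', d'. tauto.
Qed.

(** Columns can change only at the left and right ends of the rectangles. *)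
Lemma RP_columns P : is_RP P -> exists Xs : list R, forall x, ~ col_const P x -> In x Xs.
Proof.
  intros [l [_ HP]].
  set (U := fun l x y => exists a b c d, In (a, b, c, d) l /\ a <= x <= b /\ c <= y <= d).
  assert (HU : exists Xs : list R, forall x, ~ In x Xs -> col_const (U l) x).
  { clear HP. induction l as [|[[[a b] c] d] l (Xs & IH)].
    - exists nil. intros z _. exists 1. split; [lra|]. intros z' _ w.
      split; intros (a & b & c & d & [] & _).
    - exists (a :: b :: Xs). intros z Hz. simpl in Hz.
      destruct (IH z) as [e1 [He1 H1]]; [tauto|].
      destruct (interval_locally_const a b z) as [e2 [He2 H2]]; [intros ->; tauto..|].
      exists (Rmin e1 e2). split; [now apply Rmin_pos|]. intros z' Hz' w.
      Rmin_bounds e1 e2.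
      specialize (H1 z' ltac:(lra) w). specialize (H2 z' ltac:(lra)).
      assert (Hcons : forall x, U ((a, b, c, d) :: l) x w <-> (a <= x <= b /\ c <= w <= d) \/ U l x w).
      { intros x. split.
        - intros (a' & b' & c' & d' & [E|Hin] & Hx & Hy).
          + injection E as -> -> -> ->. now left.
          + right. now exists a', b', c', d'.
        - intros [Hx|(a' & b' & c' & d' & Hin & Hx)].
          + exists a, b, c, d. split; [now left|easy].
          + exists a', b', c', d'. split; [now right|easy]. }
      rewrite !Hcons. tauto. }
  destruct HU as (Xs & HU). exists Xs. intros z Hz. apply NNPP. intros Hn. apply Hz.
  destruct (HU z Hn) as [e [He H]]. exists e. split; [easy|]. intros z' Hz' w.
  rewrite !HP. now apply H.
Qed.

Lemma in_hill_le V h x : well V -> in_hill V h x -> V x <= h.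
Proof.
  intros HV (a & b & Ha & HVa & Hb & HVb & Hx). destruct (Rle_dec 0 x).
  - rewrite <- HVa. apply well_incr_le; [easy|lra..].
  - rewrite <- HVb. apply well_between; [easy|]. rewrite Rmin_right, Rmax_left; lra.
Qed.

Lemma in_hill_of_le V h x : well V -> 0 <= h -> V x <= h -> in_hill V h x.
Proof.
  intros HV Hh Hx. pose proof (well_refl V HV) as HW.
  destruct (pinv_spec V HV h Hh) as [Ha HVa]. destruct (pinv_spec (refl V) HW h Hh) as [Hb HVb].
  exists (pinv V h), (pinv (refl V) h). repeat split; auto.
  - apply Rnot_lt_le. intros Hlt.
    pose proof (well_incr (refl V) HW (pinv (refl V) h) (- x) Hb ltac:(lra)) as Hi.
    rewrite HVb in Hi. unfold refl in Hi. rewrite Ropp_involutive in Hi. lra.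
  - apply Rnot_lt_le. intros Hlt. pose proof (well_incr V HV (pinv V h) x Ha Hlt). lra.
Qed.

Lemma in_hill_locally V h x : well V -> V x < h ->
  exists d, 0 < d /\ forall x', Rabs (x' - x) < d -> in_hill V h x'.
Proof.
  intros HV Hx. pose proof (well_nonneg V x HV).
  assert (HL : locally x (fun y => V y < h)).
  { apply (well_continuous V x HV (fun t => t < h)). now apply open_lt. }
  apply locally_abs_inv in HL as [d [Hd HL]]. exists d. split; [easy|].
  intros x' Hx'. apply in_hill_of_le; [easy|lra|]. left. now apply HL.
Qed.

(** Strictly inside the well the truncation does not affect nearby columns, so a change of column is
    one of [P]; otherwise the abscissa is a turning point. The same holds for rows. *)
Lemma trunc_corner V1 V2 P E th x y : well V1 -> well V2 -> corner (trunc_poly V1 V2 P E th) x y ->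
  (~ col_const P x \/ V1 x = th) /\ (~ row_const P y \/ V2 y = E - th).
Proof.
  intros HV1 HV2 Hc. pose proof (corner_not_const _ _ _ Hc) as [Hn1 Hn2].
  destruct Hc as [(_ & Hh1 & Hh2) _].
  assert (Hl1 := in_hill_le _ _ _ HV1 Hh1). assert (Hl2 := in_hill_le _ _ _ HV2 Hh2). split.
  - destruct Hl1 as [Hlt|]; [left|now right]. intros [d [Hd H]]. apply Hn1.
    destruct (in_hill_locally V1 th x HV1 Hlt) as [d' [Hd' H']].
    exists (Rmin d d'). split; [now apply Rmin_pos|]. intros x' Hx' w.
    Rmin_bounds d d'.
    specialize (H x' ltac:(lra) w). specialize (H' x' ltac:(lra)). unfold trunc_poly. tauto.
  - destruct Hl2 as [Hlt|]; [left|now right]. intros [d [Hd H]]. apply Hn2.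
    destruct (in_hill_locally V2 (E - th) y HV2 Hlt) as [d' [Hd' H']].
    exists (Rmin d d'). split; [now apply Rmin_pos|]. intros x' Hx' w.
    Rmin_bounds d d'.
    specialize (H x' ltac:(lra) w). specialize (H' x' ltac:(lra)). unfold trunc_poly. tauto.
Qed.

Lemma resonant_times V1 V2 P E th : well V1 -> well V2 -> 0 < th < E -> resonant V1 V2 P E th ->
  exists T, 0 < T /\ is_time V1 (fun x => ~ col_const P x) th T /\
    is_time V2 (fun y => ~ row_const P y) (E - th) T.
Proof.
  intros HV1 HV2 Hth (T & q1 & q2 & p1 & p2 & Htr & Hc0 & HcT).
  destruct Htr as (HT & HE & Hr1 & Hr2 & Hl1 & Hl2 & ts & Hts & Hode & Hj).
  destruct (trunc_corner _ _ _ _ _ _ _ HV1 HV2 Hc0) as [C01 C02].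
  destruct (trunc_corner _ _ _ _ _ _ _ HV1 HV2 HcT) as [CT1 CT2].
  exists T. split; [easy|]. split.
  - apply (trajectory_time V1 HV1 th ltac:(lra) T HT (fun x => ~ col_const P x) q1 p1 ts); auto.
    + intros t Ht. now apply HE.
    + now apply rlim_of_filterlim.
    + now apply llim_of_filterlim.
    + intros t Ht Hn. split; now apply Hode.
    + intros s Hs. destruct (Hj s Hs) as (Hq & _ & u1 & u2 & w1 & w2 & A1 & A2 & B1 & B2 & HR).
      split; [easy|]. exists u1, w1. split; [now apply llim_of_filterlim|].
      split; [now apply rlim_of_filterlim|]. now apply reflection_law_fst in HR.
  - apply (trajectory_time V2 HV2 (E - th) ltac:(lra) T HT (fun y => ~ row_const P y) q2 p2 ts); auto.
    + intros t Ht. now apply HE.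
    + now apply rlim_of_filterlim.
    + now apply llim_of_filterlim.
    + intros t Ht Hn. split; now apply Hode.
    + intros s Hs. destruct (Hj s Hs) as (_ & Hq & u1 & u2 & w1 & w2 & A1 & A2 & B1 & B2 & HR).
      split; [easy|]. exists u2, w2. split; [now apply llim_of_filterlim|].
      split; [now apply rlim_of_filterlim|]. now apply reflection_law_snd in HR.
Qed.

(** * Countability *)

Definition enumerable {A : Type} (P : A -> Prop) : Prop :=
  exists e : nat -> A, forall a, P a -> exists n, e n = a.

Lemma enumerable_nat : enumerable (fun _ : nat => True).
Proof. exists (fun n => n). intros n _. now exists n. Qed.

Lemma enumerable_Z : enumerable (fun _ : Z => True).
Proof.
  exists (fun n => let (i, j) := Cantor.of_nat n in (Z.of_nat i - Z.of_nat j)%Z). intros z _.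
  exists (Cantor.to_nat (Z.to_nat z, Z.to_nat (- z))). rewrite Cantor.cancel_of_to. lia.
Qed.

Lemma enumerable_In {A} (a0 : A) (l : list A) : enumerable (fun a => In a l).
Proof.
  exists (fun n => nth n l a0). intros a Ha. destruct (In_nth l a a0 Ha) as [n [_ H]]. now exists n.
Qed.

Lemma enumerable_prod {A B} (P : A -> Prop) (Q : B -> Prop) : enumerable P -> enumerable Q ->
  enumerable (fun ab => P (fst ab) /\ Q (snd ab)).
Proof.
  intros [e He] [f Hf]. exists (fun n => let (i, j) := Cantor.of_nat n in (e i, f j)).
  intros [a b] [Ha Hb]. destruct (He a Ha) as [i <-], (Hf b Hb) as [j <-].
  exists (Cantor.to_nat (i, j)). now rewrite Cantor.cancel_of_to.
Qed.

Lemma enumerable_list {A} (P : A -> Prop) : enumerable P ->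
  enumerable (fun l => forall a, In a l -> P a).
Proof.
  intros [e He].
  (* Every number decodes to a list of any prescribed length [k], so the length is coded
     separately. *)
  set (dec := fix dec k n := match k with
    | O => nil
    | S k => let (i, j) := Cantor.of_nat n in e i :: dec k j
    end).
  exists (fun n => let (k, j) := Cantor.of_nat n in dec k j). intros l Hl.
  assert (Hd : exists n, dec (length l) n = l).
  { induction l as [|a l IH]; [now exists 0%nat|].
    destruct IH as [j Hj]; [intros; apply Hl; now right|].
    destruct (He a (Hl a (or_introl eq_refl))) as [i Hi].
    exists (Cantor.to_nat (i, j)).
    change ((let (i', j') := Cantor.of_nat (Cantor.to_nat (i, j)) in e i' :: dec (length l) j') = a :: l).
    rewrite Cantor.cancel_of_to. now rewrite Hi, Hj. }
  destruct Hd as [n Hn]. exists (Cantor.to_nat (length l, n)). now rewrite Cantor.cancel_of_to.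
Qed.

Lemma countable_sub (A B : R -> Prop) : (forall x, A x -> B x) -> countable_set B -> countable_set A.
Proof. intros H [f Hf]. exists f. auto. Qed.

Lemma countable_union {I} (P : I -> Prop) (A : I -> R -> Prop) : enumerable P ->
  (forall i, P i -> countable_set (A i)) -> countable_set (fun x => exists i, P i /\ A i x).
Proof.
  intros [e He] H.
  set (F := fun i => epsilon (inhabits (fun _ : nat => 0)) (fun f : nat -> R => forall x, A i x -> exists n, f n = x)).
  exists (fun n => let (k, j) := Cantor.of_nat n in F (e k) j).
  intros x (i & Hi & Hx). destruct (He i Hi) as [k <-].
  assert (HF : forall x, A (e k) x -> exists n, F (e k) n = x).
  { exact (epsilon_spec (inhabits (fun _ : nat => 0)) _ (H (e k) Hi)). }
  destruct (HF x Hx) as [j Hj]. exists (Cantor.to_nat (k, j)). now rewrite Cantor.cancel_of_to.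
Qed.

(** * Durations as functions of the energy *)

Definition admissible (V : R -> R) (L : list (R * R)) (h : R) : Prop :=
  0 < h /\ forall xc, In xc L -> V (fst xc) < h.

Definition time_sum (V : R -> R) (L : list (R * R)) (c1 c2 h : R) : R :=
  tsum V L h + (c1 * quarter V h + c2 * quarter (refl V) h).

Lemma time_sum_analytic V L c1 c2 h : well V -> admissible V L h ->
  analytic_at (time_sum V L c1 c2) h.
Proof.
  intros HV [Hh HL]. apply analytic_plus; [now apply tsum_analytic|].
  apply analytic_plus; apply analytic_scal; apply quarter_analytic; auto. now apply well_refl.
Qed.

(** Energies admissible for both coordinates thus form an interval, where zeros of an analytic
    function are countable or everything. *)
Lemma admissible_sup V L : exists l, 0 <= l /\ forall h, admissible V L h <-> l < h.
Proof.
  destruct (list_sup L (fun xc => V (fst xc))) as (l & Hl & H1 & H2).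
  exists l. split; [easy|]. intros h. split.
  - intros [Hh HL]. now apply H2.
  - intros Hh. split; [lra|]. intros xc Hxc. specialize (H1 xc Hxc). simpl in H1. lra.
Qed.

Lemma time_sum_reduction V1 V2 L1 L2 c1 c2 d1 d2 E l2 : well V1 -> well V2 ->
  (forall h, admissible V2 L2 h <-> l2 < h) ->
  (forall h, admissible V1 L1 h -> l2 < E - h -> time_sum V1 L1 c1 c2 h = time_sum V2 L2 d1 d2 (E - h)) ->
  (exists h, admissible V1 L1 h /\ l2 < E - h) ->
  forall h, 0 < h < E - l2 -> c1 * quarter V1 h + c2 * quarter (refl V1) h = time_sum V2 L2 d1 d2 (E - h).
Proof.
  intros HV1 HV2 Hl2 H [h0 [Hh0 Hh0']].
  assert (HL : forall xc, In xc L1 -> V1 (fst xc) < E - l2).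
  { intros xc Hxc. apply Rlt_trans with h0; [now apply Hh0|lra]. }
  apply (tsum_reduction V1 HV1 (length L1) L1 c1 c2 (fun h => time_sum V2 L2 d1 d2 (E - h)) (E - l2)).
  - lia.
  - destruct Hh0. lra.
  - intros h Hh. apply analytic_comp_opp, time_sum_analytic; [easy|]. apply Hl2. lra.
  - exact HL.
  - intros h Hh HL1. apply H; [|lra]. split; [lra|easy].
Qed.

(** * Scaled wells *)

Lemma travel_scale V1 V2 om ta x th : well V1 -> well V2 -> 0 < om -> 0 < ta ->
  (forall x, V1 x = om * V2 (ta * x)) -> V1 x < th ->
  travel V1 x th = / (ta * sqrt om) * travel V2 (ta * x) (th / om).
Proof.
  intros HV1 HV2 Hom Hta HV Hx.
  assert (Hso : 0 < sqrt om) by now apply sqrt_lt_R0.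
  assert (Hx2 : forall s, V1 s < th -> V2 (ta * s) < th / om).
  { intros s Hs. rewrite HV in Hs. apply (Rmult_lt_reg_l om); [easy|].
    replace (om * (th / om)) with th by (field; lra). easy. }
  set (f := fun s => / sqrt (2 * (th / om - V2 s))).
  assert (Hex : ex_RInt f (ta * 0 + 0) (ta * x + 0)).
  { rewrite Rmult_0_r, !Rplus_0_r. apply travel_ex; [easy|]. now apply Hx2. }
  assert (E := RInt_comp_lin (V := R_CompleteNormedModule) f ta 0 0 x Hex).
  rewrite Rmult_0_r, !Rplus_0_r in E. fold (travel V2 (ta * x) (th / om)) in E.
  unfold travel at 2. fold f. rewrite <- E.
  assert (Hex2 := ex_RInt_comp_lin (V := R_NormedModule) f ta 0 0 x Hex).
  assert (E2 := RInt_scal (V := R_CompleteNormedModule) _ _ _ (/ (ta * sqrt om)) Hex2).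
  unfold scal in E2; simpl in E2; unfold mult in E2; simpl in E2.
  unfold scal; simpl; unfold mult; simpl. rewrite <- E2.
  apply RInt_ext. intros s Hs. eqR. unfold f. rewrite Rplus_0_r.
  assert (Hs1 : V1 s < th).
  { apply Rle_lt_trans with (V1 x); [|easy]. apply well_between; [easy|lra]. }
  assert (Hp := Hx2 s Hs1).
  replace (2 * (th - V1 s)) with (om * (2 * (th / om - V2 (ta * s)))) by (rewrite HV; field; lra).
  rewrite sqrt_mult by lra. assert (0 < sqrt (2 * (th / om - V2 (ta * s)))) by (apply sqrt_lt_R0; lra).
  field. lra.
Qed.

(** The cut in [quarter] hides the scaling, so it is read off times of flight as [x] tends to the
    turning point in both wells at once. *)
Lemma quarter_scale V1 V2 om ta th : well V1 -> well V2 -> 0 < om -> 0 < ta ->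
  (forall x, V1 x = om * V2 (ta * x)) -> 0 < th ->
  quarter V1 th = / (ta * sqrt om) * quarter V2 (th / om).
Proof.
  intros HV1 HV2 Hom Hta HV Hth.
  assert (Hso : 0 < sqrt om) by now apply sqrt_lt_R0.
  set (k := / (ta * sqrt om)).
  assert (Hk : 0 < k) by (apply Rinv_0_lt_compat, Rmult_lt_0_compat; lra).
  set (x0 := pinv V1 th). assert (Hx0 : 0 < x0) by (apply pinv_pos; easy).
  assert (E0 : V1 x0 = th) by (apply (pinv_spec V1 HV1); lra).
  assert (E1 : V2 (ta * x0) = th / om) by (rewrite <- E0, HV; field; lra).
  apply NNPP. intros Hn.
  set (e := Rabs (quarter V1 th - k * quarter V2 (th / om))).
  assert (He : 0 < e) by (apply Rabs_pos_lt; lra).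
  destruct (travel_to_turning V1 th x0 (e / 2)) as [d1 [Hd1 H1]]; auto; [lra|].
  destruct (travel_to_turning V2 (th / om) (ta * x0) (e / 2 / k)) as [d2 [Hd2 H2]]; auto.
  { now apply Rdiv_lt_0_compat. } { apply Rmult_lt_0_compat; lra. } { apply Rdiv_lt_0_compat; lra. }
  set (m := Rmin x0 (Rmin d1 (d2 / ta))).
  assert (Hd2t : 0 < d2 / ta) by now apply Rdiv_lt_0_compat.
  assert (Hm : 0 < m /\ m <= x0 /\ m <= d1 /\ m <= d2 / ta).
  { unfold m. split; [repeat apply Rmin_pos; lra|]. Rmin_bounds x0 (Rmin d1 (d2 / ta)). Rmin_bounds d1 (d2 / ta). lra. }
  set (x := x0 - m / 2).
  assert (Hx : V1 x < th) by (rewrite <- E0; apply well_incr; [easy|unfold x; lra..]).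
  assert (Hx2 : V2 (ta * x) < th / om).
  { rewrite HV in Hx. apply (Rmult_lt_reg_l om); [easy|]. replace (om * (th / om)) with th by (field; lra). easy. }
  specialize (H1 x). specialize (H2 (ta * x)).
  assert (B1 := H1 ltac:(unfold x; apply Rabs_def1; lra) Hx).
  assert (Hmt : ta * m <= d2).
  { replace d2 with (ta * (d2 / ta)) by (field; lra). apply Rmult_le_compat_l; lra. }
  assert (B2 := H2 ltac:(unfold x; apply Rabs_def1; nra) Hx2).
  rewrite (travel_scale V1 V2 om ta x th) in B1 by easy. fold k in B1.
  set (t := travel V2 (ta * x) (th / om)) in *.
  assert (B3 : Rabs (k * t - k * quarter V2 (th / om)) < e / 2).
  { rewrite <- Rmult_minus_distr_l, Rabs_mult, (Rabs_pos_eq k) by lra.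
    replace (e / 2) with (k * (e / 2 / k)) by (field; lra). now apply Rmult_lt_compat_l. }
  assert (e < e); [|lra]. unfold e at 1.
  replace (quarter V1 th - k * quarter V2 (th / om)) with
    ((k * t - k * quarter V2 (th / om)) - (k * t - quarter V1 th)) by ring.
  eapply Rle_lt_trans; [apply Rabs_triang|]. rewrite Rabs_Ropp. lra.
Qed.

(** Either outcome of [quarter_symmetric_of_regular] leaves a multiple of the half period
    [a + b]. *)
Lemma half_sum c1 c2 a b : c1 = c2 \/ a = b -> c1 * a + c2 * b = (c1 + c2) / 2 * (a + b).
Proof. intros [-> | ->]; field. Qed.

Lemma irrational_ratio r (N M : nat) : irrational r -> INR N = r * INR M -> M = 0%nat.
Proof.
  intros Hr E. destruct M as [|M]; [easy|exfalso].
  apply (Hr (Z.of_nat N # Pos.of_succ_nat M)). unfold Q2R, Qnum, Qden.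
  change (Z.pos (Pos.of_succ_nat M)) with (Z.of_nat (S M)). rewrite <- !INR_IZR_INZ, E.
  field. apply not_0_INR. easy.
Qed.

Lemma Derive_2_refl V : well V -> Derive_n (refl V) 2 0 = Derive_n V 2 0.
Proof.
  intros HV. simpl.
  change (Derive (fun x => Derive (fun x => refl V x) x) 0 = Derive (fun x => Derive (fun x => V x) x) 0).
  rewrite (Derive_ext _ (fun x => - Derive V (- x))) by (intros; now apply Derive_refl).
  apply is_derive_unique.
  replace (Derive (fun x => Derive (fun x => V x) x) 0) with (- (-1 * Derive (Derive V) 0)).
  - apply (is_derive_opp (V := R_NormedModule) (fun x => Derive V (- x))).
    apply (is_derive_comp (Derive V) Ropp).
    + rewrite Ropp_0. apply Derive_correct, analytic_ex_derive, analytic_Derive, HV.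
    + auto_derive; auto.
  - replace (Derive (fun x => Derive (fun x => V x) x) 0) with (Derive (Derive V) 0) by reflexivity. ring.
Qed.

(* At [th = om * E / (1 + om)] the energy [E - th] of the second oscillator equals [th / om],
   so both sides are integer multiples of the same half period, up to the factor [ta * sqrt om]. *)
Lemma scaled_quarters_zero V1 V2 om ta (n1 m1 n2 m2 : nat) E : well V1 -> well V2 ->
  Derive_n V1 2 0 <> 0 -> Derive_n V2 2 0 <> 0 -> 0 < E -> 0 < om -> 0 < ta ->
  (forall x, V1 x = om * V2 (ta * x)) -> irrational (ta * sqrt om) ->
  (forall h, 0 < h < E -> INR n1 * quarter V1 h + INR m1 * quarter (refl V1) h =
     INR n2 * quarter V2 (E - h) + INR m2 * quarter (refl V2) (E - h)) ->
  n1 = 0%nat /\ m1 = 0%nat.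
Proof.
  intros HV1 HV2 D1 D2 HE Hom Hta HV Hirr H.
  pose proof (well_refl V1 HV1) as HW1. pose proof (well_refl V2 HV2) as HW2.
  assert (Hso : 0 < sqrt om) by now apply sqrt_lt_R0.
  assert (S1 := quarter_symmetric_of_regular V1 (INR n1) (INR m1)
    (fun h => INR n2 * quarter V2 (E - h) + INR m2 * quarter (refl V2) (E - h)) E HV1 D1 HE).
  assert (S2 := quarter_symmetric_of_regular V2 (INR n2) (INR m2)
    (fun h => INR n1 * quarter V1 (E - h) + INR m1 * quarter (refl V1) (E - h)) E HV2 D2 HE).
  assert (Han : forall U (a b : R), well U -> analytic_at (fun h => a * quarter U (E - h) + b * quarter (refl U) (E - h)) 0).
  { intros U a b HU. apply analytic_plus; apply analytic_scal.
    - apply analytic_comp_opp, quarter_analytic; [easy|lra].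
    - apply analytic_comp_opp, quarter_analytic; [now apply well_refl|lra]. }
  specialize (S1 (Han V2 _ _ HV2) H).
  specialize (S2 (Han V1 _ _ HV1)).
  assert (H' : forall h, 0 < h < E -> INR n2 * quarter V2 h + INR m2 * quarter (refl V2) h =
     INR n1 * quarter V1 (E - h) + INR m1 * quarter (refl V1) (E - h)).
  { intros h Hh. rewrite (H (E - h)) by lra. now replace (E - (E - h)) with h by ring. }
  specialize (S2 H').
  set (hs := E / (1 + om)). set (th := om * hs).
  assert (Hhs : 0 < hs) by (apply Rdiv_lt_0_compat; lra).
  assert (Hth : 0 < th) by now apply Rmult_lt_0_compat.
  assert (HEth : E - th = hs) by (unfold th, hs; field; lra).
  specialize (H th ltac:(lra)). rewrite HEth in H.
  rewrite (half_sum (INR n1) (INR m1)) in H by (destruct S1 as [|S1]; [now left|right; now apply S1]).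
  rewrite (half_sum (INR n2) (INR m2)) in H by (destruct S2 as [|S2]; [now left|right; now apply S2]).
  assert (Hq : forall U1 U2, well U1 -> well U2 -> (forall x, U1 x = om * U2 (ta * x)) ->
     quarter U1 th = / (ta * sqrt om) * quarter U2 hs).
  { intros U1 U2 HU1 HU2 HU. rewrite (quarter_scale U1 U2 om ta th) by easy.
    do 2 f_equal. unfold th. field. lra. }
  rewrite (Hq V1 V2) in H by easy.
  rewrite (Hq (refl V1) (refl V2)) in H;
    [|easy|easy|intros x; unfold refl; rewrite HV; do 2 f_equal; ring].
  set (r := ta * sqrt om) in *. assert (Hr : 0 < r) by now apply Rmult_lt_0_compat.
  set (P := quarter V2 hs + quarter (refl V2) hs).
  assert (HP : 0 < P) by (apply Rplus_lt_0_compat; now apply quarter_pos).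
  assert (Hnm : INR (n1 + m1) = r * INR (n2 + m2)).
  { rewrite !plus_INR. apply (Rmult_eq_reg_r (P / (2 * r))).
    - replace (r * (INR n2 + INR m2) * (P / (2 * r))) with ((INR n2 + INR m2) / 2 * P) by (field; lra).
      unfold P at 2. rewrite <- H. unfold P. field. lra.
    - apply Rgt_not_eq, Rdiv_lt_0_compat; lra. }
  assert (Hz := irrational_ratio r _ _ Hirr Hnm). rewrite Hz in Hnm. simpl in Hnm. rewrite Rmult_0_r in Hnm.
  apply INR_eq with (m := 0%nat) in Hnm. lia.
Qed.

(** * Excluding identical durations *)

Definition incommensurable (V1 V2 : R -> R) : Prop :=
  Derive_n V1 2 0 = 0 \/ Derive_n V2 2 0 = 0 \/
  (Derive_n V1 2 0 <> 0 /\ Derive_n V2 2 0 <> 0 /\ exists om ta, 0 < om /\ ta <> 0 /\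
     (forall x, V1 x = om * V2 (ta * x)) /\ irrational (Rabs ta * sqrt om)).

Definition times_agree V1 V2 L1 L2 c1 c2 d1 d2 E : Prop :=
  forall h, admissible V1 L1 h -> admissible V2 L2 (E - h) ->
    time_sum V1 L1 c1 c2 h = time_sum V2 L2 d1 d2 (E - h).

Lemma times_agree_sym V1 V2 L1 L2 c1 c2 d1 d2 E :
  times_agree V1 V2 L1 L2 c1 c2 d1 d2 E -> times_agree V2 V1 L2 L1 d1 d2 c1 c2 E.
Proof.
  intros H h H1 H2. rewrite (H (E - h)); replace (E - (E - h)) with h by ring; easy.
Qed.

Lemma times_agree_reduced V1 V2 L1 L2 c1 c2 d1 d2 E h0 : well V1 -> well V2 ->
  times_agree V1 V2 L1 L2 c1 c2 d1 d2 E -> admissible V1 L1 h0 -> admissible V2 L2 (E - h0) ->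
  forall h, 0 < h -> admissible V2 L2 (E - h) ->
  c1 * quarter V1 h + c2 * quarter (refl V1) h = time_sum V2 L2 d1 d2 (E - h).
Proof.
  intros HV1 HV2 H A1 A2 h Hh A. destruct (admissible_sup V2 L2) as [l2 [_ Hl2]].
  apply (time_sum_reduction V1 V2 L1 L2 c1 c2 d1 d2 E l2); auto.
  - intros h' Hh' Hl. apply H; [easy|]. now apply Hl2.
  - exists h0. split; [easy|]. now apply Hl2.
  - apply Hl2 in A. lra.
Qed.

Lemma times_agree_flat V1 V2 L1 L2 (n1 m1 : nat) d1 d2 E h0 : well V1 -> well V2 ->
  Derive_n V1 2 0 = 0 -> times_agree V1 V2 L1 L2 (INR n1) (INR m1) d1 d2 E ->
  admissible V1 L1 h0 -> admissible V2 L2 (E - h0) -> time_sum V2 L2 d1 d2 (E - h0) = 0.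
Proof.
  intros HV1 HV2 HD H A1 A2.
  assert (HR := times_agree_reduced _ _ _ _ _ _ _ _ _ h0 HV1 HV2 H A1 A2).
  assert (Hh0 : 0 < h0) by apply A1.
  (* Lowering [h] raises the energy of the second coordinate, so its duration stays analytic down to
     [h = 0], where the flat side would blow up. *)
  assert (Hadm : forall h, h <= h0 -> admissible V2 L2 (E - h)).
  { intros h Hh. destruct A2 as [A2 A3]. split; [lra|]. intros xc Hxc. specialize (A3 xc Hxc). lra. }
  destruct (quarter_bounded_zero V1 (INR n1) (INR m1) (fun h => time_sum V2 L2 d1 d2 (E - h)) h0)
    as [E1 E2]; auto; try apply pos_INR.
  - apply analytic_continuous, analytic_comp_opp, time_sum_analytic; [easy|]. apply Hadm. lra.
  - intros h Hh. apply HR; [lra|]. apply Hadm. lra.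
  - rewrite <- HR by easy. rewrite E1, E2. ring.
Qed.

(** An identity between the two durations is not absurd in itself; it forces the duration to be 0,
    which no trajectory has. *)
Lemma times_agree_impossible V1 V2 L1 L2 (n1 m1 n2 m2 : nat) E h0 : well V1 -> well V2 ->
  incommensurable V1 V2 -> times_agree V1 V2 L1 L2 (INR n1) (INR m1) (INR n2) (INR m2) E ->
  admissible V1 L1 h0 -> admissible V2 L2 (E - h0) -> time_sum V1 L1 (INR n1) (INR m1) h0 = 0.
Proof.
  intros HV1 HV2 Hinc H A1 A2.
  pose proof (well_refl V1 HV1) as HW1. pose proof (well_refl V2 HV2) as HW2.
  assert (A1' : admissible V1 L1 (E - (E - h0))) by (now replace (E - (E - h0)) with h0 by ring).
  assert (Hsym := times_agree_sym _ _ _ _ _ _ _ _ _ H).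
  destruct Hinc as [D1|[D2|(D1 & D2 & om & ta & Hom & Hta & HV & Hirr)]].
  - rewrite H by easy. now apply (times_agree_flat V1 V2 L1 L2 n1 m1).
  - replace h0 with (E - (E - h0)) by ring. now apply (times_agree_flat V2 V1 L2 L1 n2 m2).
  - assert (HE : 0 < E) by (destruct A1, A2; lra).
    assert (HR1 := times_agree_reduced _ _ _ _ _ _ _ _ _ h0 HV1 HV2 H A1 A2).
    assert (HR2 : forall h, 0 < h < E -> INR n1 * quarter V1 h + INR m1 * quarter (refl V1) h =
        INR n2 * quarter V2 (E - h) + INR m2 * quarter (refl V2) (E - h)).
    (* With the abscissae of the first coordinate gone, the roles are exchanged and the reduction
       removes those of the second, which extends the identity to all of [(0, E)]. *)
    { assert (Hag : times_agree V2 V1 L2 nil (INR n2) (INR m2) (INR n1) (INR m1) E).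
      { intros h B1 B2. assert (Rh := HR1 (E - h)). replace (E - (E - h)) with h in Rh by ring.
        rewrite <- Rh; [unfold time_sum; simpl; ring | apply B2 | exact B1]. }
      intros h Hh.
      assert (A3 : admissible V1 nil (E - (E - h0))) by (split; [apply A1' | intros _ []]).
      assert (HR3 := times_agree_reduced V2 V1 L2 nil _ _ _ _ E (E - h0) HV2 HV1 Hag A2 A3 (E - h)).
      replace (E - (E - h)) with h in HR3 by ring.
      rewrite HR3; [unfold time_sum; simpl; ring | lra | split; [lra | intros _ []]]. }
    assert (Hz : n1 = 0%nat /\ m1 = 0%nat).
    { destruct (Rtotal_order ta 0) as [Ht|[Ht|Ht]]; [|easy|].
      (* For negative [ta] the second well is reflected, which exchanges its two quarter periods and
         so [n2] and [m2]. *)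
      - apply (scaled_quarters_zero V1 (refl V2) om (- ta) n1 m1 m2 n2 E); auto; try lra.
        + now rewrite Derive_2_refl.
        + intros x. unfold refl. rewrite HV. do 2 f_equal. ring.
        + now rewrite <- (Rabs_left ta).
        + intros h Hh. rewrite HR2, refl_refl by easy. ring.
      - apply (scaled_quarters_zero V1 V2 om ta n1 m1 n2 m2 E); auto.
        now rewrite <- (Rabs_pos_eq ta) by lra. }
    destruct Hz as [-> ->]. rewrite H by easy. rewrite <- HR1; [simpl; ring|apply A1|easy].
Qed.

Lemma word_times_countable V1 V2 L1 L2 (n1 m1 n2 m2 : nat) E : well V1 -> well V2 ->
  incommensurable V1 V2 ->
  countable_set (fun h => admissible V1 L1 h /\ admissible V2 L2 (E - h) /\
    0 < time_sum V1 L1 (INR n1) (INR m1) h /\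
    time_sum V1 L1 (INR n1) (INR m1) h = time_sum V2 L2 (INR n2) (INR m2) (E - h)).
Proof.
  intros HV1 HV2 Hinc.
  destruct (admissible_sup V1 L1) as [l1 [_ Hl1]]. destruct (admissible_sup V2 L2) as [l2 [_ Hl2]].
  destruct (analytic_zeros_countable (fun h => time_sum V1 L1 (INR n1) (INR m1) h -
    time_sum V2 L2 (INR n2) (INR m2) (E - h)) l1 (E - l2)) as [Hc|Hz].
  - intros h Hh. apply analytic_minus.
    + apply time_sum_analytic; [easy|]. now apply Hl1.
    + apply analytic_comp_opp, time_sum_analytic; [easy|]. apply Hl2. lra.
  - revert Hc. apply countable_sub. intros h (A1 & A2 & _ & Heq).
    apply Hl1 in A1. apply Hl2 in A2. split; lra.
  (* The set is empty here, so any sequence enumerates it. *)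
  - exists (fun _ => 0). intros h (A1 & A2 & Hpos & _). exfalso.
    enough (time_sum V1 L1 (INR n1) (INR m1) h = 0) by lra.
    apply (times_agree_impossible V1 V2 L1 L2 n1 m1 n2 m2 E h); auto.
    intros h' B1 B2. apply Hl1 in B1. apply Hl2 in B2. specialize (Hz h' ltac:(lra)). simpl in Hz. lra.
Qed.

Lemma resonant_countable V1 V2 P E : well V1 -> well V2 -> incommensurable V1 V2 -> is_RP P ->
  countable_set (fun th => 0 < th < E /\ resonant V1 V2 P E th).
Proof.
  intros HV1 HV2 Hinc HP. destruct (RP_columns P HP) as (Xs & HX).
  destruct (RP_columns _ (is_RP_transpose P HP)) as (Ys & HY).
  (* The conjuncts [True] give the predicates the shape delivered by [enumerable_prod]. *)
  set (word := fun (Zs : list R) => fun w : list (R * Z) * (nat * nat) =>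
     (forall xc, In xc (fst w) -> In (fst xc) Zs /\ True) /\ (True /\ True)).
  assert (Hw : forall Zs, enumerable (word Zs)).
  { intros Zs. apply (enumerable_prod (fun L => forall xc : R * Z, In xc L -> In (fst xc) Zs /\ True)
      (fun _ : nat * nat => True /\ True)).
    - apply enumerable_list. apply (enumerable_prod (fun x => In x Zs) (fun _ : Z => True)).
      + apply (enumerable_In 0).
      + apply enumerable_Z.
    - apply (enumerable_prod (fun _ : nat => True) (fun _ : nat => True)); apply enumerable_nat. }
  set (zero_set := fun (w : (list (R * Z) * (nat * nat)) * (list (R * Z) * (nat * nat))) (h : R) =>
    let '((L1, (n1, m1)), (L2, (n2, m2))) := w in
    admissible V1 (zcoef L1) h /\ admissible V2 (zcoef L2) (E - h) /\
    0 < time_sum V1 (zcoef L1) (INR n1) (INR m1) h /\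
    time_sum V1 (zcoef L1) (INR n1) (INR m1) h = time_sum V2 (zcoef L2) (INR n2) (INR m2) (E - h)).
  apply countable_sub with (fun h => exists w, (word Xs (fst w) /\ word Ys (snd w)) /\ zero_set w h).
  - intros h [Hh Hres].
    destruct (resonant_times V1 V2 P E h HV1 HV2 Hh Hres) as (T & HT & (L1 & n1 & m1 & HL1 & E1) & (L2 & n2 & m2 & HL2 & E2)).
    exists ((L1, (n1, m1)), (L2, (n2, m2))). split; [split|].
    + split; [|easy]. intros xc Hxc. split; [|easy]. apply HX. now apply HL1.
    + split; [|easy]. intros xc Hxc. split; [|easy]. apply HY. now apply HL2.
    + assert (Hadm : forall V L t, 0 < t -> (forall xc : R * Z, In xc L -> V (fst xc) < t) -> admissible V (zcoef L) t).
      { intros V L t Ht HL. split; [easy|]. intros xc Hxc. apply in_map_iff in Hxc.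
        destruct Hxc as [yc [<- Hyc]]. simpl. now apply HL. }
      split; [apply Hadm; [easy|]; intros; now apply HL1|].
      split; [apply Hadm; [lra|]; intros; now apply HL2|].
      unfold time_word in E1, E2. unfold time_sum. rewrite <- E1, <- E2. now split.
  - apply countable_union.
    + now apply enumerable_prod.
    + intros [[L1 [n1 m1]] [L2 [n2 m2]]] _. now apply word_times_countable.
Qed.

Theorem theorem1 (V1 V2 : R -> R) (m1 m2 : nat) :
  UM V1 -> UM V2 -> is_deg0 V1 m1 -> is_deg0 V2 m2 ->
  ((m1 > 2)%nat \/ (m2 > 2)%nat \/
   (m1 = 2%nat /\ m2 = 2%nat /\
    exists omega tau : R, 0 < omega /\ tau <> 0 /\
      (forall x, V1 x = omega * V2 (tau * x)) /\
      sqrt (Derive_n V1 2 0 / Derive_n V2 2 0) = Rabs tau * sqrt omega /\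
      irrational (sqrt (Derive_n V1 2 0 / Derive_n V2 2 0)))) ->
  forall P : R -> R -> Prop, is_RP P ->
  forall E : R, ~ resonant_energy_level V1 V2 P E.
Proof.
  intros H1 H2 [Hd1 Hl1] [Hd2 Hl2] Hcase P HP E [_ Hunc]. apply Hunc.
  apply resonant_countable; [now apply UM_well | now apply UM_well | | easy].
  destruct Hcase as [Hm|[Hm|(-> & -> & om & ta & Hom & Hta & HV & Hr & Hirr)]].
  - left. now apply Hl1.
  - right; left. now apply Hl2.
  - right; right. split; [easy|]. split; [easy|]. exists om, ta. rewrite Hr in Hirr. auto.
Qed.
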